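(* Let $\Omega\subset\mathbb{R}^n$ be a bounded domain with Lipschitz boundary and let $p>n$ (with $p<+\infty$). Suppose that $y_k\rightharpoonup y$ weakly in $W^{1,p}(\Omega;\mathbb{R}^n)$, that for all $k\in\mathbb{N}$ $\det\nabla y_k>0$ a.e. in $\Omega$, and that $\{(\nabla y_k)^{-1}\}_{k\in\mathbb{N}}\subset L^p(\Omega;\mathbb{R}^{n\times n})$ is bounded. Then $\det\nabla y>0$ a.e. in $\Omega$. Moreover, every Young measure $\nu=\{\nu_x\}_{x\in\Omega}$ generated by a subsequence of $\{\nabla y_k\}_{k\in\mathbb{N}}$ is supported on the set $\mathbb{R}^{n\times n}_{\rm inv+}$ of matrices with positive determinant, i.e. $\nu_x(\mathbb{R}^{n\times n}_{\rm inv+})=1$ for a.a. $x\in\Omega$.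
   Context: $(\nabla y_k)^{-1}$ is the pointwise matrix inverse. A Young measure is a family $\nu=\{\nu_x\}_{x\in\Omega}$ of Radon probability measures on $\mathbb{R}^{n\times n}$ such that $x\mapsto\int v\,\mathrm{d}\nu_x$ is measurable for all $v\in C_0(\mathbb{R}^{n\times n})$. A sequence $\{Y_k\}$ bounded in $L^p(\Omega;\mathbb{R}^{n\times n})$ generates $\nu$ if for every $v\in C(\mathbb{R}^{n\times n})$ with $\lim_{|s|\to\infty}v(s)/|s|^p=0$, $v\circ Y_k\rightharpoonup\int v(s)\,\nu_x(\mathrm{d}s)$ weakly in $L^1(\Omega)$. *)

(* Defs.v *)
From HB Require Import structures.
From mathcomp Require Import all_boot all_order all_algebra.
From mathcomp Require Import all_classical all_reals all_analysis.
Set Implicit Arguments.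
Unset Strict Implicit.
Unset Printing Implicit Defensive.
Import Order.TTheory GRing.Theory Num.Theory.
Import numFieldNormedType.Exports.
Local Open Scope classical_set_scope.
Local Open Scope ring_scope.

Section LebesgueMeasure.
Context (R : realType).

Definition cylinders n : set (set 'rV[R]_n) :=
  [set A | exists i (B : set (measurableTypeR R)),
     measurable B /\ A = [set x : 'rV[R]_n | B (x ord0 i)]].

Definition row_space n := g_sigma_algebraType (@cylinders n).

Definition row_cons n (z : measurableTypeR R * row_space n) : row_space n.+1 :=
  \row_i oapp (z.2 ord0) z.1 (unlift ord0 i).

Lemma measurable_row_cons n : measurable_fun setT (@row_cons n).
Proof.
apply: (@measurability _ _ _ _ setT (@row_cons n) (@cylinders n.+1) erefl)
  => _ [_ [i [B [mB ->]]] <-].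
rewrite setTI; case: (unliftP ord0 i) => [j ij|i0].
  have -> : @row_cons n @^-1` [set x : 'rV_n.+1 | B (x ord0 i)] =
      snd @^-1` ([set x : 'rV_n | B (x ord0 j)] : set (row_space n)).
    by apply/seteqP; split=> z /=; rewrite mxE ij liftK.
  rewrite -[X in measurable X]setTI; apply: measurable_snd => //.
  by apply: sub_sigma_algebra; exists j, B.
have -> : @row_cons n @^-1` [set x : 'rV_n.+1| B (x ord0 i)] = fst @^-1` B.
  by apply/seteqP; split=> z /=; rewrite mxE i0 unlift_none.
by rewrite -[X in measurable X]setTI; exact: measurable_fst.
Qed.

Definition row_uncons n (x : row_space n.+1) : measurableTypeR R * row_space n :=
  (x ord0 ord0, \row_j x ord0 (lift ord0 j)).

Lemma row_consK n : cancel (@row_cons n) (@row_uncons n).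
Proof.
move=> [t v]; congr pair; first by rewrite mxE unlift_none.
by apply/rowP => j; rewrite !mxE liftK.
Qed.

Lemma measurable_coord n (i : 'I_n) :
  measurable_fun setT
    (fun x : row_space n => (x : 'rV[R]_n) ord0 i : measurableTypeR R).
Proof.
move=> _ B mB; rewrite setTI.
by apply: sub_sigma_algebra; exists i, B.
Qed.

Lemma measurable_row_uncons n : measurable_fun setT (@row_uncons n).
Proof.
apply/measurable_fun_pairP; split; first exact: measurable_coord.
apply: (@measurability _ _ _ _ setT (snd \o @row_uncons n)
  (@cylinders n) erefl) => _ [_ [i [B [mB ->]]] <-].
rewrite setTI [X in measurable X](_ : _ =
    setT `&` (fun x : 'rV_n.+1 => x ord0 (lift ord0 i)) @^-1` B).
  exact: measurable_coord.
by rewrite setTI; apply/seteqP; split=> x /=; rewrite mxE.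
Qed.

Section step.
Context n (mu : {sigma_finite_measure set (row_space n) -> \bar R}).

Definition lebesgue_step : set (row_space n.+1) -> \bar R :=
  pushforward (@lebesgue_measure R \x mu)%E (@row_cons n).

Let lebesgue_step0 : lebesgue_step set0 = 0.
Proof. by rewrite /lebesgue_step /pushforward preimage_set0 measure0. Qed.

Let lebesgue_step_ge0 A : (0 <= lebesgue_step A)%E.
Proof. by rewrite /lebesgue_step /pushforward; exact: measure_ge0. Qed.

Let lebesgue_step_sigma_additive : semi_sigma_additive lebesgue_step.
Proof.
move=> F mF tF mUF; rewrite /lebesgue_step /pushforward preimage_bigcup.
have mcons A : measurable A -> measurable (@row_cons n @^-1` A).
  by move=> mA; rewrite -[X in measurable X]setTI; exact: measurable_row_cons.
apply: measure_semi_sigma_additive.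
- by move=> k; exact: mcons.
- apply/trivIsetP => i j _ _ ij; rewrite -preimage_setI.
  by move/trivIsetP : tF => /(_ _ _ _ _ ij) ->//; rewrite preimage_set0.
- by rewrite -preimage_bigcup; exact: mcons.
Qed.

HB.instance Definition _ := isMeasure.Build _ _ _ lebesgue_step
  lebesgue_step0 lebesgue_step_ge0 lebesgue_step_sigma_additive.

Let lebesgue_step_sigma_finite : sigma_finite setT lebesgue_step.
Proof.
have /sigma_finiteP[F [TF ndF Foo]] := sigma_finiteT (@lebesgue_measure R).
have /sigma_finiteP[G [TG ndG Goo]] := sigma_finiteT mu.
exists (fun k => @row_uncons n @^-1` (F k `*` G k)).
  apply/seteqP; split=> // x _.
  have [k _ Fk] : (\bigcup_k F k) (row_uncons x).1 by rewrite -TF.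
  have [l _ Gl] : (\bigcup_k G k) (row_uncons x).2 by rewrite -TG.
  exists (maxn k l) => //; split.
    by move: Fk; exact/subsetPset/ndF/leq_maxl.
  by move: Gl; exact/subsetPset/ndG/leq_maxr.
move=> k; have [mF Fk] := Foo k; have [mG Gk] := Goo k; split.
  rewrite -[X in measurable X]setTI; apply: measurable_row_uncons => //.
  exact: measurableX.
rewrite /lebesgue_step /pushforward -comp_preimage.
rewrite (_ : _ \o _ = id) ?preimage_id; last first.
  by apply/funext => z; exact: row_consK.
by rewrite product_measure1E// lte_mul_pinfty// ge0_fin_numE.
Qed.

HB.instance Definition _ :=
  Measure_isSigmaFinite.Build _ _ _ lebesgue_step lebesgue_step_sigma_finite.
End step.

Fixpoint product_lebesgue n :
    {sigma_finite_measure set (row_space n) -> \bar R} :=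
  if n is n'.+1 then lebesgue_step (product_lebesgue n')
  else \d_(0 : row_space 0).

(* The completed measure lives on the Caratheodory sigma-algebra of the outer
   measure induced by the product measure, i.e. on the Lebesgue measurable
   subsets of R^n. *)
Definition lebesgueRn n :=
  @completed_measure_extension _ _ _ (product_lebesgue n).
HB.instance Definition _ n := Measure.on (@lebesgueRn n).

Definition Rn n := caratheodory_type (product_lebesgue n)^*%mu.

(* Characterizes the measure: a box has the product of its side lengths. *)
Lemma lebesgueRn_box n (B : 'I_n -> set (measurableTypeR R)) :
  (forall i, measurable (B i)) ->
  @lebesgueRn n [set x : 'rV[R]_n | forall i, B i (x ord0 i)] =
  (\prod_(i < n) @lebesgue_measure R (B i))%E.
Proof.
move=> mB.
suff [mX PX] : @measurable _ (row_space n)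
    [set x : 'rV[R]_n | forall i, B i (x ord0 i)] /\
  product_lebesgue n [set x : 'rV[R]_n | forall i, B i (x ord0 i)] =
  (\prod_(i < n) @lebesgue_measure R (B i))%E.
  by rewrite -PX; exact: measurable_mu_extE.
elim: n B mB => [|n IH] B mB.
  rewrite big_ord0 (_ : [set x | _] = setT); last first.
    by apply/seteqP; split=> // x _ [].
  by split; [exact: measurableT|rewrite /= diracT].
have [mX PX] := IH (fun j => B (lift ord0 j)) (fun j => mB _).
set X : set (row_space n) := [set x | _] in mX PX.
have XE : ([set x | forall i, B i (x ord0 i)] : set (row_space n.+1)) =
    @row_uncons n @^-1` (B ord0 `*` X).
  apply/seteqP; split=> [x Bx|x [/= B0 BX] i].
    by split=> [|j /=]; rewrite ?mxE; exact: Bx.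
  by case: (unliftP ord0 i) => [j ->|->//]; have := BX j; rewrite mxE.
split.
  rewrite XE -[X in measurable X]setTI; apply: measurable_row_uncons => //.
  exact: measurableX.
rewrite XE big_ord_recl /= /lebesgue_step /pushforward -comp_preimage.
rewrite (_ : _ \o _ = id) ?preimage_id; last first.
  by apply/funext => z; exact: row_consK.
by rewrite -PX; exact: product_measure1E.
Qed.

End LebesgueMeasure.

Definition borel (T : ptopologicalType) := g_sigma_algebraType (@open T).

(* Weak convergence in the space S with norm N: S is a subspace of V whose
   elements are functions rather than classes, so N is only a seminorm on S;
   a bounded functional does not see the difference. *)
Section WeakConvergence.
Context {R : realType} {V : lmodType R} (S : set V) (N : V -> \bar R).

Definition dual : set (V -> R) :=
  [set L | (forall a f g, S f -> S g -> L (a *: f + g) = a * L f + L g) /\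
     exists C : R, forall f, S f -> ((`|L f|)%:E <= C%:E * N f)%E].

Definition weak_cvg (u : nat -> V) (l : V) :=
  [/\ forall k, S (u k), S l & forall L, dual L -> L (u k) @[k --> \oo] --> L l].

End WeakConvergence.

(* Functions are total on R^n, and only their restrictions to Omega matter.
   The norm of 'M[R]_(m, n) is the maximum of the absolute values of the
   entries, which is equivalent to the Euclidean one. *)
Section FunctionSpaces.
Context {R : realType} {n : nat} (Omega : set 'rV[R]_n) (p : R).

Definition Lp_norm (W : normedModType R) (f : 'rV[R]_n -> W) : \bar R :=
  'N[@lebesgueRn R n]_(p%:E)[EFin \o ((fun x => `|f x|) \_ Omega)].

Definition Lp (W : normedModType R) : set ('rV[R]_n -> W) :=
  [set f | @measurable_fun _ _ (Rn R n) (borel W) Omega f /\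
           (Lp_norm f < +oo)%E].

Definition partial (j : 'I_n) (f : 'rV[R]_n -> R) (x : 'rV[R]_n) : R :=
  'D_(delta_mx ord0 j) f x.

Fixpoint Ck k (f : 'rV[R]_n -> R) : Prop :=
  continuous f /\
  if k is k'.+1 then
    forall j, (forall x, derivable f x (delta_mx ord0 j)) /\ Ck k' (partial j f)
  else True.

Definition test_function (f : 'rV[R]_n -> R) :=
  (forall k, Ck k f) /\
  exists K, [/\ compact K, K `<=` Omega & forall x, ~ K x -> f x = 0].

(* Convention: (Du)_ij is the j-th partial derivative of u_i. *)
Definition weak_gradient (u : 'rV[R]_n -> 'rV[R]_n) (Du : 'rV[R]_n -> 'M[R]_n) :=
  forall i j phi, test_function phi ->
    \int[@lebesgueRn R n]_(x in Omega) (u x ord0 i * partial j phi x) =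
    - \int[@lebesgueRn R n]_(x in Omega) (Du x i j * phi x).

(* An element of W^{1,p}(Omega; R^n) is given together with (a representative of)
   its weak gradient, which is unique up to a null set. *)
Definition W1p : set (('rV[R]_n -> 'rV[R]_n) * ('rV[R]_n -> 'M[R]_n)) :=
  [set u | [/\ Lp u.1, Lp u.2 & weak_gradient u.1 u.2]].

Definition W1p_norm (u : ('rV[R]_n -> 'rV[R]_n) * ('rV[R]_n -> 'M[R]_n)) :=
  (Lp_norm u.1 + Lp_norm u.2)%E.

End FunctionSpaces.

(* After an orthogonal map Q and the choice of a vertical axis i, Omega is locally the
   strict epigraph of a Lipschitz function of the other n - 1 coordinates. *)
Definition lipschitz_boundary (R : realType) n (Omega : set 'rV[R]_n) :=
  forall x0, (closure Omega `\` interior Omega) x0 ->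
  exists (r : R) (Q : 'M[R]_n) (i : 'I_n) (gamma : 'rV[R]_n.-1 -> R),
    [/\ 0 < r, Q *m Q^T = 1%:M, lipschitz gamma &
      forall x, ball x0 r x ->
        Omega x <-> gamma (col' i (x *m Q)) < (x *m Q) ord0 i].

Definition lipschitz_domain (R : realType) n (Omega : set 'rV[R]_n) :=
  [/\ open Omega, connected Omega, Omega !=set0, bounded_set Omega &
      lipschitz_boundary Omega].

Section YoungMeasures.
Context {R : realType} {n : nat} (Omega : set 'rV[R]_n) (p : R).

Definition vanishes_at_infinity (v : 'M[R]_n -> R) :=
  forall e, 0 < e -> exists M, forall s, M < `|s| -> `|v s| < e.

(* Local finiteness is automatic for a probability measure. *)
Definition radon (mu : probability (borel 'M[R]_n) R) :=
  forall A : set (borel 'M[R]_n), measurable A ->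
    mu A = ereal_sup
      [set mu K | K in [set K : set 'M[R]_n | compact K /\ K `<=` A]].

Definition young_measure (nu : 'rV[R]_n -> probability (borel 'M[R]_n) R) :=
  (forall x, Omega x -> radon (nu x)) /\
  forall v : 'M[R]_n -> R, continuous v -> vanishes_at_infinity v ->
    measurable_fun (Omega : set (Rn R n)) (fun x => \int[nu x]_s v s).

(* The a.e. integrability of v makes the (otherwise total) integral of v against
   nu x meaningful. *)
Definition generates (Y : nat -> 'rV[R]_n -> 'M[R]_n)
    (nu : 'rV[R]_n -> probability (borel 'M[R]_n) R) :=
  [/\ young_measure nu, forall k, Lp Omega p (Y k),
      exists C : R, forall k, (Lp_norm Omega p (Y k) <= C%:E)%E &
      forall v : 'M[R]_n -> R, continuous v ->
        vanishes_at_infinity (fun s => v s / `|s| `^ p) ->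
        {ae @lebesgueRn R n, forall x, Omega x ->
           (nu x).-integrable setT (EFin \o v)} /\
        weak_cvg (@Lp R n Omega 1 R^o) (@Lp_norm R n Omega 1 R^o)
          (fun k => v \o Y k) (fun x => \int[nu x]_s v s)].

End YoungMeasures.

(* Main.v *)
(* The determinant is a null Lagrangian, hence weakly continuous on W^{1,p}, p > n.
   Telescoping from eta_m to eta_l one coordinate at a time, eta_m - eta_l is the divergence
   of a kernel of L^1 norm O(1/m); integrating by parts,
     | int phi det (eta_m * G) - int phi det (eta_l * G) | <= K sup int |G|^n / m
   for every weak gradient G, uniformly in l. Letting l tend to infinity and using that
   eta_m * Dy_k converges pointwise as k grows, int phi det Dy_k tends to int phi det Dy. The
   bound on the L^n norms of Dy_k comes from the weak convergence (uniform boundedness).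

   As 1 / det Dy_k = det (Dy_k)^-1 is bounded in L^1 by some c and d >= 2 t - t^2 / d for d > 0,
   in the limit int phi det Dy >= 2 t int phi - t^2 c whenever 0 <= phi <= 1. Taking for phi
   mollified indicators of a set A where det Dy <= 0 gives 2 t |A| <= t^2 c for all t > 0.

   For the Young measure, v_m (s) = max (0, 1 - m max (det s, 0)) is 1 where det s <= 0 and at
   most 1 / (m det s) elsewhere, so the integral over Omega of nu_x (det <= 0) is at most c / m. *)

From HB Require Import structures.
Require Import Defs.
From mathcomp Require Import all_boot all_order all_algebra.
From mathcomp Require Import all_classical all_reals all_analysis.
From mathcomp Require Import fingroup perm.
From mathcomp Require Import measurable_realfun ring lra.
Set Implicit Arguments.
Unset Strict Implicit.
Unset Printing Implicit Defensive.
Import Order.TTheory GRing.Theory Num.Theory.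
Import numFieldNormedType.Exports.
Local Open Scope classical_set_scope.
Local Open Scope ring_scope.

(** * Lebesgue measure on row vectors *)

(** The obstacle is compactness: the gradients converge only weakly, and the speed at which
    [eta_m * Dy_k] approaches [Dy_k] may depend on k. The gain 1/m comes from the functions
    themselves. If [eta_m - eta_l] is the divergence of kernels psi_j, testing the weak gradient
    against them gives [eta_m * u_i - eta_l * u_i = sum_j psi_j * G_ij], which is of order 1/m in
    L^n by Young's convolution inequality, with constants that see G only through its L^n norms. In
    each term of the telescoped determinant one row is the gradient of such a difference; moving
    that derivative onto phi leaves a determinant with one small row. Products of entries are always
    bounded by sums of n-th powers, so bounds in L^n suffice, and these follow from n <= p on a
    bounded set. Functions are extended by zero, which spoils the weak gradient across the boundary;
    so phi has to vanish near the boundary, and the set where det Dy <= 0 is cut into pieces at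
    positive distance from it. The bound on 1/det is used through its tangents because they are
    linear in det, the only form in which weak continuity applies. *)

Section LebesgueRn.
Context {R : realType}.
Implicit Types n : nat.

Let lebesgueRn_sigma_finite n : sigma_finite setT (@lebesgueRn R n).
Proof. exact/completed_measure_extension_sigma_finite/sigma_finiteT. Qed.

HB.instance Definition _ n :=
  Measure_isSigmaFinite.Build _ _ _ (@lebesgueRn R n)
    (@lebesgueRn_sigma_finite n).

Definition boxes n : set (set 'rV[R]_n) :=
  [set A | exists B : 'I_n -> set (measurableTypeR R),
     (forall i, measurable (B i)) /\ A = [set x : 'rV[R]_n | forall i, B i (x ord0 i)]].

Lemma row_measurable_Rn n (A : set 'rV[R]_n) :
  @measurable _ (row_space R n) A -> @measurable _ (Rn R n) A.
Proof. by move=> mA; apply: caratheodory_measurable_mu_ext. Qed.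

Lemma measurable_fun_Rn n d (T : measurableType d) (f : 'rV[R]_n -> T) :
  measurable_fun (setT : set (row_space R n)) f ->
  measurable_fun (setT : set (Rn R n)) f.
Proof. by move=> mf _ B mB; apply: row_measurable_Rn; exact: mf. Qed.

(** Pushing the completed measure forward along the identity lands on the product sigma-algebra,
    where uniqueness of measures and Tonelli in the coordinates can be applied. *)
Lemma measurable_id_Rn n :
  measurable_fun (setT : set (Rn R n)) (idfun : Rn R n -> row_space R n).
Proof. by move=> _ A mA; rewrite setTI; exact: row_measurable_Rn. Qed.

Lemma lebesgueRnE n (A : set 'rV[R]_n) : @measurable _ (row_space R n) A ->
  @lebesgueRn R n A = @product_lebesgue R n A.
Proof. by move=> mA; exact: measurable_mu_extE. Qed.

Lemma measurable_box n (B : 'I_n -> set (measurableTypeR R)) :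
  (forall i, measurable (B i)) ->
  @measurable _ (row_space R n) [set x : 'rV[R]_n | forall i, B i (x ord0 i)].
Proof.
move=> mB; rewrite (_ : [set _ | _] =
    \bigcap_(i : 'I_n) [set x : 'rV[R]_n | B i (x ord0 i)]); last first.
  by apply/seteqP; split=> [x Bx i _|x Bx i]; exact: Bx.
apply: (@fin_bigcap_measurable _ (row_space R n)) => // i _.
by apply: sub_sigma_algebra; exists i, (B i).
Qed.

Lemma ball_rVP n (x y : 'rV[R]_n) (e : R) : 0 < e ->
  ball x e y <-> forall i, `|x ord0 i - y ord0 i| < e.
Proof.
by move=> e0; split=> [[_ xy] i|xy]; [exact: xy|split=> // i j; rewrite ord1; exact: xy].
Qed.

Lemma norm_rVP n (x : 'rV[R]_n) (e : R) : 0 < e ->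
  `|x| < e <-> forall i, `|x ord0 i| < e.
Proof.
move=> e0; have := ball_rVP 0 x e0; rewrite mx_norm_ball /ball_/= sub0r normrN => ->.
by split=> xe i; have := xe i; rewrite mxE sub0r normrN.
Qed.

Lemma ler_norm_rV n (x : 'rV[R]_n) i : `|x ord0 i| <= `|x|.
Proof.
apply/ler_addgt0Pr => e e0; apply/ltW.
by apply: (iffLR (norm_rVP _ _)); [apply: ltr_wpDl|rewrite ltrDl].
Qed.

(** An open set is the union of the boxes with rational centre and half-side 1/(k+1) that it
    contains, and these form a countable family. *)
Lemma open_row_measurable n (U : set 'rV[R]_n) : open U ->
  @measurable _ (row_space R n) U.
Proof.
move=> oU.
pose B (q : 'rV[rat]_n) (k : nat) : set 'rV[R]_n :=
  [set x | forall i, `]ratr (q ord0 i) - k.+1%:R^-1, ratr (q ord0 i) + k.+1%:R^-1[%classic (x ord0 i)].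
pose F (qk : 'rV[rat]_n * nat) := if `[< B qk.1 qk.2 `<=` U >] then B qk.1 qk.2 else set0.
rewrite (_ : U = \bigcup_qk F qk); last first.
  apply/seteqP; split=> [x Ux|x [qk _]]; last first.
    by rewrite /F; case: asboolP => // BU /BU.
  have /nbhs_ballP[e /= e0 xeU] := open_nbhs_nbhs (conj oU Ux).
  (* Half of [e], because both [x] and the other points of the box are within 1/(k+1) of its
     centre. *)
  have [k ke] : exists k : nat, k.+1%:R^-1 < e / 2.
    have [k _ /(_ k (leqnn _))/= ke] := near_infty_natSinv_lt (PosNum (divr_gt0 e0 (ltr0n R 2))).
    by exists k.
  have /choice[q qx] : forall i, exists q : rat, `|x ord0 i - ratr q| < k.+1%:R^-1.
    move=> i; have : x ord0 i - k.+1%:R^-1 < x ord0 i + k.+1%:R^-1.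
      by rewrite ltrD2l gt0_cp// invr_gt0.
    move=> /rat_in_itvoo[q]; rewrite in_itv/= => /andP[].
    set r := k.+1%:R^-1 => ? ?.
    by exists q; rewrite ltr_distl; apply/andP; split; lra.
  exists (\row_i q i, k) => //; rewrite /F/=; case: asboolP => [_ i|].
    rewrite /= mxE in_itv/=; have := qx i; rewrite ltr_distl => /andP[? ?].
    by apply/andP; split.
  move=> nBU; exfalso; apply: nBU => y By; apply: xeU; apply/ball_rVP => // i.
  have := By i; rewrite /= mxE in_itv/=.
  by have := qx i; rewrite !ltr_distl; move: ke; set r := k.+1%:R^-1 => ? /andP[? ?] /andP[? ?]; apply/andP; split; lra.
apply: (@countable_bigcupT_measurable _ (row_space R n)) => //.
move=> [q k]; rewrite /F; case: asboolP => // _.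
by apply: (@measurable_box _ (fun i =>
  `]ratr (q ord0 i) - k.+1%:R^-1, ratr (q ord0 i) + k.+1%:R^-1[%classic)) => i; exact: measurable_itv.
Qed.

Lemma continuous_row_measurable n (f : 'rV[R]_n -> R) : continuous f ->
  measurable_fun (setT : set (row_space R n)) f.
Proof.
move=> cf; apply: (@measurability _ _ (row_space R n) _ setT f _ (RGenOInfty.measurableE R)).
move=> _ [_ [a ->] <-]; rewrite setTI; apply: open_row_measurable.
by apply: open_comp; [move=> x _; exact: cf|exact: interval_open].
Qed.

Lemma continuous_Rn_measurable n (f : 'rV[R]_n -> R) : continuous f ->
  measurable_fun (setT : set (Rn R n)) f.
Proof. by move=> cf; apply: measurable_fun_Rn; exact: continuous_row_measurable. Qed.

Lemma open_Rn_measurable n (U : set 'rV[R]_n) : open U ->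
  @measurable _ (Rn R n) U.
Proof. by move=> oU; apply: row_measurable_Rn; exact: open_row_measurable. Qed.

(** By uniqueness of Lebesgue measure only []c, d]] has to be examined; its preimage [[a - d, a -
    c[] has the same length. *)
Lemma lebesgue_measure_reflect (a : R) (B : set (measurableTypeR R)) :
  measurable B -> lebesgue_measure [set t : R | B (a - t)] = lebesgue_measure B.
Proof.
move=> mB.
have mr : measurable_fun setT (fun t : measurableTypeR R => a - t : measurableTypeR R).
  by apply: measurable_funB.
pose m : {measure set _ -> \bar R} :=
  pushforward (@lebesgue_measure R) (fun t : measurableTypeR R => a - t : measurableTypeR R).
rewrite -[LHS]/(m mr B) -(@lebesgue_measure_unique _ (m mr))//.
move=> _ [[c d] /= _ <-]; rewrite /m /= /pushforward.
rewrite (_ : _ @^-1` _ = `[a - d, a - c[%classic); last first.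
  by apply/seteqP; split=> t /=; rewrite !in_itv/= => /andP[? ?];
    apply/andP; split; lra.
rewrite !lebesgue_measure_itv/= !lte_fin ltrD2l ltrN2.
by case: ifP => // _; rewrite -!EFinB; congr (_%:E); lra.
Qed.

Lemma prode_EFin (I : Type) (r : seq I) (P : pred I) (f : I -> R) :
  (\prod_(i <- r | P i) (f i)%:E = (\prod_(i <- r | P i) f i)%:E)%E.
Proof. by elim/big_rec2: _ => // i y1 y2 _ ->. Qed.

Definition reflect n (a x : 'rV[R]_n) : row_space R n := a - x.

Lemma measurable_reflect n (a : 'rV[R]_n) :
  measurable_fun (setT : set (Rn R n)) (reflect a).
Proof.
apply: (@measurability _ _ (Rn R n) (row_space R n) setT (reflect a) (@cylinders R n) erefl) => _ [_ [i [B [mB ->]]] <-].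
rewrite setTI; apply: row_measurable_Rn.
have mr : measurable_fun setT (fun t : measurableTypeR R => a ord0 i - t : measurableTypeR R).
  by apply: measurable_funB.
apply: sub_sigma_algebra; exists i, [set t | B (a ord0 i - t)]; split.
  by have := mr measurableT _ mB; rewrite setTI.
by apply/seteqP; split=> x; rewrite /reflect /= !mxE.
Qed.

(** Both sides are measures in [A] that agree on boxes, an intersection-stable generator, and are
    finite on the cubes [g k] that exhaust the space. Reflections are the basic symmetry here
    because convolution integrates [K (x - z)]; a translation is a composition of two of them. *)
Lemma lebesgueRn_reflect n (a : 'rV[R]_n) (A : set 'rV[R]_n) :
  @measurable _ (row_space R n) A ->
  @lebesgueRn R n (reflect a @^-1` A) = @lebesgueRn R n A.
Proof.
move=> mA.
pose m1 : {measure set (row_space R n) -> \bar R} :=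
  pushforward (@lebesgueRn R n) (idfun : Rn R n -> row_space R n).
have mi := @measurable_id_Rn n.
have mr := @measurable_reflect n a.
pose m2 : {measure set (row_space R n) -> \bar R} :=
  pushforward (@lebesgueRn R n) (reflect a).
rewrite -[LHS]/(m2 mr A) -[RHS]/(m1 mi A); symmetry.
pose g (k : nat) : set (row_space R n) :=
  [set x | forall i : 'I_n, `[- k%:R, k%:R]%classic (x ord0 i)].
have mg k : @measurable _ (row_space R n) (g k).
  by apply: (@measurable_box _ (fun=> `[- k%:R, k%:R]%classic)) => i; exact: measurable_itv.
apply: (@measure_unique _ _ (row_space R n) (@boxes n) g _ _ _ _ (m1 mi) (m2 mr)) => //.
- apply/seteqP; split; apply: smallest_sub.
  + exact: smallest_sigma_algebra.
  + move=> _ [i [B [mB ->]]]; apply: sub_sigma_algebra.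
    exists (fun j => if j == i then B else setT); split.
      by move=> j; case: ifP.
    apply/seteqP; split=> x /= => [Bx j|/(_ i)]; last by rewrite eqxx.
    by case: eqP => // ->.
  + exact: sigma_algebra_measurable.
  + by move=> _ [B [mB ->]]; exact: measurable_box.
- move=> _ _ [B [mB ->]] [C [mC ->]]; exists (fun i => B i `&` C i); split.
    by move=> i; exact: measurableI.
  by apply/seteqP; split=> x /= => [[? ?] i|BC]; [split|split=> i; have [] := BC i].
- by move=> k; exists (fun=> `[- k%:R, k%:R]%classic); split=> // i; exact: measurable_itv.
- apply/seteqP; split=> // x _.
  have [k xk] : exists k : nat, `|x| <= k%:R.
    by exists (Num.trunc `|x|).+1; exact/ltW/truncnS_gt.
  exists k => // i; rewrite /= in_itv/= -ler_norml.
  apply: le_trans xk; exact: ler_norm_rV.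
- move=> _ [B [mB ->]]; rewrite /m1 /m2 /= /pushforward.
  rewrite [LHS]lebesgueRn_box//.
  rewrite (_ : _ @^-1` _ = [set x : 'rV[R]_n | forall i, [set t | B i (a ord0 i - t)] (x ord0 i)]); last first.
    by apply/seteqP; split=> x /= H i; have := H i; rewrite /reflect !mxE.
  rewrite (@lebesgueRn_box _ _ (fun i => [set t | B i (a ord0 i - t)])).
    by apply: eq_bigr => i _; rewrite lebesgue_measure_reflect.
  move=> i; have mri : measurable_fun setT (fun t : measurableTypeR R => a ord0 i - t : measurableTypeR R).
    by apply: measurable_funB.
  by have := mri measurableT _ (mB i); rewrite setTI.
- move=> k; rewrite /m1 /= /pushforward [X in (X < _)%E](@lebesgueRn_box _ _ (fun=> `[- k%:R, k%:R]%classic))//.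
  by rewrite lebesgue_measure_itv/=; case: ifP => _; rewrite prode_EFin?ltry.
Qed.

Lemma ge0_integral_Rn n (f : 'rV[R]_n -> \bar R) :
  measurable_fun (setT : set (row_space R n)) f -> (forall x, (0 <= f x)%E) ->
  (\int[@lebesgueRn R n]_x f x = \int[@product_lebesgue R n]_x f x)%E.
Proof.
move=> mf f0.
have mi := @measurable_id_Rn n.
transitivity (\int[pushforward (@lebesgueRn R n) (idfun : Rn R n -> row_space R n)]_x f x)%E.
  by rewrite (ge0_integral_pushforward mi).
by apply: eq_measure_integral => A mA _; exact: lebesgueRnE.
Qed.

Lemma ge0_integral_reflect n (a : 'rV[R]_n) (f : 'rV[R]_n -> \bar R) :
  measurable_fun (setT : set (row_space R n)) f -> (forall x, (0 <= f x)%E) ->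
  (\int[@lebesgueRn R n]_x f (a - x)%R = \int[@lebesgueRn R n]_x f x)%E.
Proof.
move=> mf f0; rewrite [RHS]ge0_integral_Rn//.
have mr := @measurable_reflect n a.
transitivity (\int[pushforward (@lebesgueRn R n) (reflect a)]_x f x)%E.
  by rewrite (ge0_integral_pushforward mr).
apply: eq_measure_integral => A mA _.
by transitivity (@lebesgueRn R n A); [exact: lebesgueRn_reflect|exact: lebesgueRnE].
Qed.

Lemma measurable_prodfun n (F : 'I_n -> R -> R) :
  (forall i, measurable_fun setT (F i)) ->
  measurable_fun (setT : set (row_space R n)) (fun x : 'rV[R]_n => \prod_i F i (x ord0 i)).
Proof.
move=> mF.
apply: (@measurable_prod _ (row_space R n) R setT 'I_n (index_enum 'I_n)
  (fun i (x : row_space R n) => F i ((x : 'rV_n) ord0 i))) => i _.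
by apply: (measurableT_comp (mF i)); exact: measurable_coord.
Qed.

(** Tonelli, one coordinate at a time: in dimension n + 1 [product_lebesgue] is by definition the
    image of a product measure under [row_cons]. This computes the L^1 norms of all tensor-product
    kernels below. *)
Lemma ge0_integral_prodfun n (F : 'I_n -> R -> R) :
  (forall i, measurable_fun setT (F i)) -> (forall i t, 0 <= F i t) ->
  (\int[@lebesgueRn R n]_x (\prod_i F i (x ord0 i))%:E =
   \prod_i \int[@lebesgue_measure R]_t (F i t)%:E)%E.
Proof.
move=> mF F0; rewrite ge0_integral_Rn; last 2 first.
- by apply/measurable_EFinP; exact: measurable_prodfun.
- by move=> x; rewrite lee_fin prodr_ge0.
elim: n F mF F0 => [|n IH] F mF F0.
  rewrite big_ord0 /= (_ : (fun x => _) = cst 1%E); last first.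
    by apply/funext => x; rewrite big_ord0.
  by rewrite integral_cst// mul1e; exact: diracT.
rewrite big_ord_recl -(IH (fun i => F (lift ord0 i)))//.
rewrite (ge0_integral_pushforward (@measurable_row_cons R n)); last 3 first.
- by [].
- by apply/measurable_EFinP; exact: measurable_prodfun.
- by move=> x _; rewrite lee_fin prodr_ge0.
rewrite preimage_setT fubini_tonelli1/=; last 2 first.
- apply/measurable_EFinP. apply: (measurableT_comp (measurable_prodfun mF)).
  exact: measurable_row_cons.
- by move=> x; rewrite lee_fin prodr_ge0.
rewrite /fubini_F.
have P0 (y : 'rV[R]_n) : 0 <= \prod_(i < n) F (lift ord0 i) (y ord0 i) by rewrite prodr_ge0.
transitivity (\int[lebesgue_measure]_t ((F ord0 t)%:E *
    \int[@product_lebesgue R n]_y (\prod_(i < n) F (lift ord0 i) (y ord0 i))%:E))%E.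
  apply: eq_integral => t _; rewrite -ge0_integralZl//.
  - apply: eq_integral => y _ /=; rewrite big_ord_recl mxE unlift_none/= EFinM.
    congr (_ * _%:E)%E; apply: eq_bigr => i _.
    by rewrite mxE liftK.
  - by apply/measurable_EFinP; apply: (@measurable_prodfun n (fun i => F (lift ord0 i))).
  - by move=> y _; rewrite lee_fin.
  - by rewrite lee_fin.
rewrite ge0_integralZr//.
- by apply/measurable_EFinP; exact: mF.
- by move=> t _; rewrite lee_fin.
- by apply: integral_ge0 => y _; rewrite lee_fin.
Qed.

Lemma lebesgueRn_box_lty n (r : R) :
  (@lebesgueRn R n [set x : 'rV[R]_n | forall i, (`|x ord0 i| <= r)%R] < +oo)%E.
Proof.
rewrite (_ : [set _ | _] = [set x : 'rV[R]_n | forall i, `[- r, r]%classic (x ord0 i)]).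
  rewrite (@lebesgueRn_box _ _ (fun=> `[- r, r]%classic))//.
  by rewrite lebesgue_measure_itv/=; case: ifP => _; rewrite prode_EFin?ltry.
by apply/seteqP; split=> x /= H i; have := H i; rewrite /= in_itv/= ler_norml.
Qed.

Lemma bounded_lebesgueRn_lty n (A : set 'rV[R]_n) :
  @measurable _ (Rn R n) A -> bounded_set A -> (@lebesgueRn R n A < +oo)%E.
Proof.
move=> mA [M [_ /(_ (M + 1))]]; rewrite ltrDl ltr01 => /(_ isT) AM.
apply: le_lt_trans (lebesgueRn_box_lty n (M + 1)).
apply: le_measure; rewrite ?in_setE//.
  apply: row_measurable_Rn.
  rewrite (_ : [set _ | _] = [set x : 'rV[R]_n | forall i, `[- (M + 1), M + 1]%classic (x ord0 i)]).
    by apply: (@measurable_box _ (fun=> `[- (M + 1), M + 1]%classic)) => i; exact: measurable_itv.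
  by apply/seteqP; split=> x /= H i; have := H i; rewrite /= in_itv/= ler_norml.
by move=> x Ax i; apply: le_trans (AM _ Ax); exact: ler_norm_rV.
Qed.

End LebesgueRn.

(* On measurability and integrability goals over [Rn], the hint database diverges
   while unfolding the Caratheodory structure. *)
Ltac done ::= lazymatch goal with
  | |- measurable_fun _ _ => solve [assumption]
  | |- integrable _ _ _ => solve [assumption]
  | |- forall _, measurable_fun _ _ => solve [assumption]
  | _ => trivial; hnf; intros; solve
     [ do ![solve [trivial | apply: sym_equal; trivial]
           | discriminate | contradiction | split]
     | match goal with H : ~ _ |- _ => solve [case H; trivial] end ]
  end.

(** * A smooth bump function *)

Section SmoothLine.
Context {R : realType}.
Implicit Types f g : R -> R.

Fixpoint smooth_upto k f : Prop :=
  if k is k'.+1 then (forall x : R, derivable f x 1) /\ smooth_upto k' f^`()%classic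
  else forall x : R, derivable f x 1.

Definition smooth f := forall k, smooth_upto k f.

Lemma smooth_upto0 k f : smooth_upto k f -> forall x : R, derivable f x 1.
Proof. by case: k => [|k] // []. Qed.

Lemma smooth_uptoW k f : smooth_upto k.+1 f -> smooth_upto k f.
Proof.
elim: k f => [|k IH] f; first by move=> /(@smooth_upto0 1).
by move=> [df sf]; split=> //; exact: IH.
Qed.

Lemma smooth_derivable f : smooth f -> forall x : R, derivable f x 1.
Proof. by move=> /(_ 0%N). Qed.

Lemma smooth_derive1 f : smooth f -> smooth f^`()%classic.
Proof. by move=> sf k; have [] := sf k.+1. Qed.

Lemma smooth_continuous f : smooth f -> continuous f.
Proof. by move=> sf x; apply/differentiable_continuous/derivable1_diffP/smooth_derivable. Qed.

Lemma smooth_uptoD k f g : smooth_upto k f -> smooth_upto k g ->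
  smooth_upto k (fun x => f x + g x).
Proof.
elim: k f g => [|k IH] f g.
  by move=> df dg x; apply: derivableD; [exact: df|exact: dg].
move=> [df sf] [dg sg]; split.
  by move=> x; apply: derivableD; [exact: df|exact: dg].
rewrite (_ : (fun x => f x + g x)^`()%classic = (fun x => f^`()%classic x + g^`()%classic x)).
  exact: IH.
by apply/funext => x; rewrite !derive1E deriveD.
Qed.

Lemma smooth_uptoM k f g : smooth_upto k f -> smooth_upto k g ->
  smooth_upto k (fun x => f x * g x).
Proof.
elim: k f g => [|k IH] f g.
  by move=> df dg x; apply: derivableM; [exact: df|exact: dg].
move=> sf sg; have [df sf'] := sf; have [dg sg'] := sg; split.
  by move=> x; apply: derivableM; [exact: df|exact: dg].
rewrite (_ : (fun x => f x * g x)^`()%classic =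
    (fun x => f x * g^`()%classic x + g x * f^`()%classic x)).
  by apply: smooth_uptoD; apply: IH => //; exact: smooth_uptoW.
by apply/funext => x; rewrite !derive1E deriveM.
Qed.

Lemma smooth_upto_cst k (c : R) : smooth_upto k (fun=> c).
Proof.
elim: k c => [|k IH] c; first by move=> x; exact: derivable_cst.
split; first by move=> x; exact: derivable_cst.
rewrite (_ : (fun=> c)^`()%classic = fun=> 0); first exact: IH.
by apply/funext => x; rewrite derive1E; exact: derive_cst.
Qed.

Lemma smooth_uptoV k f : (forall x, f x != 0) -> smooth_upto k f ->
  smooth_upto k (fun x => (f x)^-1).
Proof.
move=> f0; elim: k => [|k IH].
  by move=> df x; apply: derivableV; [exact: f0|exact: df].
move=> sf; have [df sf'] := sf; split.
  by move=> x; apply: derivableV; [exact: f0|exact: df].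
rewrite (_ : (fun x => (f x)^-1)^`()%classic =
    (fun x => (f x)^-1 * ((f x)^-1 * (-1 * f^`()%classic x)))).
  have sV : smooth_upto k (fun x => (f x)^-1) by apply: IH; exact: smooth_uptoW.
  by apply: smooth_uptoM => //; apply: smooth_uptoM => //; apply: smooth_uptoM => //;
    exact: smooth_upto_cst.
apply/funext => x; rewrite derive1E deriveV// derive1E /GRing.scale/=.
by rewrite expr2 invfM; ring.
Qed.

Lemma is_derive_affine f (a b x : R) : (forall x : R, derivable f x 1) ->
  is_derive x 1 (fun t => f (a * t + b)) (a * f^`()%classic (a * x + b)).
Proof.
move=> df.
have dg : is_derive x 1 (fun t : R => a * t + b) a.
  by apply: is_derive_eq; rewrite addr0 /GRing.scale /= mulr1.
have df' : is_derive (a * x + b) 1 f (f^`()%classic (a * x + b)).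
  by rewrite derive1E; apply: derivableP; exact: df.
have := @is_derive1_comp R f (fun t : R => a * t + b) x _ _ df' dg.
by rewrite mulrC.
Qed.

Lemma smooth_upto_affine k f (a b : R) : smooth_upto k f ->
  smooth_upto k (fun t => f (a * t + b)).
Proof.
elim: k f => [|k IH] f.
  by move=> df x; have /@ex_derive := is_derive_affine a b x df.
move=> [df sf]; split.
  by move=> x; have /@ex_derive := is_derive_affine a b x df.
rewrite (_ : (fun t => f (a * t + b))^`()%classic = (fun t => a * f^`()%classic (a * t + b))).
  by apply: smooth_uptoM; [exact: smooth_upto_cst|exact: IH].
by apply/funext => x; rewrite derive1E; have /@derive_val -> := is_derive_affine a b x df.
Qed.

(* The functions [x^-m exp(-1/x)], extended by 0 to the left of 0: the
   derivative of a member of this family is a combination of two others. *)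
Definition flat m (x : R) : R := if 0 < x then x^-1 ^+ m * expR (- x^-1) else 0.

Lemma flat_ge0 m x : 0 <= flat m x.
Proof.
rewrite /flat; case: ifP => // x0.
by rewrite mulr_ge0 ?expR_ge0 ?exprn_ge0 ?invr_ge0 ?ltW.
Qed.

Lemma flat_gt0 m x : 0 < x -> 0 < flat m x.
Proof. by move=> x0; rewrite /flat x0 mulr_gt0 ?expR_gt0 ?exprn_gt0 ?invr_gt0. Qed.

(** With s = 1/x, exp s is the (m+1)-st power of exp (s/(m+1)), which is at least s/(m+1); hence s^m
    exp(-s) <= (m+1)^(m+1) / s. *)
Lemma flat_le m : exists2 C, 0 <= C & forall x, flat m x <= C * `|x|.
Proof.
exists (m.+1%:R ^+ m.+1) => [|x]; first by rewrite exprn_ge0.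
rewrite /flat; case: ifP => x0; last by rewrite mulr_ge0 ?exprn_ge0.
rewrite gtr0_norm//; set s := x^-1.
have s0 : 0 < s by rewrite invr_gt0.
have -> : x = s^-1 by rewrite /s invrK.
have : (s / m.+1%:R) ^+ m.+1 <= expR s.
  rewrite [X in expR X](_ : s = m.+1%:R * (s / m.+1%:R)); last by rewrite mulrCA divff ?mulr1.
  rewrite expRM_natl; apply: lerXn2r.
  - by rewrite nnegrE divr_ge0// ltW.
  - by rewrite nnegrE expR_ge0.
  - by apply: le_trans (expR_ge1Dx _); rewrite lerDr.
rewrite expr_div_n ler_pdivrMr ?exprn_gt0// => se.
by rewrite expRN ler_pdivrMr ?expR_gt0// mulrAC ler_pdivlMr// -exprSr [leRHS]mulrC.
Qed.

(** Away from 0 this is the product rule. At 0 the difference quotient of [flat m] is bounded by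
    [flat m.+1], which is O(|h|) by [flat_le]. *)
Lemma is_derive_flat m (x : R) :
  is_derive x 1 (flat m) (flat m.+2 x - m%:R * flat m.+1 x).
Proof.
have [x0|x0|->] := ltgtP x 0.
- rewrite /flat !ltNge (ltW x0)/= mulr0 subr0.
  apply: near_eq_is_derive (is_derive_cst (0 : R) x 1).
  near=> y; rewrite /flat ifN// -leNgt; apply/ltW; near: y.
  exact: lt_nbhsl.
- rewrite /flat x0.
  apply: (@near_eq_is_derive _ _ _ (fun y : R => y^-1 ^+ m * expR (- y^-1))).
    near=> y; rewrite /flat ifT//; near: y.
    exact: lt_nbhsr.
  have xn0 : x != 0 by rewrite gt_eqF.
  have dV : is_derive x 1 (fun y : R => y^-1) (- x^-1 ^+ 2).
    have := is_deriveV xn0 (is_derive_id x 1).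
    by rewrite /GRing.scale/= mulr1 exprVn.
  have dX : is_derive x 1 (fun y : R => y^-1 ^+ m) (- m%:R * x^-1 ^+ m.+1).
    have := is_deriveX m dV.
    rewrite exprfctE /GRing.scale/= => /is_derive_eq; apply; case: m => [|m]/=.
      by rewrite mulr0n !(oppr0, mul0r).
    by rewrite -mulr_natl -[m.+2]addn2 exprD; ring.
  have dE : is_derive x 1 (fun y : R => expR (- y^-1)) (x^-1 ^+ 2 * expR (- x^-1)).
    have := @is_derive1_comp R expR (fun y : R => - y^-1) x _ _ (is_derive_expR _) (is_deriveN dV).
    by rewrite opprK mulrC.
  have := is_deriveM dX dE; rewrite /GRing.scale/= => /is_derive_eq; apply.
  by rewrite -[m.+2]addn2 exprD; ring.
- rewrite /flat ltxx mulr0 subr0.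
  have [C C0 Cf] := flat_le m.+1.
  have H : (fun h : R => h^-1 *: (flat m (h *: 1 + 0) - flat m 0)) @ 0^' --> (0 : R).
    apply/cvgrPdist_le => e e0; near=> h.
    rewrite sub0r normrN addr0 {2}/flat ltxx subr0 /GRing.scale/= mulr1.
    rewrite normrM normfV [`|flat _ _|]ger0_norm ?flat_ge0//.
    have hflat : `|h|^-1 * flat m h <= flat m.+1 h.
      rewrite /flat; case: ifP => h0; last by rewrite mulr0.
      by rewrite gtr0_norm// mulrA -exprS.
    apply: (le_trans hflat); apply: (le_trans (Cf h)).
    apply: (@le_trans _ _ ((C + 1) * `|h|)); first by rewrite ler_wpM2r// lerDl.
    rewrite mulrC -ler_pdivlMr; last by rewrite ltr_wpDl.
    near: h; apply: dnbhs0_le; rewrite divr_gt0// ltr_wpDl//.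
  apply: DeriveDef; first by apply/cvg_ex; exists 0.
  exact: cvg_lim H.
Unshelve. all: by end_near. Qed.

Lemma smooth_flat m : smooth (flat m).
Proof.
move=> k; elim: k m => [|k IH] m; first by move=> x; have /@ex_derive := is_derive_flat m x.
split; first by move=> x; have /@ex_derive := is_derive_flat m x.
rewrite (_ : (flat m)^`()%classic = (fun x => flat m.+2 x + - m%:R * flat m.+1 x)).
  by apply: smooth_uptoD => //; apply: smooth_uptoM => //; exact: smooth_upto_cst.
by apply/funext => x; rewrite derive1E; have /@derive_val -> := is_derive_flat m x; rewrite mulNr.
Qed.

Definition step_den (x : R) := flat 0 (1 + x) + flat 0 (1 - x).

Lemma step_den_gt0 x : 0 < step_den x.
Proof.
rewrite /step_den; have [x0|x0] := ltP 0 (1 + x).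
  by rewrite ltr_pwDl ?flat_gt0 ?flat_ge0.
by rewrite ltr_wpDl ?flat_ge0 ?flat_gt0//; lra.
Qed.

Definition step (x : R) := flat 0 (1 + x) / step_den x.

Lemma smooth_step : smooth step.
Proof.
move=> k; apply: smooth_uptoM.
  have := @smooth_upto_affine k _ 1 1 (smooth_flat 0 k).
  by under eq_fun do rewrite mul1r addrC.
apply: smooth_uptoV; first by move=> x; rewrite gt_eqF// step_den_gt0.
apply: smooth_uptoD.
  have := @smooth_upto_affine k _ 1 1 (smooth_flat 0 k).
  by under eq_fun do rewrite mul1r addrC.
have := @smooth_upto_affine k _ (-1) 1 (smooth_flat 0 k).
by under eq_fun do rewrite mulN1r addrC.
Qed.

Lemma step_eq0 x : x <= -1 -> step x = 0.
Proof. by move=> x1; rewrite /step /flat; case: ltP; rewrite ?mul0r//; lra. Qed.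

Lemma step_eq1 x : 1 <= x -> step x = 1.
Proof.
move=> x1; rewrite /step /step_den [flat 0 (1 - x)]/flat; case: ltP; first lra.
by rewrite addr0 divff// gt_eqF// flat_gt0//; lra.
Qed.

(** Taking the derivative of a transition from 0 to 1 gives mass exactly 1 without a normalising
    constant, and keeps the primitive explicit; [step_diff] relies on the latter. *)
Definition bump := step^`()%classic.

(** The quotient rule, arranged so that the sign and the vanishing outside [-1, 1] can be read
    off. *)
Lemma bumpE x : bump x =
  (flat 2 (1 + x) * flat 0 (1 - x) + flat 0 (1 + x) * flat 2 (1 - x)) / step_den x ^+ 2.
Proof.
have dflat : forall y : R, derivable (flat 0) y 1 by exact: smooth_derivable (smooth_flat 0).
have flatE (y : R) : (flat 0)^`()%classic y = flat 2 y.
  by rewrite derive1E; have /@derive_val -> := is_derive_flat 0 y; rewrite mul0r subr0.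
have d1 : is_derive x 1 (fun x : R => flat 0 (1 + x)) (flat 2 (1 + x)).
  have := is_derive_affine 1 1 x dflat.
  by rewrite flatE !mul1r addrC; under eq_fun do rewrite mul1r addrC.
have d2 : is_derive x 1 (fun x : R => flat 0 (1 - x)) (- flat 2 (1 - x)).
  have := is_derive_affine (-1) 1 x dflat.
  by rewrite flatE !mulN1r addrC; under eq_fun do rewrite mulN1r addrC.
have d0 : step_den x != 0 by rewrite gt_eqF// step_den_gt0.
have d3 : is_derive x 1 step_den (flat 2 (1 + x) - flat 2 (1 - x)) by exact: is_deriveD d1 d2.
have d4 := is_deriveV d0 d3.
have d5 := is_deriveM d1 d4.
rewrite /bump derive1E; have /@derive_val -> := d5.
rewrite /GRing.scale/=; move: d0; rewrite /step_den => d0.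
by field.
Qed.

Lemma bump_ge0 x : 0 <= bump x.
Proof.
by rewrite bumpE divr_ge0 ?sqr_ge0// addr_ge0// mulr_ge0 ?flat_ge0.
Qed.

Lemma bump_eq0 x : 1 <= `|x| -> bump x = 0.
Proof.
rewrite bumpE ler_normr => /orP[x1|x1].
  by rewrite /flat [0 < 1 - x]ltNge (_ : 1 - x <= 0) ?subr_le0//= !mulr0 addr0 mul0r.
by rewrite /flat [0 < 1 + x]ltNge (_ : 1 + x <= 0)/= ?mul0r ?addr0 ?mul0r//; lra.
Qed.

(** The condition on [s] places the support of the integrand inside [-1, 1], where the fundamental
    theorem of calculus gives [step s - step (- s)]. *)
Lemma integral_bump (s : R) : 1 <= s ->
  (\int[@lebesgue_measure R]_t (s * bump (s * t))%:E = 1)%E.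
Proof.
move=> s1; have s0 : 0 < s by lra.
have cb : continuous (fun t => s * bump (s * t)).
  have := smooth_continuous (f := fun t => s * bump (s * t)); apply => k.
  apply: smooth_uptoM; first exact: smooth_upto_cst.
  have := @smooth_upto_affine k bump s 0 (smooth_derive1 smooth_step k).
  by under eq_fun do rewrite addr0.
have cs : continuous (fun t => step (s * t)).
  have := smooth_continuous (f := fun t => step (s * t)); apply => k.
  have := @smooth_upto_affine k step s 0 (smooth_step k).
  by under eq_fun do rewrite addr0.
have ds (x : R) : is_derive x 1 (fun t => step (s * t)) (s * bump (s * x)).
  have := is_derive_affine s 0 x (smooth_derivable smooth_step).
  by rewrite addr0; under eq_fun do rewrite addr0.
transitivity (\int[@lebesgue_measure R]_(t in `[(-1)%R, 1%R]) (s * bump (s * t))%:E)%E.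
  rewrite [RHS]integral_mkcond; apply: eq_integral => t _.
  rewrite patchE; case: ifPn => //; rewrite notin_setE/= in_itv/= -ler_norml.
  move=> /negP; rewrite -ltNge => t1; rewrite bump_eq0 ?mulr0//.
  rewrite normrM gtr0_norm//. 
  by rewrite -[1]mulr1 ler_pM// ltW.
rewrite (@continuous_FTC2 _ _ (fun t => step (s * t))).
- by rewrite mulr1 mulrN1 step_eq1// step_eq0 ?sube0//; lra.
- lra.
- exact: continuous_subspaceT.
- split.
  + by move=> x _; have /@ex_derive := ds x.
  + by apply: cvg_at_right_filter; exact: cs.
  + by apply: cvg_at_left_filter; exact: cs.
- by move=> x _; rewrite derive1E; have /@derive_val := ds x.
Qed.

End SmoothLine.

(** * Products of functions of one coordinate *)

Section Lines.
Context {R : realType} {V : normedModType R}.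
Implicit Types (f : V -> R) (x v : V).

Lemma is_derive_lineP f x v (t d : R) :
  is_derive (x + t *: v) v f d <-> is_derive t 1 (fun h => f (x + h *: v)) d.
Proof.
have E : (fun h : R => h^-1 *: ((f \o shift (x + t *: v)) (h *: v) - f (x + t *: v))) =
         (fun h : R => h^-1 *: (((fun h => f (x + h *: v)) \o shift t) (h *: 1) - f (x + t *: v))).
  apply/funext => h /=; congr (_ *: (f _ - _)).
  by rewrite [h%:A]mulr1 scalerDl addrCA.
split=> -[df fd]; (apply: DeriveDef; [by move: df; rewrite /derivable E|by move: fd; rewrite /derive E]).
Qed.

Lemma line_MVT f (f' : V -> R) x v (h : R) : (forall y, is_derive y v f (f' y)) ->
  exists2 t : R, `|t| <= `|h| & f (x + h *: v) - f x = f' (x + t *: v) * h.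
Proof.
move=> df; pose g (s : R) := f (x + s *: v).
have dg (s : R) : is_derive s 1 g (f' (x + s *: v)) by exact/is_derive_lineP.
have cg : continuous g.
  by move=> s; apply/differentiable_continuous/derivable1_diffP; have /@ex_derive := dg s.
have -> : f x = g 0 by rewrite /g scale0r addr0.
rewrite -/(g h); have [h0|h0] := leP 0 h.
  have [t] := @MVT_segment R g _ 0 h h0 (fun s _ => dg s) (continuous_subspaceT cg).
  rewrite in_itv/= subr0 => /andP[t0 th] ->; exists t => //.
  by rewrite !ger0_norm.
have [t] := @MVT_segment R g _ h 0 (ltW h0) (fun s _ => dg s) (continuous_subspaceT cg).
rewrite in_itv/= sub0r => /andP[ht t0] E; exists t.
  by rewrite !ler0_norm ?(ltW h0)// lerN2.
by rewrite -opprB E mulrN opprK.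
Qed.

Lemma derive_le_lipschitz f f' x v (C h : R) : (forall y, is_derive y v f (f' y)) ->
  (forall y, `|f' y| <= C) -> `|f (x + h *: v) - f x| <= C * `|h|.
Proof.
move=> df fC; have [t _ ->] := line_MVT x h df.
by rewrite normrM ler_wpM2r.
Qed.

(** The mean value theorem applied twice. It loses the factor 1/2 of Taylor's formula but asks only
    for a bound on [f'']. *)
Lemma taylor1_le f f' f'' x v (C h : R) : (forall y, is_derive y v f (f' y)) ->
  (forall y, is_derive y v f' (f'' y)) -> (forall y, `|f'' y| <= C) ->
  `|f (x + h *: v) - f x - h * f' x| <= C * `|h| ^+ 2.
Proof.
move=> df ddf fC; have [t th ->] := line_MVT x h df.
rewrite [h * _]mulrC -mulrBl normrM expr2 mulrA ler_wpM2r//.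
apply: le_trans (derive_le_lipschitz x t ddf fC) _.
by rewrite ler_wpM2l// (le_trans _ (fC x)).
Qed.

End Lines.

Section Products.
Context {R : realType} {n : nat}.
Implicit Types (F : 'I_n -> R -> R) (r : R).

Definition prodfun F (x : 'rV[R]_n) : R := \prod_i F i (x ord0 i).

(** Partial differentiation is expressed on the family of factors: a partial derivative of a tensor
    product is again a tensor product, so smoothness of every order and bounds on kernels follow by
    induction over families. *)
Definition dprod (j : 'I_n) F i : R -> R := if i == j then (F i)^`()%classic else F i.

Definition bump_family r F := forall i, smooth (F i) /\ forall t, r < `|t| -> F i t = 0.

Lemma dprodC i j F : dprod i (dprod j F) = dprod j (dprod i F).
Proof. by apply/funext => k; rewrite /dprod; case: ifP; case: ifP. Qed.

Lemma derive1_support r (f : R -> R) :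
  (forall t, r < `|t| -> f t = 0) -> forall t, r < `|t| -> f^`()%classic t = 0.
Proof.
move=> f0 t rt; rewrite derive1E (@near_eq_derive _ _ _ _ (cst 0)).
  exact: derive_cst.
near=> s; apply: f0; near: s.
by apply: (cvgr_gt (`|t|)) => //; exact: norm_continuous.
Unshelve. all: by end_near. Qed.

Lemma bump_family_dprod r j F : bump_family r F -> bump_family r (dprod j F).
Proof.
move=> bF i; have [sF F0] := bF i; rewrite /dprod; case: ifP => _ //; split.
  exact: smooth_derive1.
exact: derive1_support.
Qed.

Lemma is_derive_prodfun j F x : (forall i (t : R), derivable (F i) t 1) ->
  is_derive x (delta_mx ord0 j) (prodfun F) (prodfun (dprod j F) x).
Proof.
move=> dF; rewrite -[x in is_derive x](addr0 x) -(scale0r (delta_mx ord0 j)).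
apply/is_derive_lineP.
pose A := \prod_(i | i != j) F i (x ord0 i).
have -> : (fun h : R => prodfun F (x + h *: delta_mx ord0 j)) =
    (fun h => A * F j (1 * h + x ord0 j)).
  apply/funext => h; rewrite /prodfun (bigD1 j)//= mulrC !mxE !eqxx/= mulr1 mul1r [h + _]addrC.
  congr (_ * _); apply: eq_bigr => i ij; rewrite !mxE eqxx/= eq_sym (negbTE (_ : j != i))//.
    by rewrite mulr0 addr0.
  by rewrite eq_sym.
have -> : prodfun (dprod j F) x = A * (1 * (F j)^`()%classic (1 * 0 + x ord0 j)).
  rewrite /prodfun (bigD1 j)//= mulrC mul1r mulr0 add0r /dprod eqxx; congr (_ * _).
  by apply: eq_bigr => i ij; rewrite (negbTE ij).
have := is_deriveZ A (is_derive_affine 1 (x ord0 j) 0 (dF j)).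
by [].
Qed.

Lemma smooth_bounded r (f : R -> R) : continuous f ->
  (forall t, r < `|t| -> f t = 0) -> exists2 C : R, 0 <= C & forall t, `|f t| <= C.
Proof.
move=> cf f0.
have : compact (f @` `[- r, r]%classic).
  by apply: continuous_compact; [exact: continuous_subspaceT|exact: segment_compact].
move=> /compact_bounded[M [_ /(_ (`|M| + 1))]].
rewrite (le_lt_trans (ler_norm M)) ?ltrDl// => /(_ isT) fM.
exists (`|M| + 1) => [|t]; first by rewrite addr_ge0.
have [tr|rt] := leP `|t| r; last by rewrite f0// normr0 addr_ge0.
by apply: fM; exists t => //; rewrite /= in_itv/= -ler_norml.
Qed.

(** A class stable under sums, products, determinants and convolution. Its members are continuous,
    hence measurable, and bounded, hence harmless as factors of integrable functions. *)
Definition bounded_lipschitz (V : normedModType R) (f : V -> R) :=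
  exists2 C : R, 0 <= C & (forall x, `|f x| <= C) /\ forall x y, `|f x - f y| <= C * `|x - y|.

Lemma bounded_lipschitzM (V : normedModType R) (f g : V -> R) :
  bounded_lipschitz f -> bounded_lipschitz g -> bounded_lipschitz (fun x => f x * g x).
Proof.
move=> [C C0 [fC fL]] [D D0 [gD gL]]; exists (C * D + C * D).
  by rewrite addr_ge0// mulr_ge0.
split=> [x|x y].
  by rewrite normrM (le_trans (ler_pM _ _ (fC x) (gD x)))// lerDl mulr_ge0.
have -> : f x * g x - f y * g y = f x * (g x - g y) + (f x - f y) * g y by ring.
apply: (le_trans (ler_normD _ _)); rewrite [leRHS]mulrDl; apply: lerD; rewrite normrM.
  by rewrite -mulrA ler_pM.
by rewrite mulrAC ler_pM.
Qed.

Lemma bounded_lipschitz_continuous (V : normedModType R) (f : V -> R) :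
  bounded_lipschitz f -> continuous f.
Proof.
move=> [C C0 [_ fL]] x; apply/cvgrPdist_le => e e0; near=> y.
apply: (le_trans (fL x y)); apply: (@le_trans _ _ ((C + 1) * `|x - y|)).
  by rewrite ler_wpM2r// lerDl.
rewrite mulrC -ler_pdivlMr; last by rewrite ltr_wpDl.
near: y; apply: cvgr_dist_le; first exact: cvg_id.
by rewrite divr_gt0// ltr_wpDl.
Unshelve. all: by end_near. Qed.

Lemma prodfun_bounded_lipschitz r F : bump_family r F -> bounded_lipschitz (prodfun F).
Proof.
move=> bF; rewrite /prodfun; elim: (index_enum _) => [|i s IH].
  under eq_fun do rewrite big_nil.
  by exists 1 => //; split=> [x|x y]; rewrite ?normr1// subrr normr0 mul1r.
under eq_fun do rewrite big_cons; apply: bounded_lipschitzM => //.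
have [sF F0] := bF i.
have [C C0 FC] := smooth_bounded (smooth_continuous sF) F0.
have [D D0 FD] := smooth_bounded (smooth_continuous (smooth_derive1 sF)) (derive1_support F0).
exists (C + D); first by rewrite addr_ge0.
split=> [x|x y]; first by rewrite (le_trans (FC _))// lerDl.
have dFi (t : R) : is_derive t 1 (F i) ((F i)^`()%classic t).
  by rewrite derive1E; apply: derivableP; exact: smooth_derivable.
have := @derive_le_lipschitz R R (F i) _ (y ord0 i) 1 D (x ord0 i - y ord0 i) dFi FD.
rewrite [(_ - _)%:A]mulr1 [y ord0 i + _]addrC subrK => FL.
apply: (le_trans FL).
apply: ler_pM => //; first by rewrite lerDr.
by have := ler_norm_rV (x - y) i; rewrite !mxE.
Qed.

Lemma prodfun_support r F (x : 'rV[R]_n) i : bump_family r F -> r < `|x ord0 i| -> prodfun F x = 0.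
Proof. by move=> bF xi; rewrite /prodfun (bigD1 i)//=; have [_ ->] := bF i; rewrite ?mul0r. Qed.

Lemma partial_prodfun r j F : bump_family r F ->
  partial j (prodfun F) = prodfun (dprod j F).
Proof.
move=> bF; apply/funext => x; rewrite /partial.
by have /@derive_val -> := @is_derive_prodfun j F x (fun i => smooth_derivable (bF i).1).
Qed.

Lemma derivable_prodfun r j F x : bump_family r F ->
  derivable (prodfun F) x (delta_mx ord0 j).
Proof.
move=> bF.
by have /@ex_derive := @is_derive_prodfun j F x (fun i => smooth_derivable (bF i).1).
Qed.

Lemma continuous_prodfun F : (forall i, continuous (F i)) -> continuous (prodfun F).
Proof.
move=> cF; apply: continuous_big => [|i _]; first exact: mul_continuous.
by move=> x; apply: (continuous_comp (@coord_continuous _ _ _ ord0 i x)); exact: cF.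
Qed.

Lemma Ck_prodfun k r F : bump_family r F -> Ck k (prodfun F).
Proof.
elim: k F => [|k IH] F bF; split=> //; try (by apply: continuous_prodfun => i; exact/smooth_continuous/(bF i).1).
move=> j; split; first by move=> x; exact: derivable_prodfun bF.
by rewrite (partial_prodfun j bF); apply: IH; exact: bump_family_dprod.
Qed.

End Products.

(** * Convolution *)

Section BoundedFactor.
Context d (T : measurableType d) {R : realType} (mu : {measure set T -> \bar R}).

Lemma integrableMl_bounded (g f : T -> R) C : measurable_fun setT g ->
  (forall x, `|g x| <= C) -> mu.-integrable setT (EFin \o f) ->
  mu.-integrable setT (EFin \o (fun x => g x * f x)).
Proof.
move=> mg gC fi; have mf : measurable_fun setT f by apply/measurable_EFinP/measurable_int/fi.
apply: (@le_integrable _ _ _ mu setT _ _ (EFin \o (fun x => `|C| * f x))) => //.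
- by apply/measurable_EFinP; exact: measurable_funM.
- move=> x _ /=; rewrite lee_fin !normrM ler_wpM2r//.
  by rewrite (le_trans (gC x))// normr_id ler_norm.
- exact: (integrableZl measurableT `|C| fi).
Qed.

Lemma norm_Rintegral_le (f g : T -> R) : mu.-integrable setT (EFin \o f) ->
  mu.-integrable setT (EFin \o g) -> (forall x, `|f x| <= g x) ->
  `|\int[mu]_x f x| <= \int[mu]_x g x.
Proof.
move=> fi gi fg; apply: (le_trans (le_normr_Rintegral measurableT fi)).
by apply: le_Rintegral => //; exact: integrable_norm fi.
Qed.

(** The power t^(N+1) lies above its tangent at s. In the inductive step, [a] times the induction
    hypothesis is added to (N+1) s^N (a - s)^2 >= 0. *)
Lemma young_exprn (N : nat) (a s : R) : 0 <= a -> 0 <= s ->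
  N.+1%:R * (a * s ^+ N) <= a ^+ N.+1 + N%:R * s ^+ N.+1.
Proof.
move=> a0 s0; elim: N => [|N IH]; first by rewrite expr0 mulr1 !expr1 mul0r addr0 mul1r.
have := ler_wpM2l a0 IH.
have : 0 <= N.+1%:R * (s ^+ N * (a - s) ^+ 2).
  by rewrite mulr_ge0// mulr_ge0 ?sqr_ge0 ?exprn_ge0.
rewrite !exprS -[N.+2]addn2 -[N.+1]addn1 !natrD.
set t := s ^+ N; set u := a ^+ N; set k := N%:R.
by move=> h1 h2; nra.
Qed.

End BoundedFactor.

Section Translation.
Context {R : realType} {V : normedModType R}.
Implicit Types (K : V -> R).

Lemma continuous_subl K (x : V) : continuous K -> continuous (fun z => K (x - z)).
Proof.
move=> cK z; have h : continuous (fun z : V => x - z).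
  by move=> w; apply: cvgB; [exact: cvg_cst|exact: cvg_id].
exact: (continuous_comp (h z) (cK _)).
Qed.

Lemma continuous_subr K (z : V) : continuous K -> continuous (fun x => K (x - z)).
Proof.
move=> cK x; have h : continuous (fun x : V => x - z).
  by move=> w; apply: cvgB; [exact: cvg_id|exact: cvg_cst].
exact: (continuous_comp (h x) (cK _)).
Qed.

End Translation.

Section Convolution.
Context {R : realType} {n : nat}.
Notation lam := (@lebesgueRn R n).
Notation integ f := (lam.-integrable setT (EFin \o f)).
Implicit Types (K f g : 'rV[R]_n -> R) (x z : 'rV[R]_n).

Definition conv K f x : R := \int[lam]_z (K (x - z) * f z).

Lemma measurable_kernel K x : continuous K ->
  measurable_fun (setT : set (Rn R n)) (fun z => K (x - z)).
Proof. by move=> cK; apply: continuous_Rn_measurable; exact: continuous_subl. Qed.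

Lemma integrable_kernel K f x : bounded_lipschitz K -> integ f ->
  integ (fun z => K (x - z) * f z).
Proof.
move=> bK fi; have [C _ [KC _]] := bK.
apply: (@integrableMl_bounded _ _ _ _ _ _ C) => //.
exact/measurable_kernel/bounded_lipschitz_continuous.
Qed.

Lemma conv_lipschitz K f : bounded_lipschitz K -> integ f -> bounded_lipschitz (conv K f).
Proof.
move=> bK fi; have [C C0 [KC KL]] := bK.
have nfi : integ (fun z => `|f z|) := integrable_norm fi.
have I0 : 0 <= \int[lam]_z `|f z| by apply: Rintegral_ge0.
have ZI c : integ (fun z => c * `|f z|) := integrableZl measurableT c nfi.
exists (C * \int[lam]_z `|f z|); first by rewrite mulr_ge0.
split=> [x|x y].
  rewrite -RintegralZl//; apply: norm_Rintegral_le => //; first exact: integrable_kernel.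
  by move=> z; rewrite normrM ler_wpM2r.
rewrite /conv -RintegralB//; try exact: integrable_kernel.
rewrite mulrAC -RintegralZl//; apply: norm_Rintegral_le => //.
  exact: (integrableB measurableT (integrable_kernel x bK fi) (integrable_kernel y bK fi)).
move=> z; rewrite -mulrBl normrM ler_wpM2r//; apply: (le_trans (KL _ _)).
by rewrite opprB addrA subrK.
Qed.

Lemma measurable_conv K f : bounded_lipschitz K -> integ f ->
  measurable_fun (setT : set (Rn R n)) (conv K f).
Proof.
move=> bK fi; apply: continuous_Rn_measurable.
exact/bounded_lipschitz_continuous/conv_lipschitz.
Qed.

(** The first-order Taylor remainder of the kernel is at most C |h|^2 uniformly in the base point;
    integrated against |f| it stays O(|h|^2), so differentiation under the integral comes with a
    rate. *)
Lemma is_derive_conv r j F f x : bump_family r F -> integ f ->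
  is_derive x (delta_mx ord0 j) (conv (prodfun F) f) (conv (prodfun (dprod j F)) f x).
Proof.
move=> bF fi; set v := delta_mx ord0 j.
have bF' := bump_family_dprod j bF; have bF'' := bump_family_dprod j bF'.
have KI y := integrable_kernel y (prodfun_bounded_lipschitz bF) fi.
have K'I y := integrable_kernel y (prodfun_bounded_lipschitz bF') fi.
have nfi : integ (fun z => `|f z|) := integrable_norm fi.
have ZI c : integ (fun z => c * `|f z|) := integrableZl measurableT c nfi.
have [C C0 [FC _]] := prodfun_bounded_lipschitz bF''.
have T1 y h : `|prodfun F (y + h *: v) - prodfun F y - h * prodfun (dprod j F) y| <= C * `|h| ^+ 2.
  apply: (taylor1_le y h _ _ FC) => w; apply: is_derive_prodfun => i t.
    exact: smooth_derivable (bF i).1 t.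
  exact: smooth_derivable (bF' i).1 t.
have I0 : 0 <= \int[lam]_z `|f z| by apply: Rintegral_ge0.
set D := C * \int[lam]_z `|f z|.
have D0 : 0 <= D by rewrite mulr_ge0.
have T2 h : `|conv (prodfun F) f (x + h *: v) - conv (prodfun F) f x
    - h * conv (prodfun (dprod j F)) f x| <= D * `|h| ^+ 2.
  rewrite /conv -RintegralB// -RintegralZl// -RintegralB//; last 2 first.
  - exact: (integrableB measurableT (KI _) (KI _)).
  - exact: (integrableZl measurableT h (K'I _)).
  rewrite /D mulrAC -RintegralZl//; apply: norm_Rintegral_le => //.
    exact: (integrableB measurableT (integrableB measurableT (KI _) (KI _))
      (integrableZl measurableT h (K'I _))).
  move=> z; rewrite mulrA -!mulrBl normrM ler_wpM2r//.
  by rewrite [x + _ - z]addrAC; exact: T1.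
have H : (fun h : R => h^-1 *: (conv (prodfun F) f (h *: v + x) - conv (prodfun F) f x)) @ 0^' -->
    conv (prodfun (dprod j F)) f x.
  apply/cvgrPdist_le => e e0; near=> h.
  have h0 : h != 0 by near: h; exact: nbhs_dnbhs_neq.
  rewrite distrC [h *: v + x]addrC /GRing.scale/=.
  have -> : h^-1 * (conv (prodfun F) f (x + h *: v) - conv (prodfun F) f x) - conv (prodfun (dprod j F)) f x
    = h^-1 * (conv (prodfun F) f (x + h *: v) - conv (prodfun F) f x - h * conv (prodfun (dprod j F)) f x).
    by rewrite [RHS]mulrBr mulKf.
  rewrite normrM normfV ler_pdivrMl ?normr_gt0//; apply: (le_trans (T2 h)).
  rewrite expr2 mulrA mulrC ler_wpM2l//.
  apply: (@le_trans _ _ ((D + 1) * `|h|)); first by rewrite ler_wpM2r// lerDl.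
  rewrite mulrC -ler_pdivlMr; last by rewrite ltr_wpDl.
  near: h; apply: dnbhs0_le; rewrite divr_gt0// ltr_wpDl//.
apply: DeriveDef; first by apply/cvg_ex; eexists; exact: H.
exact: cvg_lim H.
Unshelve. all: by end_near. Qed.

(** Joint measurability for Tonelli on the product of two completed sigma-algebras: the difference
    map takes values in [row_space], so it is enough to check its coordinates. *)
Lemma measurable_kernel2 K : continuous K ->
  measurable_fun setT (fun xz : Rn R n * Rn R n => K ((xz.1 : 'rV_n) - xz.2)).
Proof.
move=> cK; apply: (measurableT_comp (continuous_row_measurable cK)).
apply: (@measurability _ _ _ (row_space R n) setT
  (fun xz : Rn R n * Rn R n => (xz.1 : 'rV_n) - xz.2) (@cylinders R n) erefl).
move=> _ [_ [i [B [mB ->]]] <-]; rewrite setTI.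
have mc : measurable_fun (setT : set (Rn R n)) (fun x => (x : 'rV_n) ord0 i).
  by apply: measurable_fun_Rn; exact: measurable_coord.
have : measurable_fun setT (fun xz : Rn R n * Rn R n => (xz.1 : 'rV_n) ord0 i - (xz.2 : 'rV_n) ord0 i).
  by apply: measurable_funB; apply: (measurableT_comp mc); [exact: measurable_fst|exact: measurable_snd].
move=> /(_ measurableT _ mB); rewrite setTI; congr measurable.
by apply/seteqP; split=> xz /=; rewrite !mxE.
Qed.

Lemma ge0_integral_kernel K z : continuous K -> (forall x, 0 <= K x) ->
  (\int[lam]_x (K (x - z))%:E = \int[lam]_x (K x)%:E)%E.
Proof.
move=> cK K0.
transitivity (\int[lam]_x (K (- x))%:E)%E.
  rewrite -[RHS](@ge0_integral_reflect _ _ z (fun x => (K (- x))%:E)).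
  - by apply: eq_integral => x _; rewrite opprB.
  - apply/measurable_EFinP; apply: continuous_row_measurable => x.
    by apply: continuous_comp; [exact: continuousN|exact: cK].
  - by move=> x; rewrite lee_fin.
rewrite -[RHS](@ge0_integral_reflect _ _ 0 (fun x => (K x)%:E)).
- by apply: eq_integral => x _; rewrite sub0r.
- by apply/measurable_EFinP; exact: continuous_row_measurable.
- by move=> x; rewrite lee_fin.
Qed.

Lemma fubini_kernel K (f : Rn R n -> \bar R) : continuous K -> (forall x, 0 <= K x) ->
  measurable_fun setT f -> (forall x, 0 <= f x)%E ->
  (\int[lam]_x \int[lam]_z ((K ((x : 'rV_n) - z))%:E * f z) =
   \int[lam]_x (K x)%:E * \int[lam]_z f z)%E.
Proof.
move=> cK K0 mf f0.
rewrite (@fubini_tonelli _ _ _ _ R lam lam (fun xz => (K ((xz.1 : 'rV_n) - xz.2))%:E * f xz.2)%E)/=; last 2 first.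
- apply: emeasurable_funM; first by apply/measurable_EFinP; exact: measurable_kernel2.
  exact: (measurableT_comp mf measurable_snd).
- by move=> x; rewrite mule_ge0// lee_fin.
rewrite /fubini_G/=.
transitivity (\int[lam]_z ((\int[lam]_x (K x)%:E) * f z))%E.
  apply: eq_integral => z _; rewrite ge0_integralZr//.
  - by rewrite ge0_integral_kernel.
  - by apply/measurable_EFinP; apply: continuous_Rn_measurable; exact: continuous_subr.
  - by move=> x _; rewrite lee_fin.
by rewrite ge0_integralZl//; apply: integral_ge0 => x _; rewrite lee_fin.
Qed.

(* Jensen, in the form [n a s^(n-1) <= a^n + (n-1) s^n] with [s] the average of [f]. *)
Lemma conv_jensen K f N (m : R) x : bounded_lipschitz K -> (forall x, 0 <= K x) ->
  (\int[lam]_z (K z)%:E <= m%:E)%E -> 0 < m -> (forall x, 0 <= f x) ->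
  integ f -> integ (fun x => f x ^+ N.+1) ->
  conv K f x ^+ N.+1 <= m ^+ N * conv K (fun z => f z ^+ N.+1) x.
Proof.
move=> bK K0 Km m0 f0 fi fNi; have cK := bounded_lipschitz_continuous bK.
have KI := integrable_kernel x bK fi; have KNI := integrable_kernel x bK fNi.
pose c := conv K f x; pose s := c / m.
have c0 : 0 <= c by apply: Rintegral_ge0 => z _; rewrite mulr_ge0.
have s0 : 0 <= s by rewrite divr_ge0// ltW.
have Kx : (\int[lam]_z (K (x - z))%:E <= m%:E)%E.
  rewrite (@ge0_integral_reflect _ _ x (fun z => (K z)%:E))//.
  by apply/measurable_EFinP; exact: continuous_row_measurable.
have K1 : integ (fun z => K (x - z)).
  apply/integrableP; split; first by apply/measurable_EFinP; exact: measurable_kernel.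
  apply: le_lt_trans (ltry m); apply: le_trans Kx.
  by under eq_integral do rewrite /= ger0_norm//.
have Kx' : \int[lam]_z K (x - z) <= m.
  by rewrite -lee_fin (le_trans _ Kx)// fineK//; exact: integral_fune_fin_num.
have Z1 : integ (fun z => (N.+1%:R * s ^+ N) * (K (x - z) * f z)) := integrableZl measurableT _ KI.
have Z2 : integ (fun z => (N%:R * s ^+ N.+1) * K (x - z)) := integrableZl measurableT _ K1.
have : \int[lam]_z ((N.+1%:R * s ^+ N) * (K (x - z) * f z)) <=
    \int[lam]_z (K (x - z) * f z ^+ N.+1 + (N%:R * s ^+ N.+1) * K (x - z)).
  apply: le_Rintegral => //; first exact: (integrableD measurableT KNI Z2).
  move=> z _; have := ler_wpM2l (K0 (x - z)) (young_exprn N (f0 z) s0).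
  by rewrite mulrDr; set u := f z ^+ N.+1; congr (_ <= _ + _); ring.
rewrite RintegralD// !RintegralZl// -/(conv K f x) -/(conv K (fun z => f z ^+ N.+1) x) -/c.
set cN := conv K _ x; set I := Rintegral _ _ _ => H.
have H2 : N.+1%:R * s ^+ N * c <= cN + N%:R * s ^+ N.+1 * m.
  by apply: (le_trans H); rewrite lerD2l ler_wpM2l// mulr_ge0// exprn_ge0.
(* Substituting [c = s * m], the N copies of s^(N+1) m on the right cancel and s^(N+1) m <= [cN] is
   left; multiplying by m^N turns the left side into c^(N+1). *)
have cE : c = s * m by rewrite /s divfK// gt_eqF.
have : s ^+ N.+1 * m <= cN.
  move: H2; rewrite cE (_ : _ * (s * m) = s ^+ N.+1 * m + N%:R * s ^+ N.+1 * m); last first.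
    by rewrite exprS -natr1; ring.
  by rewrite lerD2r.
rewrite -(ler_pM2l (exprn_gt0 N m0)) => /(le_trans _); apply.
by rewrite cE exprMn mulrCA -exprSr.
Qed.

Lemma conv_norm_le K f x : bounded_lipschitz K -> integ f ->
  `|conv K f x| <= conv (fun x => `|K x|) (fun z => `|f z|) x.
Proof.
move=> bK fi; have [C C0 [KC KL]] := bK.
have bK' : bounded_lipschitz (fun x => `|K x|).
  exists C => //; split=> [y|y z]; first by rewrite normr_id.
  exact: le_trans (ler_dist_dist _ _) (KL _ _).
apply: norm_Rintegral_le.
- exact: integrable_kernel.
- exact: (integrable_kernel x bK' (integrable_norm fi)).
- by move=> z; rewrite normrM.
Qed.

(** Young's inequality for a kernel of L^1 norm at most m: the pointwise Jensen inequality
    contributes m^N and Tonelli the remaining factor m. *)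
Lemma conv_Lp_le K f N (m : R) : bounded_lipschitz K ->
  (\int[lam]_z `|K z|%:E <= m%:E)%E -> 0 < m ->
  integ f -> integ (fun x => `|f x| ^+ N.+1) ->
  (\int[lam]_x (`|conv K f x| ^+ N.+1)%:E <= (m ^+ N.+1)%:E * \int[lam]_x (`|f x| ^+ N.+1)%:E)%E.
Proof.
move=> bK Km m0 fi fNi; have [C C0 [KC KL]] := bK.
have bK' : bounded_lipschitz (fun x => `|K x|).
  exists C => //; split=> [y|y z]; first by rewrite normr_id.
  exact: le_trans (ler_dist_dist _ _) (KL _ _).
have cK' := bounded_lipschitz_continuous bK'.
have nfi := integrable_norm fi.
have mN : measurable_fun (setT : set (Rn R n)) (fun x => `|f x| ^+ N.+1).
  by apply/measurable_EFinP/measurable_int/fNi.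
have A x : `|conv K f x| ^+ N.+1 <=
    m ^+ N * conv (fun x => `|K x|) (fun z => `|f z| ^+ N.+1) x.
  apply: (le_trans _ (conv_jensen x bK' (fun _ => normr_ge0 _) Km m0 (fun _ => normr_ge0 _) nfi fNi)).
  by apply: lerXn2r; rewrite ?nnegrE ?conv_norm_le// (le_trans _ (conv_norm_le x bK fi)).
apply: (@le_trans _ _ (\int[lam]_x ((m ^+ N)%:E * (conv (fun x => `|K x|) (fun z => `|f z| ^+ N.+1) x)%:E)))%E.
  apply: ge0_le_integral; first exact: measurableT.
  - by move=> x _; rewrite lee_fin exprn_ge0.
  - apply/measurable_EFinP/measurable_funX; apply: measurableT_comp; first exact: normr_measurable.
    exact: measurable_conv.
  - by apply/measurable_EFinP/measurable_funM; [exact: measurable_cst|exact: (measurable_conv bK' fNi)].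
  - by move=> x _; rewrite -EFinM lee_fin.
have E x : (conv (fun x => `|K x|) (fun z => `|f z| ^+ N.+1) x)%:E =
    (\int[lam]_z (`|K (x - z)|%:E * (`|f z| ^+ N.+1)%:E))%E.
  have KNI := integrable_kernel x bK' fNi.
  by rewrite /conv /Rintegral fineK//; exact: integral_fune_fin_num.
rewrite ge0_integralZl//; last 3 first.
- by apply/measurable_EFinP; exact: (measurable_conv bK' fNi).
- by move=> x _; rewrite E; apply: integral_ge0 => z _; rewrite -EFinM lee_fin mulr_ge0// exprn_ge0.
- by rewrite lee_fin exprn_ge0// ltW.
under eq_integral do rewrite E.
have mN' := measurable_int lam fNi.
have N0 x : (0 <= (`|f x| ^+ N.+1)%:E)%E by rewrite lee_fin exprn_ge0.
rewrite (fubini_kernel cK' (fun=> normr_ge0 _) mN' N0).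
rewrite exprSr EFinM -!muleA lee_pmul2l ?lte_fin ?exprn_gt0//.
by rewrite lee_wpmul2r//; apply: integral_ge0 => z _; rewrite lee_fin exprn_ge0.
Qed.

End Convolution.

(** * Density in L^1 *)

Section DominatedL1.
Context d (T : measurableType d) {R : realType} (mu : {measure set T -> \bar R}).

Lemma measurable_of_integrable (f : T -> R) :
  mu.-integrable setT (EFin \o f) -> measurable_fun setT f.
Proof. by move=> fi; apply/measurable_EFinP; exact: measurable_int fi. Qed.

Lemma dominated_L1 (f_ : nat -> T -> R) (f g : T -> R) :
  (forall k, measurable_fun setT (f_ k)) -> mu.-integrable setT (EFin \o g) ->
  (forall k x, `|f_ k x| <= g x) -> (forall x, f_ k x @[k --> \oo] --> f x) ->
  mu.-integrable setT (EFin \o f) /\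
  (fun k => \int[mu]_x `|f_ k x - f x|) @ \oo --> (0 : R).
Proof.
move=> mf_ gi fg ff.
have mf : measurable_fun setT f by apply: (measurable_fun_cvg (h := f_)) => // x _; exact: ff.
have [] := @dominated_convergence _ _ _ mu setT measurableT (fun k => EFin \o f_ k) (EFin \o f) (EFin \o g).
- by move=> k; apply/measurable_EFinP; exact: mf_.
- by apply/measurable_EFinP.
- by apply: aeW => x _; apply: cvg_EFin; [exact: nearW|exact: ff].
- exact: gi.
- by apply: aeW => x k _; rewrite lee_fin.
move=> fi H _; split; first exact: fi.
exact: (fine_cvg H).
Qed.

End DominatedL1.

Section Density.
Local Open Scope ring_scope.

Context {R : realType} {n : nat}.
Notation lam := (@lebesgueRn R n).
Notation integ f := (lam.-integrable setT (EFin \o f)).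
Implicit Types (f g : 'rV[R]_n -> R) (A : set 'rV[R]_n).

(** Open sets are closed under intersection, so this is the generator from which the Dynkin argument
    of [Pborel] starts. *)
Lemma row_measurableE :
  @measurable _ (row_space R n) = <<s [set V : set 'rV[R]_n | open V] >>.
Proof.
apply/seteqP; split; apply: smallest_sub.
- exact: smallest_sigma_algebra.
- move=> _ [i [B [mB ->]]].
  have mc : measurable_fun (setT : set (borel 'rV[R]_n)) (fun x : 'rV[R]_n => x ord0 i).
    apply: (@measurability _ _ (borel 'rV[R]_n) _ setT (fun x : 'rV[R]_n => x ord0 i) _ (RGenOInfty.measurableE R)).
    move=> _ [_ [a ->] <-]; rewrite setTI; apply: sub_sigma_algebra.
    by apply: open_comp; [move=> x _; exact: coord_continuous|exact: interval_open].
  by have := mc measurableT _ mB; rewrite setTI.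
- exact: sigma_algebra_measurable.
- by move=> V oV; exact: open_row_measurable.
Qed.

Definition cube (k : nat) : set 'rV[R]_n := ball (0 : 'rV[R]_n) k.+1%:R.

Lemma open_cube k : open (cube k).
Proof. exact: ball_open. Qed.

Lemma measurable_cube k : @measurable _ (Rn R n) (cube k).
Proof. by apply: open_Rn_measurable; exact: open_cube. Qed.

Lemma bounded_measurable_lty A : @measurable _ (Rn R n) A -> (exists k, A `<=` cube k) ->
  (lam A < +oo)%E.
Proof.
move=> mA [k Ak]; apply: bounded_lebesgueRn_lty => //.
exists k.+1%:R; split=> // M kM x /Ak; rewrite /cube mx_norm_ball /ball_/= sub0r normrN => xk.
by rewrite ltW// (lt_trans xk).
Qed.

Lemma integrable_indicT A : @measurable _ (Rn R n) A -> (lam A < +oo)%E -> integ (\1_A : 'rV[R]_n -> R).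
Proof.
move=> mA Aoo; apply/integrableP; split.
  by apply/measurable_EFinP; apply: (@measurable_indic _ (Rn R n)).
rewrite (eq_integral (fun x : Rn R n => (\1_A x)%:E)).
  by rewrite integral_indic// setIT.
by move=> x _ /=; rewrite ger0_norm.
Qed.

Lemma indicI (A B : set 'rV[R]_n) x : \1_(A `&` B) x = \1_A x * \1_B x :> R.
Proof. by rewrite indicI. Qed.

Lemma cube_cvg x : \1_(cube k) x @[k --> \oo] --> (1 : R).
Proof.
have [k0 xk] : exists k0 : nat, `|x| < k0%:R.
  by exists (Num.trunc `|x|).+1; exact: truncnS_gt.
apply: cvg_near_cst; exists k0 => // k /= k0k.
rewrite indicE mem_set// /cube mx_norm_ball /ball_/= sub0r normrN.
by rewrite (lt_le_trans xk)// ler_nat (leq_trans k0k).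
Qed.

Section Induction.
Variable P : ('rV[R]_n -> R) -> Prop.
Hypothesis PL : forall a f g, integ f -> integ g -> P f -> P g -> P (fun x => a * f x + g x).
Hypothesis Plim : forall f, integ f ->
  (forall e : R, 0 < e -> exists g, [/\ integ g, P g & \int[lam]_x `|g x - f x| <= e]) -> P f.
Hypothesis Popen : forall V : set 'rV[R]_n, open V -> (exists k, V `<=` cube k) -> P (\1_V : 'rV[R]_n -> R).

Lemma Pdominated (f_ : nat -> 'rV[R]_n -> R) f g :
  (forall k, integ (f_ k)) -> integ g -> (forall k x, `|f_ k x| <= g x) ->
  (forall x, f_ k x @[k --> \oo] --> f x) -> (forall k, P (f_ k)) -> P f.
Proof.
move=> fi_ gi fg ff Pf.
have [fi fL] := @dominated_L1 _ (Rn R n) R lam f_ f g (fun k => measurable_of_integrable (fi_ k)) gi fg ff.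
apply: Plim => // e e0.
move: fL => /cvgrPdist_le/(_ e e0)[k _ /(_ k (leqnn k))/=].
rewrite sub0r normrN => /(le_trans (ler_norm _)) H; exists (f_ k); split => //.
Qed.

Lemma P0 : P (fun=> 0).
Proof.
have := Popen (@open0 'rV[R]_n) (ex_intro _ 0%N (@sub0set _ (cube 0))).
by rewrite indic0.
Qed.

Let measurable_capcube (B : set 'rV[R]_n) k : @measurable _ (Rn R n) B ->
  @measurable _ (Rn R n) (B `&` cube k).
Proof. by move=> mB; apply: (@measurableI _ (Rn R n)) => //; exact: measurable_cube. Qed.

Let integrable_capcube (B : set 'rV[R]_n) k : @measurable _ (Rn R n) B ->
  integ (\1_(B `&` cube k) : 'rV[R]_n -> R).
Proof.
move=> mB; apply: integrable_indicT; first exact: measurable_capcube.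
by apply: bounded_measurable_lty; [exact: measurable_capcube|exists k; exact: subIsetr].
Qed.

(** Dynkin induction: complements within the cube are linear combinations, and countable disjoint
    unions are dominated limits of finite sums. The cube keeps every indicator integrable. *)
Lemma Pborel k (B : set 'rV[R]_n) : @measurable _ (row_space R n) B ->
  P (\1_(B `&` cube k) : 'rV[R]_n -> R).
Proof.
move=> mB.
have iQ : integ (\1_(cube k) : 'rV[R]_n -> R).
  by have := @integrable_capcube setT k (@measurableT _ (Rn R n)); rewrite setTI.
have PQ : P (\1_(cube k) : 'rV[R]_n -> R).
  by apply: Popen; [exact: open_cube|exists k].
pose PP (B : set (row_space R n)) := P (\1_((B : set 'rV[R]_n) `&` cube k) : 'rV[R]_n -> R).
apply: (@dynkin_induction _ (row_space R n) [set V : set 'rV[R]_n | open V] PP row_measurableE) => //.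
- by move=> U V; exact: openI.
- by rewrite /PP setTI.
- move=> V oV; apply: Popen; first by apply: openI => //; exact: open_cube.
  by exists k; exact: subIsetr.
- move=> S mS PS; rewrite /PP.
  have -> : \1_(~` S `&` cube k) = (fun x => -1 * \1_(S `&` cube k) x + \1_(cube k) x) :> ('rV[R]_n -> R).
    apply/funext => x; rewrite !indicI !indicE in_setC.
    by case: (x \in S); case: (x \in cube k); rewrite /=; lra.
  by apply: PL => //; apply: integrable_capcube; exact: row_measurable_Rn.
- move=> F mF tF PF; rewrite /PP.
  have mFN N : @measurable _ (Rn R n) (\big[setU/set0]_(i < N) F i).
    by apply: (@bigsetU_measurable _ (Rn R n)) => i _; exact: row_measurable_Rn.
  apply: (@Pdominated (fun N => \1_((\big[setU/set0]_(i < N) F i) `&` cube k)) _ (\1_(cube k))).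
  + by move=> N; exact: integrable_capcube.
  + exact: iQ.
  + move=> N x; rewrite indicI ger0_norm ?mulr_ge0// -[leRHS]mul1r ler_wpM2r//.
  + move=> x; have [[i _ Fi]|nF] := pselect ((\bigcup_i F i) x).
      apply: cvg_near_cst; exists i.+1 => // N /= iN; rewrite !indicI; congr (_ * _).
      rewrite !indicE !mem_set//; first by exists i.
      by rewrite -bigcup_mkord; exists i.
    apply: cvg_near_cst; exists 0%N => // N _; rewrite !indicI; congr (_ * _).
    rewrite !indicE !memNset// -bigcup_mkord => -[i _ Fi].
    by apply: nF; exists i.
  + elim=> [|N IH]; first by rewrite big_ord0 set0I indic0; exact: P0.
    have -> : \1_(\big[setU/set0]_(i < N.+1) F i `&` cube k) = (fun x =>
        1 * \1_(\big[setU/set0]_(i < N) F i `&` cube k) x + \1_(F N `&` cube k) x) :> ('rV[R]_n -> R).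
      apply/funext => x; rewrite mul1r !indicI -mulrDl; congr (_ * _).
      rewrite big_ord_recr/= !indicE in_setU.
      have [xF|_] := boolP (x \in F N); last by rewrite orbF addr0.
      rewrite orbT (_ : (x \in _) = false) ?add0r//; apply/negP; rewrite in_setE -bigcup_mkord.
      move: xF; rewrite in_setE => xF [i /= iN Fi].
      by move: iN; rewrite (tF i N I I (ex_intro _ x (conj Fi xF))) ltnn.
    apply: PL; [exact: (@integrable_capcube _ k (mFN N))| |exact: IH|exact: PF].
    exact: (@integrable_capcube _ k (row_measurable_Rn (mF N))).
- by rewrite -row_measurableE.
Qed.

(** A set of the completed sigma-algebra is reached in L^1: the infimum that defines the outer
    measure provides a covering set in the product sigma-algebra with excess measure below [e]. *)
Lemma Pset k A : @measurable _ (Rn R n) A -> P (\1_(A `&` cube k) : 'rV[R]_n -> R).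
Proof.
move=> mA; apply: Plim; first exact: integrable_capcube.
move=> e e0.
have mAk := @measurable_capcube A k mA.
have Aoo : (lam (A `&` cube k) < +oo)%E.
  by apply: bounded_measurable_lty; [exact: mAk|exists k; exact: subIsetr].
have [B [mB AB BA]] : exists B : set 'rV[R]_n,
    [/\ @measurable _ (row_space R n) B, A `&` cube k `<=` B & (lam B < lam (A `&` cube k) + e%:E)%E].
  have Afin : mu_ext (product_lebesgue R n) (A `&` cube k) \is a fin_num by rewrite ge0_fin_numE ?mu_ext_ge0.
  have [_ [F [mF AF] <-] Fe] := lb_ereal_inf_adherent e0 Afin.
  have mU : @measurable _ (row_space R n) (\bigcup_i F i) by exact: bigcupT_measurable.
  exists (\bigcup_i F i); split => //.
  apply: le_lt_trans Fe; rewrite lebesgueRnE//.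
  by apply: measure_sigma_subadditive.
have mBR := row_measurable_Rn mB.
exists (\1_(B `&` cube k)); split; [exact: integrable_capcube|exact: Pborel|].
have AkBk : A `&` cube k `<=` B `&` cube k by move=> x [Ax Qx]; split=> //; apply: AB.
rewrite (_ : (fun x => _) = (fun x => \1_(B `&` cube k) x - \1_(A `&` cube k) x)); last first.
  apply/funext => x; rewrite ger0_norm// subr_ge0 !indicE ler_nat.
  by case: (boolP (x \in A `&` cube k)) => //; rewrite in_setE => /AkBk xB; rewrite mem_set.
rewrite RintegralB//; try exact: integrable_capcube.
have mBk := @measurable_capcube B k mBR.
rewrite /Rintegral !integral_indic// !setIT lerBlDl -lee_fin EFinD fineK ?fineK.
- by apply: le_trans (ltW BA); apply: le_measure; rewrite ?in_setE//; exact: subIsetl.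
- by rewrite ge0_fin_numE.
- rewrite ge0_fin_numE//; apply: bounded_measurable_lty; [exact: mBk|exists k; exact: subIsetr].
Qed.

Lemma Psum k (s : seq R) (S : R -> set 'rV[R]_n) : (forall y, @measurable _ (Rn R n) (S y)) ->
  P (fun x => (\sum_(y <- s) y * \1_(S y) x) * \1_(cube k) x) /\
  integ (fun x => (\sum_(y <- s) y * \1_(S y) x) * \1_(cube k) x).
Proof.
move=> mS; elim: s => [|y s [IHP IHi]].
  under eq_fun do rewrite big_nil mul0r.
  by split; [exact: P0|exact: integrable0].
have E : (fun x => (\sum_(z <- y :: s) z * \1_(S z) x) * \1_(cube k) x) =
   (fun x => y * \1_(S y `&` cube k) x + (\sum_(z <- s) z * \1_(S z) x) * \1_(cube k) x).
  by apply/funext => x; rewrite big_cons mulrDl indicI mulrA.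
rewrite E; split.
  by apply: PL => //; [exact: integrable_capcube|exact: Pset].
exact: (integrableD measurableT (integrableZl measurableT y (integrable_capcube k (mS y))) IHi).
Qed.

Import HBSimple.

(** After restriction to a cube, simple functions, which are combinations of the sets treated in
    [Pset], approximate [f] in L^1; exhaustion by cubes is a dominated limit. *)
Lemma L1_induction f : integ f -> P f.
Proof.
move=> fi; have mf := @measurable_of_integrable _ (Rn R n) R lam _ fi.
have nfi : integ (fun z => `|f z|) := integrable_norm fi.
have fki k : integ (fun x => \1_(cube k) x * f x).
  apply: (@integrableMl_bounded _ (Rn R n) R lam (\1_(cube k)) f 1) => //.
    by apply: (@measurable_indic _ (Rn R n)); exact: measurable_cube.
  by move=> x; rewrite indicE; case: (_ \in _); rewrite ?normr1 ?normr0.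
apply: (@Pdominated (fun k x => \1_(cube k) x * f x) _ (fun x => `|f x|)) => //.
- by move=> k x; rewrite normrM -[leRHS]mul1r ler_wpM2r// indicE; case: (_ \in _); rewrite ?normr1 ?normr0.
- move=> x; rewrite -[X in _ --> X]mul1r; apply: cvgMl; exact: cube_cvg.
move=> k.
have [g [gi _ gL]] := @approximation_sfun_integrable _ (Rn R n) R lam setT measurableT _ fi.
apply: Plim => // e e0.
have : (fun m => \int[lam]_z `|f z - g m z|) @ \oo --> (0 : R) by exact: (fine_cvg gL).
move=> /cvgrPdist_le/(_ e e0)[m _ /(_ m (leqnn m))/=].
rewrite sub0r normrN => /(le_trans (ler_norm _)) H.
have mg y : @measurable _ (Rn R n) (g m @^-1` [set y]) by exact: measurable_sfunP.
have [PS iS] := @Psum k (finmap.enum_fset (fset_set (range (g m)))) (fun y => g m @^-1` [set y]) mg.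
have E : (fun x => (\sum_(y <- finmap.enum_fset (fset_set (range (g m)))) y * \1_(g m @^-1` [set y]) x) * \1_(cube k) x)
    = (fun x => g m x * \1_(cube k) x).
  by apply/funext => x; rewrite [in RHS]fimfunE fsbig_finite.
rewrite E in PS iS.
exists (fun x => g m x * \1_(cube k) x); split => //.
apply: le_trans H; apply: le_Rintegral => //.
- exact: (integrable_norm (integrableB measurableT iS (fki k))).
- exact: (integrable_norm (integrableB measurableT fi (gi m))).
move=> x _; rewrite [_ * f x]mulrC -mulrBl normrM distrC -[leRHS]mulr1 ler_wpM2l//.
by rewrite indicE; case: (_ \in _); rewrite ?normr1 ?normr0.
Qed.

End Induction.
End Density.

(** * Mollifiers *)

Section SmallLemmas.
Context {R : realType}.

Lemma squeeze_cvg0 (u v : nat -> R) : (forall m, 0 <= u m <= v m) ->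
  v @ \oo --> (0 : R) -> u @ \oo --> (0 : R).
Proof.
move=> uv v0; apply: (@squeeze_cvgr _ _ _ _ (fun=> 0) v) => //; last exact: cvg_cst.
by apply: nearW => m; rewrite uv.
Qed.

Lemma exprD3_le N (a b c : R) : 0 <= a -> 0 <= b -> 0 <= c ->
  (a + b + c) ^+ N <= 3%:R ^+ N * (a ^+ N + b ^+ N + c ^+ N).
Proof.
move=> a0 b0 c0; set M := Num.max a (Num.max b c).
have [aM bM cM] : [/\ a <= M, b <= M & c <= M].
  by rewrite /M !le_max !lexx !orbT.
have M0 : 0 <= M := le_trans a0 aM.
apply: (@le_trans _ _ ((3%:R * M) ^+ N)).
  by apply: lerXn2r; rewrite ?nnegrE ?addr_ge0 ?mulr_ge0//; lra.
rewrite exprMn ler_wpM2l ?exprn_ge0//.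
have [aN bN cN] : [/\ 0 <= a ^+ N, 0 <= b ^+ N & 0 <= c ^+ N] by rewrite !exprn_ge0.
have [->|[->|->]] : M = a \/ M = b \/ M = c; [|lra..].
by rewrite /M; case: (leP b c) => _; case: leP => _; auto.
Qed.

End SmallLemmas.

Section Mollifier.
Context {R : realType} {n : nat}.
Notation lam := (@lebesgueRn R n).
Notation integ f := (lam.-integrable setT (EFin \o f)).
Implicit Types (f g : 'rV[R]_n -> R) (A : set 'rV[R]_n) (m : nat).

Definition moll m (t : R) := m.+1%:R * bump (m.+1%:R * t).

Lemma moll_ge0 m t : 0 <= moll m t.
Proof. by rewrite mulr_ge0// bump_ge0. Qed.

Lemma smooth_moll m : smooth (moll m).
Proof.
move=> k; apply: smooth_uptoM; first exact: smooth_upto_cst.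
have := @smooth_upto_affine R k bump m.+1%:R 0 (smooth_derive1 smooth_step k).
by under eq_fun do rewrite addr0.
Qed.

Lemma moll_support m t : m.+1%:R^-1 < `|t| -> moll m t = 0.
Proof.
move=> mt; rewrite /moll bump_eq0 ?mulr0// normrM ger0_norm//.
by rewrite mulrC -ler_pdivrMr// mul1r ltW.
Qed.

(** A tensor product rather than a radial mollifier, so that passing from one scale to another can
    be done coordinate by coordinate. Its support lies in a cube of half-side 1/(m+1). *)
Definition eta m : 'rV[R]_n -> R := prodfun (fun=> moll m).

Lemma moll_family m : bump_family m.+1%:R^-1 (fun _ : 'I_n => moll m).
Proof. by move=> i; split; [exact: smooth_moll|exact: moll_support]. Qed.

Lemma eta_ge0 m x : 0 <= eta m x.
Proof. by rewrite /eta /prodfun prodr_ge0// => i _; exact: moll_ge0. Qed.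

Lemma eta_bounded_lipschitz m : bounded_lipschitz (eta m).
Proof. exact: prodfun_bounded_lipschitz (moll_family m). Qed.

Lemma eta_continuous m : continuous (eta m).
Proof. exact/bounded_lipschitz_continuous/eta_bounded_lipschitz. Qed.

Lemma eta_support m (x z : 'rV[R]_n) : eta m (x - z) != 0 -> forall i, `|x ord0 i - z ord0 i| <= m.+1%:R^-1.
Proof.
move=> e0 i; rewrite leNgt; apply: contra e0 => h; apply/eqP.
by apply: (prodfun_support (i := i) (moll_family m)); rewrite !mxE.
Qed.

Lemma integral_eta m : (\int[lam]_x (eta m x)%:E = 1)%E.
Proof.
rewrite (@ge0_integral_prodfun R n (fun=> moll m)).
- by rewrite big1// => i _; apply: integral_bump; rewrite ler1n.
- by move=> i; apply: continuous_measurable_fun; exact/smooth_continuous/smooth_moll.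
- by move=> i t; exact: moll_ge0.
Qed.

Lemma integral_eta_norm m : (\int[lam]_x `|eta m x|%:E <= 1%:E)%E.
Proof. by under eq_integral do rewrite ger0_norm ?eta_ge0//; rewrite integral_eta. Qed.

Lemma integral_eta_subl m x : integ (fun z => eta m (x - z)) /\ \int[lam]_z eta m (x - z) = 1.
Proof.
have H : (\int[lam]_z (eta m (x - z))%:E = 1)%E.
  rewrite (@ge0_integral_reflect R n x (fun z => (eta m z)%:E)) ?integral_eta//.
    by apply/measurable_EFinP; apply: continuous_row_measurable; exact: eta_continuous.
  by move=> z; rewrite lee_fin eta_ge0.
split; last by rewrite /Rintegral H.
apply/integrableP; split.
  by apply/measurable_EFinP; apply: measurable_kernel; exact: eta_continuous.
rewrite (eq_integral (fun z : Rn R n => (eta m (x - (z : 'rV[R]_n)))%:E)) ?H ?ltry//.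
by move=> z _ /=; rewrite ger0_norm ?eta_ge0.
Qed.

Lemma integrable_conv m f : integ f -> integ (conv (eta m) f).
Proof.
move=> fi; apply/integrableP; split.
  by apply/measurable_EFinP; apply: measurable_conv => //; exact: eta_bounded_lipschitz.
have nfi := integrable_norm fi.
have := @conv_Lp_le R n (eta m) f 0 1 (eta_bounded_lipschitz m) (integral_eta_norm m) ltr01 fi nfi.
rewrite expr1 mul1e => H; apply: le_lt_trans H _.
by move/integrableP : fi => [].
Qed.

Lemma norm1_conv m f : integ f -> \int[lam]_x `|conv (eta m) f x| <= \int[lam]_x `|f x|.
Proof.
move=> fi; have nfi := integrable_norm fi.
have := @conv_Lp_le R n (eta m) f 0 1 (eta_bounded_lipschitz m) (integral_eta_norm m) ltr01 fi nfi.
rewrite expr1 mul1e => H; apply: fine_le => //.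
- exact: (integral_fune_fin_num measurableT (integrable_norm (integrable_conv m fi))).
- exact: (integral_fune_fin_num measurableT nfi).
Qed.

Lemma convL m a f g x : integ f -> integ g ->
  conv (eta m) (fun x => a * f x + g x) x = a * conv (eta m) f x + conv (eta m) g x.
Proof.
move=> fi gi; have bK := eta_bounded_lipschitz m.
have fi' := integrable_kernel x bK fi; have gi' := integrable_kernel x bK gi.
rewrite /conv -RintegralZl// -RintegralD//; last exact: (integrableZl measurableT a fi').
by apply: eq_Rintegral => z _; ring.
Qed.

Lemma Rintegral_indic A : @measurable _ (Rn R n) A -> \int[lam]_x (\1_A x : R) = fine (lam A).
Proof. by move=> mA; rewrite /Rintegral integral_indic// setIT. Qed.

Lemma conv_indic_bounds m A x : @measurable _ (Rn R n) A -> integ (\1_A : _ -> R) ->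
  0 <= conv (eta m) \1_A x <= 1.
Proof.
move=> mA iA; have bK := eta_bounded_lipschitz m.
have [ie e1] := integral_eta_subl m x.
apply/andP; split; first by apply: Rintegral_ge0 => z _; rewrite mulr_ge0 ?eta_ge0.
rewrite -e1; apply: le_Rintegral => //; first exact: integrable_kernel.
by move=> z _; rewrite -[leRHS]mulr1 ler_wpM2l ?eta_ge0// indicE; case: (_ \in _).
Qed.

Lemma integral_conv m f : integ f -> (forall x, 0 <= f x) ->
  \int[lam]_x conv (eta m) f x = \int[lam]_x f x.
Proof.
move=> fi f0; have bK := eta_bounded_lipschitz m.
rewrite /Rintegral; congr fine.
rewrite -[RHS]mul1e -(integral_eta m).
rewrite -(fubini_kernel (eta_continuous (m := m)) (eta_ge0 m) (measurable_int _ fi)); last first.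
  by move=> x; rewrite lee_fin.
apply: eq_integral => x _; rewrite /conv /Rintegral fineK//.
exact: (integral_fune_fin_num measurableT (integrable_kernel x bK fi)).
Qed.

Definition L1_approximable f :=
  (fun m => \int[lam]_x `|conv (eta m) f x - f x|) @ \oo --> (0 : R).

(** Mollification preserves mass and keeps the values in [0, 1], so the L^1 error is twice the mass
    that leaves [V]. That mass tends to 0 because at a point of the open set [V] the mollified
    indicator is eventually equal to 1. *)
Lemma L1_approximable_open (V : set 'rV[R]_n) : open V -> (exists k, V `<=` cube k) ->
  L1_approximable (\1_V).
Proof.
move=> oV Vk; have mV := open_Rn_measurable oV.
have iV := integrable_indicT mV (bounded_measurable_lty mV Vk).
have B m x := conv_indic_bounds m x mV iV.
have iP m : integ (fun x => \1_V x * conv (eta m) \1_V x).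
  apply: (@integrableMl_bounded _ (Rn R n) R lam (\1_V) _ 1).
  - exact: (@measurable_indic _ (Rn R n)).
  - by move=> x; rewrite indicE; case: (_ \in _); rewrite ?normr1 ?normr0.
  - exact: integrable_conv.
have E m : \int[lam]_x `|conv (eta m) \1_V x - \1_V x| =
    2 * (\int[lam]_x \1_V x - \int[lam]_x (\1_V x * conv (eta m) \1_V x)).
  transitivity (\int[lam]_x ((conv (eta m) \1_V x + \1_V x) - 2 * (\1_V x * conv (eta m) \1_V x))).
    apply: eq_Rintegral => x _; have /andP[c0 c1] := B m x.
    rewrite indicE; case: (x \in V) => /=.
      by rewrite mul1r ler0_norm; lra.
    by rewrite subr0 mul0r mulr0 addr0 subr0 ger0_norm.
  rewrite RintegralB//; last 2 first.
  - exact: (integrableD measurableT (integrable_conv m iV) iV).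
  - exact: (integrableZl measurableT 2 (iP m)).
  rewrite RintegralD//; last exact: integrable_conv.
  rewrite RintegralZl// integral_conv//; lra.
have H := @dominated_L1 _ (Rn R n) R lam (fun m x => \1_V x * conv (eta m) \1_V x) (\1_V) (\1_V)
  (fun m => measurable_of_integrable (iP m)) iV.
have [||_ D] := H.
- move=> m x; have /andP[c0 c1] := B m x.
  by rewrite ger0_norm ?mulr_ge0// -[leRHS]mulr1 ler_wpM2l.
- move=> x; have [Vx|nVx] := pselect (V x); last first.
    apply: cvg_near_cst; apply: nearW => m.
    by rewrite indicE memNset// mul0r.
  have /nbhs_ballP[e /= e0 xeV] := open_nbhs_nbhs (conj oV Vx).
  have [k _ ke] := near_infty_natSinv_lt (PosNum e0).
  apply: cvg_near_cst; exists k => // m /= km; rewrite indicE mem_set// mul1r.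
  have [_ <-] := integral_eta_subl m x; apply: eq_Rintegral => z _.
  have [->|ez] := eqVneq (eta m (x - z)) 0; first by rewrite mul0r.
  rewrite indicE mem_set ?mulr1//; apply: xeV; apply/ball_rVP => // i.
  exact: le_lt_trans (eta_support ez i) (ke m km).
apply: (@squeeze_cvg0 _ _ (fun m => 2 * \int[lam]_x `|\1_V x * conv (eta m) \1_V x - \1_V x|)); last first.
  by rewrite -[X in _ --> X](mulr0 2); apply: cvgMr.
move=> m; rewrite Rintegral_ge0//= E ler_wpM2l// -RintegralB//.
have i1 := integrableB measurableT iV (iP m).
apply: (le_trans (ler_norm _)); apply: (le_trans (le_normr_Rintegral measurableT i1)).
by rewrite le_eqVlt; apply/orP; left; apply/eqP; apply: eq_Rintegral => x _; rewrite distrC.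
Qed.

(** Stability under L^1 limits, as [L1_induction] requires, holds because mollification is a
    contraction of L^1. *)
Lemma L1_approximation f : integ f -> L1_approximable f.
Proof.
move=> fi; apply: (L1_induction (P := L1_approximable)) fi.
- move=> a {}f g fi gi Pf Pg; rewrite /L1_approximable.
  apply: (@squeeze_cvg0 _ _ (fun m => `|a| * \int[lam]_x `|conv (eta m) f x - f x| +
    \int[lam]_x `|conv (eta m) g x - g x|)); last first.
    by rewrite -[X in _ --> X](addr0 0) -[X in _ --> X + _](mulr0 `|a|); apply: cvgD => //; apply: cvgMr.
  move=> m; rewrite Rintegral_ge0//=.
  have i1 := integrable_norm (integrableB measurableT (integrable_conv m fi) fi).
  have i2 := integrable_norm (integrableB measurableT (integrable_conv m gi) gi).
  have i3 := integrableD measurableT (integrableZl measurableT a fi) gi.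
  rewrite -RintegralZl// -RintegralD//; last exact: (integrableZl measurableT `|a| i1).
  apply: le_Rintegral => //.
  + exact: (integrable_norm (integrableB measurableT (integrable_conv m i3) i3)).
  + exact: (integrableD measurableT (integrableZl measurableT `|a| i1) i2).
  move=> x _; rewrite convL// -normrM; apply: le_trans (ler_normD _ _).
  by rewrite le_eqVlt; apply/orP; left; apply/eqP; congr `|_|; ring.
- move=> {}f fi H; apply/cvgrPdist_le => e e0.
  have e3 : 0 < e / 3 by lra.
  have [g [gi Pg gf]] := H _ e3.
  move: Pg => /cvgrPdist_le/(_ _ e3)[m0 _ Hm]; exists m0 => // m /= m0m.
  have {}Hm := Hm m m0m; rewrite /= sub0r normrN in Hm.
  rewrite sub0r normrN ger0_norm ?Rintegral_ge0//.
  have gfi := integrableB measurableT gi fi.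
  have i1 := integrable_norm (integrableB measurableT (integrable_conv m gi) gi).
  have i2 := integrable_norm (integrable_conv m gfi).
  have i3 := integrable_norm gfi.
  apply: (@le_trans _ _ (\int[lam]_x (`|conv (eta m) g x - g x| + `|conv (eta m) (fun x => g x - f x) x| + `|g x - f x|))).
    apply: le_Rintegral => //.
    + exact: (integrable_norm (integrableB measurableT (integrable_conv m fi) fi)).
    + exact: (integrableD measurableT (integrableD measurableT i1 i2) i3).
    move=> x _.
    have -> : conv (eta m) (fun x => g x - f x) x = conv (eta m) g x - conv (eta m) f x.
      have -> : (fun x => g x - f x) = (fun x => -1 * f x + g x) by apply/funext => z; ring.
      by rewrite convL//; ring.
    set u := conv _ f x; set v := conv _ g x.
    have -> : u - f x = (v - g x) - (v - u) + (g x - f x) by ring.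
    by apply: (le_trans (ler_normD _ _)); rewrite lerD2r; exact: ler_normB.
  rewrite RintegralD//; last exact: (integrableD measurableT i1 i2).
  rewrite RintegralD//.
  rewrite (_ : e = e / 3 + e / 3 + e / 3); last by field.
  apply: lerD => //; apply: lerD; first exact: le_trans (ler_norm _) Hm.
  exact: le_trans (norm1_conv m gfi) gf.
- exact: L1_approximable_open.
Qed.

Lemma conv_le_sup m f (c : R) x : integ f -> (forall x, `|f x| <= c) -> `|conv (eta m) f x| <= c.
Proof.
move=> fi fc; have bK := eta_bounded_lipschitz m; have [ie e1] := integral_eta_subl m x.
rewrite -[leRHS]mulr1 -e1 -RintegralZl//; apply: norm_Rintegral_le.
- exact: integrable_kernel.
- exact: (integrableZl measurableT c ie).
- by move=> z; rewrite normrM ger0_norm ?eta_ge0// mulrC ler_wpM2r ?eta_ge0.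
Qed.

Lemma normN_conv m f N : integ f -> integ (fun x => `|f x| ^+ N.+1) ->
  integ (fun x => `|conv (eta m) f x| ^+ N.+1) /\
  \int[lam]_x `|conv (eta m) f x| ^+ N.+1 <= \int[lam]_x `|f x| ^+ N.+1.
Proof.
move=> fi fNi; have bK := eta_bounded_lipschitz m.
have := @conv_Lp_le R n (eta m) f N 1 bK (integral_eta_norm m) ltr01 fi fNi.
rewrite expr1n mul1e => H.
have ci : integ (fun x => `|conv (eta m) f x| ^+ N.+1).
  apply/integrableP; split.
    apply/measurable_EFinP/measurable_funX/measurableT_comp; first exact: normr_measurable.
    exact: measurable_conv.
  rewrite (eq_integral (fun x : Rn R n => (`|conv (eta m) f x| ^+ N.+1)%:E)).
    apply: le_lt_trans H _; move/integrableP : fNi => [_].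
    by under eq_integral do rewrite /= ger0_norm ?exprn_ge0//.
  by move=> x _ /=; rewrite ger0_norm ?exprn_ge0.
split=> //; apply: fine_le => //; exact: integral_fune_fin_num.
Qed.

Lemma integrable_le f g : measurable_fun (setT : set (Rn R n)) f -> integ g ->
  (forall x, `|f x| <= g x) -> integ f.
Proof.
move=> mf gi fg; apply: (@le_integrable _ (Rn R n) R lam setT measurableT _ (EFin \o g)) => //.
- exact/measurable_EFinP.
- by move=> x _ /=; rewrite lee_fin (le_trans (fg x))// ler_norm.
Qed.

Section PowerApproximation.
Variables (f : 'rV[R]_n -> R) (N : nat).
Hypotheses (fi : integ f) (fNi : integ (fun x => `|f x| ^+ N.+1)).

Definition cutoff (k : nat) x := \1_[set y | `|f y| <= k%:R] x * f x.

Let mf : measurable_fun (setT : set (Rn R n)) f.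
Proof. exact: (@measurable_of_integrable _ (Rn R n) R lam). Qed.

Lemma integrable_cutoff k : integ (cutoff k).
Proof.
apply: (@integrableMl_bounded _ (Rn R n) R lam _ f 1) => //.
  apply: (@measurable_indic _ (Rn R n)); rewrite -[X in measurable X]setTI.
  apply: (@measurable_fun_ler _ (Rn R n) R setT (fun y => `|f y|) (cst k%:R)) => //.
  - by apply: measurableT_comp => //; exact: normr_measurable.
  - exact: measurable_cst.
by move=> x; rewrite indicE; case: (_ \in _); rewrite ?normr1 ?normr0.
Qed.

Lemma cutoffE k x : cutoff k x = if `|f x| <= k%:R then f x else 0.
Proof.
rewrite /cutoff indicE; case: ifPn => h; first by rewrite mem_set ?mul1r.
by rewrite memNset ?mul0r//; exact/negP.
Qed.

(** Split [f] into a cutoff and a remainder [g]. The remainder is small in L^(N+1), and so is its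
    mollification, by contraction; for the bounded cutoff the N extra powers of the error are
    bounded, which reduces the claim to L^1. *)
Lemma power_approximation :
  (fun m => \int[lam]_x `|conv (eta m) f x - f x| ^+ N.+1) @ \oo --> (0 : R).
Proof.
pose g k x := f x - cutoff k x.
have gi k : integ (g k) := integrableB measurableT fi (integrable_cutoff k).
have gf k x : `|g k x| <= `|f x|.
  by rewrite /g cutoffE; case: ifP => _; rewrite ?subrr ?normr0 ?subr0.
have mgN k : measurable_fun (setT : set (Rn R n)) (fun x => `|g k x| ^+ N.+1).
  apply: measurable_funX; apply: measurableT_comp; first exact: normr_measurable.
  exact: measurable_of_integrable (gi k).
have gNf k x : `| `|g k x| ^+ N.+1| <= `|f x| ^+ N.+1.
  by rewrite ger0_norm ?exprn_ge0//; apply: lerXn2r; rewrite ?nnegrE.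
have gNi k : integ (fun x => `|g k x| ^+ N.+1) by exact: (integrable_le (mgN k) fNi (gNf k)).
have [|_ D] := @dominated_L1 _ (Rn R n) R lam (fun k x => `|g k x| ^+ N.+1) (fun=> 0) _ mgN fNi gNf.
  move=> x; have [k0 fk] : exists k0 : nat, `|f x| <= k0%:R.
    by exists (Num.trunc `|f x|).+1; exact/ltW/truncnS_gt.
  apply: cvg_near_cst; exists k0 => // k /= kk.
  by rewrite /g cutoffE ifT ?subrr ?normr0 ?expr0n//; rewrite (le_trans fk)// ler_nat.
(* [C] is the constant of [exprD3_le]; the error is a sum of three functions, each allotted
   [e / C / 3]. *)
apply/cvgrPdist_le => e e0; pose C : R := 3%:R ^+ N.+1.
have C0 : 0 < C by rewrite exprn_gt0.
have e1 : 0 < e / C / 3 by rewrite !divr_gt0.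
move: D => /cvgrPdist_le/(_ _ e1)[k _ /(_ k (leqnn k))/=].
rewrite sub0r normrN => /(le_trans (ler_norm _)) Dk.
have {}Dk : \int[lam]_x `|g k x| ^+ N.+1 <= e / C / 3.
  apply: le_trans Dk; rewrite le_eqVlt; apply/orP; left; apply/eqP.
  by apply: eq_Rintegral => x _; rewrite subr0 [RHS]ger0_norm ?exprn_ge0.
have ck0 x : `|cutoff k x| <= k%:R by rewrite cutoffE; case: ifP => // _; rewrite normr0.
(* Both the cutoff and its mollification are bounded by k, so their difference to the power N is at
   most [B]. *)
pose B : R := (k%:R + k%:R) ^+ N.
have B0 : 0 <= B by rewrite exprn_ge0// addr_ge0.
have e2 : 0 < e / C / 3 / (B + 1) by rewrite divr_gt0// ltr_wpDl.
have := L1_approximation (integrable_cutoff k).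
move=> /cvgrPdist_le/(_ _ e2)[m0 _ Hm]; exists m0 => // m /= m0m.
have {}Hm := Hm m m0m; rewrite /= sub0r normrN in Hm.
rewrite sub0r normrN ger0_norm; last by apply: Rintegral_ge0 => x _; rewrite exprn_ge0.
pose h x := conv (eta m) (cutoff k) x - cutoff k x.
have hi : integ h := integrableB measurableT (integrable_conv m (integrable_cutoff k)) (integrable_cutoff k).
have nhi : integ (fun x => `|h x|) := integrable_norm hi.
have hk x : `|h x| ^+ N <= B.
  apply: lerXn2r; rewrite ?nnegrE ?addr_ge0//; apply: (le_trans (ler_normB _ _)).
  by apply: lerD => //; exact: (conv_le_sup _ _ (integrable_cutoff k)).
have hBi : integ (fun x => B * `|h x|) := integrableZl measurableT B nhi.
have hNh x : `|h x| ^+ N.+1 <= B * `|h x| by rewrite exprSr ler_wpM2r.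
have mhN : measurable_fun (setT : set (Rn R n)) (fun x => `|h x| ^+ N.+1).
  apply: measurable_funX; apply: measurableT_comp; first exact: normr_measurable.
  exact: measurable_of_integrable hi.
have hNi : integ (fun x => `|h x| ^+ N.+1).
  by apply: integrable_le mhN hBi _ => x; rewrite ger0_norm ?exprn_ge0.
have hN : \int[lam]_x `|h x| ^+ N.+1 <= e / C / 3.
  apply: (@le_trans _ _ (B * \int[lam]_x `|h x|)).
    by rewrite -RintegralZl//; apply: le_Rintegral.
  apply: (@le_trans _ _ ((B + 1) * \int[lam]_x `|h x|)).
    by rewrite ler_wpM2r ?lerDl// Rintegral_ge0.
  by rewrite mulrC -ler_pdivlMr ?ltr_wpDl// (le_trans (ler_norm _) Hm).
have [cgi cg] := normN_conv m (gi k) (gNi k).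
have E x : conv (eta m) f x - f x = conv (eta m) (g k) x + h x + - g k x.
  have -> : conv (eta m) f x = conv (eta m) (g k) x + conv (eta m) (cutoff k) x.
    have := convL m 1 x (gi k) (integrable_cutoff k); rewrite mul1r => <-.
    by congr (conv _ _ _); apply/funext => z; rewrite /g mul1r subrK.
  by rewrite /h /g; ring.
have Ei : integ (fun x => C * (`|conv (eta m) (g k) x| ^+ N.+1 + `|h x| ^+ N.+1 + `|g k x| ^+ N.+1)).
  exact: (integrableZl measurableT C (integrableD measurableT (integrableD measurableT cgi hNi) (gNi k))).
have Ele x : `|conv (eta m) f x - f x| ^+ N.+1 <=
    C * (`|conv (eta m) (g k) x| ^+ N.+1 + `|h x| ^+ N.+1 + `|g k x| ^+ N.+1).
  apply: le_trans (exprD3_le _ _ _ _) => //.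
  apply: lerXn2r; rewrite ?nnegrE ?addr_ge0// E -[in leRHS](normrN (g k x)).
  by apply: (le_trans (ler_normD _ _)); rewrite lerD2r ler_normD.
have mE : measurable_fun (setT : set (Rn R n)) (fun x => `|conv (eta m) f x - f x| ^+ N.+1).
  apply: measurable_funX; apply: measurableT_comp; first exact: normr_measurable.
  exact: measurable_of_integrable (integrableB measurableT (integrable_conv m fi) fi).
apply: (@le_trans _ _ (\int[lam]_x (C * (`|conv (eta m) (g k) x| ^+ N.+1 + `|h x| ^+ N.+1 + `|g k x| ^+ N.+1)))).
  apply: le_Rintegral => //; apply: integrable_le mE Ei _ => x.
  by rewrite ger0_norm ?exprn_ge0.
rewrite RintegralZl//; last exact: (integrableD measurableT (integrableD measurableT cgi hNi) (gNi k)).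
rewrite RintegralD//; last exact: (integrableD measurableT cgi hNi).
rewrite RintegralD// -ler_pdivlMl// mulrC (_ : e / C = e / C / 3 + e / C / 3 + e / C / 3); last first.
  by field; rewrite gt_eqF.
by apply: lerD => //; apply: lerD => //; exact: le_trans cg Dk.
Qed.

End PowerApproximation.
End Mollifier.

(** * Null Lagrangians *)

Section NullLagrangian.
Context {R : realType} {n : nat}.
Notation lam := (@lebesgueRn R n).
Notation integ f := (lam.-integrable setT (EFin \o f)).
Notation e_ j := (delta_mx ord0 j : 'rV[R]_n).
Implicit Types (f g : 'rV[R]_n -> R) (df dg : 'I_n -> 'rV[R]_n -> R).

Lemma integral_reflect (a : 'rV[R]_n) f : measurable_fun (setT : set (row_space R n)) f ->
  \int[lam]_x f (a - x) = \int[lam]_x f x.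
Proof.
move=> mf; rewrite /Rintegral; congr fine.
have mf' : measurable_fun (setT : set (row_space R n)) (EFin \o f) by exact/measurable_EFinP.
rewrite integralE [RHS]integralE; congr (_ - _)%E.
- have H := @ge0_integral_reflect R n a ((EFin \o f)^\+)%E (measurable_funepos mf').
  transitivity (\int[lam]_x ((EFin \o f)^\+ (a - x)%R))%E.
    by apply: eq_integral => x _; rewrite !funeposE.
  by rewrite H// => x; exact: funepos_ge0.
- have H := @ge0_integral_reflect R n a ((EFin \o f)^\-)%E (measurable_funeneg mf').
  transitivity (\int[lam]_x ((EFin \o f)^\- (a - x)%R))%E.
    by apply: eq_integral => x _; rewrite !funenegE.
  by rewrite H// => x; exact: funeneg_ge0.
Qed.

Lemma integral_translate (a : 'rV[R]_n) f : continuous f ->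
  \int[lam]_x f (x + a) = \int[lam]_x f x.
Proof.
move=> cf; rewrite -(integral_reflect a (continuous_row_measurable cf)).
have cfa : continuous (fun x : 'rV[R]_n => f (x + a)).
  by have := continuous_subr (z := - a) cf; under eq_fun do rewrite opprK.
rewrite -(integral_reflect 0 (continuous_row_measurable cfa)).
by apply: eq_Rintegral => x _; rewrite sub0r addrC.
Qed.

(** The partial derivatives are carried as data, which lets identities be stated for the explicit
    convolution formulas instead of for abstract derivatives. *)
Definition C1b f df := [/\ bounded_lipschitz f, forall j, bounded_lipschitz (df j) &
  forall j x, is_derive x (e_ j) f (df j x)].

Lemma bounded_lipschitzD f g : bounded_lipschitz f -> bounded_lipschitz g ->
  bounded_lipschitz (fun x => f x + g x).
Proof.
move=> [C C0 [fC fL]] [D D0 [gD gL]]; exists (C + D); first exact: addr_ge0.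
split=> [x|x y]; first by rewrite (le_trans (ler_normD _ _))// lerD.
rewrite mulrDl opprD addrACA; apply: (le_trans (ler_normD _ _)).
by apply: lerD.
Qed.

Lemma C1bM f df g dg : C1b f df -> C1b g dg ->
  C1b (fun x => f x * g x) (fun j x => df j x * g x + f x * dg j x).
Proof.
move=> [bf bdf Df] [bg bdg Dg]; split=> [|j|j x]; first exact: bounded_lipschitzM.
  by apply: bounded_lipschitzD; exact: bounded_lipschitzM.
have := is_deriveM (Df j x) (Dg j x); rewrite /GRing.scale/= => H.
by apply: is_derive_eq; rewrite addrC [g x * _]mulrC.
Qed.

Lemma C1b_cst (c : R) : C1b (fun=> c) (fun _ _ => 0).
Proof.
split=> [|j|j x].
- by exists `|c| => //; split=> [x|x y]//; rewrite subrr normr0 mulr_ge0.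
- by exists 0 => //; split=> [x|x y]; rewrite ?subrr normr0// mul0r.
- exact: is_derive_cst.
Qed.

(** Leibniz rule by induction on the list; since [s] has no repetition, the filter [l != m] removes
    exactly the differentiated factor. *)
Lemma C1b_prod (s : seq 'I_n) (a : 'I_n -> 'rV[R]_n -> R) (da : 'I_n -> 'I_n -> 'rV[R]_n -> R) :
  uniq s -> (forall l, C1b (a l) (da l)) ->
  C1b (fun x => \prod_(l <- s) a l x)
    (fun j x => \sum_(m <- s) da m j x * \prod_(l <- s | l != m) a l x).
Proof.
move=> + Ha; elim: s => [_|k s IH /= /andP[ks us]].
  under eq_fun do rewrite big_nil.
  have := C1b_cst 1; congr C1b.
  by apply/funext => j; apply/funext => x; rewrite big_nil.
have := C1bM (Ha k) (IH us).
rewrite (_ : (fun x => a k x * _) = (fun x => \prod_(l <- k :: s) a l x)); last first.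
  by apply/funext => x; rewrite big_cons.
congr C1b; apply/funext => j; apply/funext => x; rewrite big_cons; congr (_ * _ + _).
  rewrite big_cons eqxx/= big_seq [RHS]big_seq_cond.
  apply: eq_bigl => l; case ls : (l \in s) => //=.
  by apply/esym; apply: contraNneq ks => <-.
rewrite mulr_sumr big_seq [RHS]big_seq; apply: eq_bigr => m ms.
rewrite mulrCA; congr (_ * _); rewrite big_cons ifT//.
by apply: contraNneq ks => ->.
Qed.

Definition compact_cube f := exists k, forall x, ~ cube k x -> f x = 0.

Lemma integrable_cube k : integ (\1_(@cube R n k) : 'rV[R]_n -> R).
Proof.
apply: integrable_indicT; first exact: measurable_cube.
by apply: bounded_measurable_lty; [exact: measurable_cube|exists k].
Qed.

Lemma norm_delta_le1 j : `|e_ j| <= 1.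
Proof.
apply/ler_addgt0Pr => e e0; apply/ltW/norm_rVP; first by rewrite addr_gt0.
move=> i; rewrite mxE eqxx/=; case: (i == j); rewrite ?normr1 ?normr0 ?ltrDl//.
by rewrite addr_gt0.
Qed.

Lemma cube_shift k (a x : 'rV[R]_n) : `|a| <= 1 -> ~ cube k.+1 x -> ~ cube k (x + a).
Proof.
move=> a1 nx xa; apply: nx; move: xa; rewrite /cube mx_norm_ball /ball_/= !sub0r !normrN => xa.
have := ler_normB (x + a) a; rewrite addrK => /le_lt_trans; apply.
by rewrite -[k.+2%:R]natr1 ltr_leD.
Qed.

Lemma integrable_compact f : continuous f -> (exists C : R, forall x, `|f x| <= C) ->
  compact_cube f -> integ f.
Proof.
move=> cf [C fC] [k f0].
have iQ : integ (fun x => C * \1_(@cube R n k) x).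
  exact: (integrableZl measurableT C (integrable_cube k)).
apply: (integrable_le _ iQ); first exact: continuous_Rn_measurable.
move=> x; rewrite indicE; case: (boolP (x \in _)) => [_|]; first by rewrite mulr1.
by rewrite notin_setE => /f0 ->; rewrite mulr0 normr0.
Qed.

(** Difference quotients have integral zero by translation invariance, are dominated by a multiple
    of the indicator of the next larger cube, and converge to the partial derivative. *)
Lemma integral_partial_eq0 f df j : C1b f df -> compact_cube f ->
  integ (df j) /\ \int[lam]_x df j x = 0.
Proof.
move=> [bf bdf Df] cf; have [C C0 [dfC _]] := bdf j.
have fc := bounded_lipschitz_continuous bf.
have dfc := bounded_lipschitz_continuous (bdf j).
have [k f0] := cf.
have fi : integ f.
  by apply: integrable_compact => //; have [D _ [fD _]] := bf; exists D.
have iQ : integ (fun x => C * \1_(@cube R n k.+1) x).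
  exact: (integrableZl measurableT C (integrable_cube k.+1)).
pose D m x : R := m.+1%:R * (f (x + m.+1%:R^-1 *: e_ j) - f x).
have h1 m : `|m.+1%:R^-1 *: e_ j| <= 1.
  rewrite normrZ mulr_ile1// ?norm_delta_le1// ger0_norm ?invr_ge0//.
  by rewrite invf_le1// ler1n.
have fti m : integ (fun x => f (x + m.+1%:R^-1 *: e_ j)).
  apply: integrable_compact.
  - by have := continuous_subr (z := - (m.+1%:R^-1 *: e_ j)) fc; under eq_fun do rewrite opprK.
  - by have [E _ [fE _]] := bf; exists E.
  - by exists k.+1 => x nx; apply: f0; exact: cube_shift.
have Di m : integ (D m) := integrableZl measurableT m.+1%:R (integrableB measurableT (fti m) fi).
have [|||dfi H] := @dominated_L1 _ (Rn R n) R lam D (df j) _ _ iQ.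
- by move=> m; exact: measurable_of_integrable (Di m).
- move=> m x; rewrite indicE; case: (boolP (x \in _)) => [_|].
    rewrite mulr1 /D normrM ger0_norm//.
    have := derive_le_lipschitz x m.+1%:R^-1 (Df j) dfC.
    by rewrite [`|_^-1|]ger0_norm ?invr_ge0// ler_pdivlMr// mulrC.
  rewrite notin_setE => nx; rewrite /D !f0 ?subrr ?mulr0 ?normr0//.
    by have := cube_shift (a := 0) _ nx; rewrite addr0; apply; rewrite normr0.
  exact: cube_shift.
- move=> x; have [E E0 [_ dfE]] := bdf j.
  apply/cvgrPdist_le => e e0.
  have e1 : 0 < e / (E + 1) by rewrite divr_gt0// ltr_wpDl.
  have [m0 _ Hm] := near_infty_natSinv_lt (PosNum e1); exists m0 => // m /= m0m.
  have [t th Et] := line_MVT x m.+1%:R^-1 (Df j).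
  rewrite /D Et mulrCA divff// mulr1; apply: (le_trans (dfE _ _)).
  rewrite opprD addrA subrr sub0r normrN normrZ.
  have tm : `|t| * `|e_ j| <= m.+1%:R^-1.
    apply: (le_trans (ler_wpM2l _ (norm_delta_le1 j))) => //.
    by rewrite mulr1 (le_trans th)// ger0_norm ?invr_ge0.
  apply: (@le_trans _ _ ((E + 1) * m.+1%:R^-1)).
    by apply: ler_pM; rewrite ?mulr_ge0 ?lerDl.
  by rewrite mulrC -ler_pdivlMr ?ltr_wpDl// ltW//; exact: (Hm m m0m).
split => //.
have I0 m : \int[lam]_x D m x = 0.
  rewrite RintegralZl//; last exact: (integrableB measurableT (fti m) fi).
  by rewrite RintegralB// integral_translate// subrr mulr0.
apply/eqP; rewrite -normr_le0; apply/ler_addgt0Pl => e e0; rewrite ?add0r ?addr0.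
move: H => /cvgrPdist_le/(_ _ e0)[m _ /(_ m (leqnn m))/=].
rewrite sub0r normrN => /(le_trans (ler_norm _)); apply: le_trans.
have -> : \int[lam]_x df j x = - \int[lam]_x (D m x - df j x).
  by rewrite RintegralB// I0 sub0r opprK.
rewrite normrN; apply: (le_normr_Rintegral measurableT).
exact: (integrableB measurableT (Di m) dfi).
Qed.

Lemma Rintegral_sum0 (I : Type) (s : seq I) (c : I -> R) (F : I -> 'rV[R]_n -> R) :
  (forall i, integ (F i)) -> (forall i, \int[lam]_x F i x = 0) ->
  \int[lam]_x (\sum_(i <- s) c i * F i x) = 0 /\ integ (fun x => \sum_(i <- s) c i * F i x).
Proof.
move=> Fi F0; elim: s => [|i s [IH IHi]].
  under [X in Rintegral _ _ X]eq_fun do rewrite big_nil.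
  under [X in EFin \o X]eq_fun do rewrite big_nil.
  by split; [rewrite Rintegral_cst// mul0r|exact: integrable0].
under [X in Rintegral _ _ X]eq_fun do rewrite big_cons.
under [X in EFin \o X]eq_fun do rewrite big_cons.
have cFi : integ (fun x => c i * F i x) := integrableZl measurableT (c i) (Fi i).
split; last exact: (integrableD measurableT cFi IHi).
by rewrite RintegralD// IH RintegralZl// F0 mulr0 addr0.
Qed.

Section Determinant.
Variables (i0 : 'I_n) (f : 'rV[R]_n -> R) (df : 'I_n -> 'rV[R]_n -> R).
Variables (du : 'I_n -> 'I_n -> 'rV[R]_n -> R) (ddu : 'I_n -> 'I_n -> 'I_n -> 'rV[R]_n -> R).
Hypotheses (fC : C1b f df) (f0 : compact_cube f).
Hypotheses (duC : forall l j, C1b (du l j) (ddu l j)).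
Hypothesis ddu_sym : forall l i j x, ddu l i j x = ddu l j i x.

(** The cofactors of a gradient matrix are divergence free. In the Leibniz expansion each term
    differs from a partial derivative of [f] times the other factors, of integral zero, by [f] times
    second derivatives; summed over permutations the latter cancel. *)
Lemma integral_det_gradient_eq0 :
  \int[lam]_x \det (\matrix_(l, j) (if l == i0 then df j x else du l j x)) = 0.
Proof.
pose s := [seq l <- index_enum 'I_n | l != i0].
have us : uniq s by rewrite filter_uniq// index_enum_uniq.
pose P (t : 'S_n) x := \prod_(l <- s) du l (t l) x.
pose dP (t : 'S_n) j x := \sum_(m <- s) ddu m (t m) j x * \prod_(l <- s | l != m) du l (t l) x.
have PC t : C1b (P t) (dP t) by apply: C1b_prod => // l; exact: duC.
pose F (t : 'S_n) x := df (t i0) x * P t x + f x * dP t (t i0) x.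
have FP t : integ (F t) /\ \int[lam]_x F t x = 0.
  apply: (integral_partial_eq0 (t i0) (C1bM fC (PC t))).
  by have [k fk] := f0; exists k => x /fk ->; rewrite mul0r.
(* For fixed m, composing with the transposition of [i0] and m flips the sign and exchanges [t i0]
   with [t m]; as [ddu] is symmetric, the sum equals its own opposite. *)
have dP0 x : \sum_(t : 'S_n) (-1) ^+ t * dP t (t i0) x = 0.
  under eq_bigr do rewrite mulr_sumr.
  rewrite exchange_big/= big_seq big1// => m; rewrite mem_filter => /andP[mi0 _].
  set S := \sum_t _; suff : S = - S by move=> /eqP; rewrite -addr_eq0 -mulr2n mulrn_eq0 => /eqP.
  rewrite {1}/S (reindex_inj (mulgI (tperm i0 m)))/= /S -sumrN; apply: eq_bigr => t _.
  rewrite odd_permM odd_tperm eq_sym mi0 addTb signrN mulNr; congr (- (_ * (_ * _))).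
    by rewrite !permM tpermL tpermR ddu_sym.
  rewrite big_seq_cond [RHS]big_seq_cond; apply: eq_bigr => l; rewrite mem_filter => /andP[/andP[li0 _] lm].
  by rewrite permM tpermD// eq_sym.
transitivity (\int[lam]_x (\sum_(t <- index_enum 'S_n) (-1) ^+ t * F t x)); last first.
  by have [] := @Rintegral_sum0 _ (index_enum 'S_n) (fun t => (-1) ^+ t) F (fun t => (FP t).1) (fun t => (FP t).2).
apply: eq_Rintegral => x _.
transitivity (\sum_(t : 'S_n) ((-1) ^+ t * (df (t i0) x * P t x) + f x * ((-1) ^+ t * dP t (t i0) x))).
  rewrite big_split/= -mulr_sumr dP0 mulr0 addr0; apply: eq_bigr => t _; congr (_ * _).
  rewrite (bigD1 i0)//= mxE eqxx; congr (_ * _); rewrite /P /s big_filter.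
  by apply: eq_bigr => l li; rewrite mxE (negbTE li).
by apply: eq_bigr => t _; rewrite /F mulrDr [f x * (_ * _)]mulrCA.
Qed.

End Determinant.
End NullLagrangian.

(** * Telescoping determinants and mollifiers *)

Section DeterminantBounds.
Context {R : realType} {N : nat}.
Notation n := N.+1.

Lemma family_max (b : 'I_n -> R) : exists k0, forall k, b k <= b k0.
Proof.
case: (@arg_maxP _ R 'I_n ord0 xpredT b isT) => k0 _ Hk.
by exists k0 => k; exact: Hk.
Qed.

Lemma prod_le_sum_power (b : 'I_n -> R) : (forall k, 0 <= b k) ->
  \prod_k b k <= \sum_k b k ^+ n.
Proof.
move=> b0; have [k0 bk] := family_max b.
apply: (@le_trans _ _ (b k0 ^+ n)).
  by rewrite -[in leRHS](card_ord n) -prodr_const; apply: ler_prod => k _; rewrite b0 bk.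
by rewrite (bigD1 k0)//= lerDl sumr_ge0// => k _; rewrite exprn_ge0.
Qed.

Lemma power_sum_le (b : 'I_n -> R) : (forall k, 0 <= b k) ->
  (\sum_k b k) ^+ n <= n%:R ^+ n * \sum_k b k ^+ n.
Proof.
move=> b0; have [k0 bk] := family_max b.
apply: (@le_trans _ _ ((n%:R * b k0) ^+ n)).
  apply: lerXn2r; rewrite ?nnegrE ?sumr_ge0 ?mulr_ge0//.
  by rewrite mulr_natl -[in leRHS](card_ord n) -sumr_const; apply: ler_sum => k _.
rewrite exprMn ler_wpM2l ?exprn_ge0//.
by rewrite (bigD1 k0)//= lerDl sumr_ge0// => k _; rewrite exprn_ge0.
Qed.

(** In each of the n! Leibniz terms, row i is divided by [t] before the product is bounded by a sum
    of n-th powers, and the factor [t] is put back outside. When row i has size t in L^n, the whole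
    bound has size t in L^1. *)
Lemma det_row_bound (A : 'M[R]_n) (i : 'I_n) (t : R) : 0 < t ->
  `|\det A| <= (n`!)%:R * (t * (\sum_j (`|A i j| / t) ^+ n + \sum_k \sum_j (k != i)%:R * `|A k j| ^+ n)).
Proof.
move=> t0; apply: (le_trans (ler_norm_sum _ _ _)).
rewrite -card_Sn mulr_natl -sumr_const; rewrite [leRHS](_ : _ = \sum_(s : 'S_n) (t *
  (\sum_j (`|A i j| / t) ^+ n + \sum_k \sum_j (k != i)%:R * `|A k j| ^+ n))); last first.
  by apply: eq_bigl => s; rewrite inE.
apply: ler_sum => s _.
rewrite normrM normrX normrN1 expr1n mul1r normr_prod.
pose b k := if k == i then `|A i (s i)| / t else `|A k (s k)|.
have b0 k : 0 <= b k by rewrite /b; case: ifP => _ //; rewrite divr_ge0// ltW.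
have -> : \prod_k `|A k (s k)| = t * \prod_k b k.
  rewrite (bigD1 i)//= [in RHS](bigD1 i)//= {1}/b eqxx mulrA mulrCA divff ?gt_eqF// mulr1.
  by congr (_ * _); apply: eq_bigr => k ki; rewrite /b (negbTE ki).
apply: ler_wpM2l; first exact: ltW.
apply: (le_trans (prod_le_sum_power b0)).
have P0 (j : 'I_n) : 0 <= (`|A i j| / t) ^+ n by rewrite exprn_ge0// divr_ge0// ltW.
have Q0 (k j : 'I_n) : 0 <= (k != i)%:R * `|A k j| ^+ n by rewrite mulr_ge0// exprn_ge0.
rewrite (bigD1 i)//=; apply: lerD.
  rewrite /b eqxx (bigD1 (s i))//= lerDl sumr_ge0//.
rewrite [leRHS](bigD1 i)//= -[leLHS]add0r lerD//; first by rewrite sumr_ge0.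
apply: ler_sum => k ki; rewrite (bigD1 (s k))//= /b (negbTE ki) /= mul1r lerDl.
by rewrite sumr_ge0// => j _; rewrite mulr_ge0// exprn_ge0.
Qed.

Lemma telescope_ord (T : nat -> R) : \sum_(i < n) (T i.+1 - T i) = T n - T 0%N.
Proof. by rewrite -(big_mkord xpredT (fun i => T i.+1 - T i)) telescope_sumr. Qed.

Definition mix (X : Type) (k : nat) (a b : 'I_n -> X) (l : 'I_n) := if (l < k)%N then a l else b l.

Lemma mixS (X : Type) (i l : 'I_n) (a b : 'I_n -> X) : l != i -> mix i.+1 a b l = mix i a b l.
Proof. by move=> li; rewrite /mix ltnS leq_eqVlt val_eqE (negbTE li). Qed.

(* Replace the rows of [B] by those of [A] one at a time. *)
Lemma det_telescope (A B : 'M[R]_n) :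
  \det A - \det B = \sum_i \det (\matrix_(l, j) (if l == i then A i j - B i j
     else mix i (fun l => A l j) (fun l => B l j) l)).
Proof.
pose T (k : nat) := \det (\matrix_(l, j) mix k (fun l => A l j) (fun l => B l j) l).
have -> : \det A = T n.
  by congr determinant; apply/matrixP => l j; rewrite mxE /mix ltn_ord.
have -> : \det B = T 0%N by congr determinant; apply/matrixP => l j; rewrite mxE.
rewrite -telescope_ord; apply: eq_bigr => i _; rewrite /T.
rewrite (@determinant_multilinear _ _ (\matrix_(l, j) mix i.+1 (fun l => A l j) (fun l => B l j) l)
  (\matrix_(l, j) (if l == i then A i j - B i j else mix i (fun l => A l j) (fun l => B l j) l))
  (\matrix_(l, j) mix i (fun l => A l j) (fun l => B l j) l) i 1 1).
- by rewrite !mul1r addrK.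
- by apply/rowP => j; rewrite !mxE /mix eqxx ltnn ltnSn; ring.
- by apply/matrixP => l j; rewrite !mxE mixS eq_sym ?neq_lift// (negbTE (neq_lift _ _)).
- by apply/matrixP => l j; rewrite !mxE mixS// eq_sym neq_lift.
Qed.

End DeterminantBounds.

Section TelescopingKernel.
Context {R : realType} {N : nat}.
Notation n := N.+1.
Notation lam := (@lebesgueRn R n).
Notation integ f := (lam.-integrable setT (EFin \o f)).
Implicit Types (m l : nat).

(** The compactly supported primitive of [moll m - moll l]: for m <= l both steps are 0 or both are
    1 beyond distance 1/(m+1). *)
Definition step_diff m l (t : R) := step (m.+1%:R * t) - step (l.+1%:R * t).

Lemma smooth_step_diff m l : smooth (step_diff m l).
Proof.
have S (c : R) k : smooth_upto k (fun t => step (c * t)).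
  have := @smooth_upto_affine R k step c 0 (smooth_step k).
  by under eq_fun do rewrite addr0.
move=> k; apply: smooth_uptoD => //.
have := smooth_uptoM (smooth_upto_cst k (-1)) (S l.+1%:R k).
by under eq_fun do rewrite mulN1r.
Qed.

Lemma derive1_step_diff m l : (step_diff m l)^`()%classic = (fun t => moll m t - moll l t).
Proof.
apply/funext => t; rewrite derive1E.
have D (c : R) : is_derive t 1 (fun t => step (c * t)) (c * bump (c * t)).
  have := is_derive_affine c 0 t (smooth_derivable smooth_step).
  by rewrite addr0; under eq_fun do rewrite addr0.
by have /@derive_val -> := is_deriveB (D m.+1%:R) (D l.+1%:R).
Qed.

Lemma step_diff_support m l t : (m <= l)%N -> m.+1%:R^-1 < `|t| -> step_diff m l t = 0.
Proof.
move=> ml mt; have mt1 : 1 <= m.+1%:R * `|t| by rewrite mulrC -ler_pdivrMr// mul1r ltW.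
have lt1 : 1 <= l.+1%:R * `|t|.
  by apply: (le_trans mt1); rewrite ler_wpM2r// ler_nat.
rewrite /step_diff; case: (leP 0 t) => t0.
  by move: mt1 lt1; rewrite ger0_norm// => mt1 lt1; rewrite !step_eq1// subrr.
move: mt1 lt1; rewrite ltr0_norm// => mt1 lt1.
by rewrite !step_eq0 ?subrr//; lra.
Qed.

Lemma step_bounds (t : R) : 0 <= step t <= 1.
Proof.
have d0 := step_den_gt0 t; apply/andP; split.
  by apply: divr_ge0; [exact: flat_ge0|exact: ltW].
by rewrite /step ler_pdivrMr// mul1r /step_den lerDl flat_ge0.
Qed.

Lemma step_diff_le1 m l t : `|step_diff m l t| <= 1.
Proof.
have /andP[? ?] := step_bounds (m.+1%:R * t); have /andP[? ?] := step_bounds (l.+1%:R * t).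
by rewrite /step_diff ler_norml; apply/andP; split; lra.
Qed.

(** The i-th component of a vector field with divergence [eta m - eta l]: coordinates before i are
    already at scale m, those after i still at scale l, and differentiating in i produces the i-th
    telescoping difference. *)
Definition psi_family m l (i : 'I_n) (k : 'I_n) : R -> R :=
  if k == i then step_diff m l else mix i (fun=> moll m) (fun=> moll l) k.

Lemma psi_bump_family m l i : (m <= l)%N -> bump_family m.+1%:R^-1 (psi_family m l i).
Proof.
move=> ml k; rewrite /psi_family; case: ifP => _.
  by split; [exact: smooth_step_diff|move=> t; exact: step_diff_support].
rewrite /mix; case: ifP => _; split; try exact: smooth_moll.
  exact: moll_support.
move=> t mt; apply: moll_support; apply: le_lt_trans mt.
by rewrite lef_pV2 ?posrE// ler_nat.
Qed.

Lemma eta_sub_eta m l (x : 'rV[R]_n) :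
  eta m x - eta l x = \sum_i prodfun (dprod i (psi_family m l i)) x.
Proof.
pose T (k : nat) := \prod_j mix k (fun j => moll m (x ord0 j)) (fun j => moll l (x ord0 j)) j.
have -> : eta m x = T n by apply: eq_bigr => j _; rewrite /mix ltn_ord.
have -> : eta l x = T 0%N by apply: eq_bigr => j _; rewrite /mix.
rewrite -telescope_ord; apply: eq_bigr => i _; rewrite /T /prodfun.
rewrite (bigD1 i)//= [X in _ - X](bigD1 i)//= [RHS](bigD1 i)//=.
rewrite {1}/dprod eqxx {1}/psi_family eqxx derive1_step_diff {1 3}/mix ltnn ltnSn mulrBl.
have E j : j != i -> dprod i (psi_family m l i) j (x ord0 j) =
    mix i (fun j => moll m (x ord0 j)) (fun j => moll l (x ord0 j)) j.
  by move=> ji; rewrite /dprod /psi_family (negbTE ji) /mix; case: ifP.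
by congr (_ * _ - _ * _); apply: eq_bigr => j ji; rewrite E// mixS.
Qed.

(** The factors other than the i-th have mass 1; the i-th is bounded by 1 on an interval of length
    2/(m+1) and vanishes outside. *)
Lemma integral_psi m l i : (m <= l)%N ->
  (\int[lam]_x `|prodfun (psi_family m l i) x|%:E <= (2 / m.+1%:R)%:E)%E.
Proof.
move=> ml.
under eq_integral do rewrite /prodfun normr_prod.
have cf k : continuous (psi_family m l i k) by exact/smooth_continuous/(psi_bump_family i ml k).1.
rewrite (@ge0_integral_prodfun R n (fun k t => `|psi_family m l i k t|)); last 2 first.
- move=> k; apply: measurableT_comp; first exact: normr_measurable.
  exact: continuous_measurable_fun.
- by [].
rewrite (bigD1 i)//= [X in (_ * X)%E]big1 ?mule1; last first.
  move=> k ki; rewrite /psi_family (negbTE ki) /mix.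
  have I1 p : (\int[lebesgue_measure]_t (`|moll p t|)%:E = 1)%E.
    under eq_integral do rewrite ger0_norm ?moll_ge0//.
    by apply: integral_bump; rewrite ler1n.
  by case: ifP => _; exact: I1.
rewrite /psi_family eqxx; set r := m.+1%:R^-1.
apply: (@le_trans _ _ (\int[lebesgue_measure]_(t in `[(- r)%R, r]) 1)%E).
  rewrite [leRHS]integral_mkcond; apply: ge0_le_integral => //.
  - apply/measurable_EFinP; apply: measurableT_comp; first exact: normr_measurable.
    by apply: continuous_measurable_fun; exact/smooth_continuous/smooth_step_diff.
  - by apply/(measurable_restrictT _ _).1 => //; exact: measurable_cst.
  move=> t _; rewrite patchE; case: ifPn => [_|]; first by rewrite lee_fin step_diff_le1.
  rewrite notin_setE/= in_itv/= -ler_norml => /negP; rewrite -ltNge => rt.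
  by rewrite step_diff_support// normr0.
rewrite integral_cst// mul1e [X in (X <= _)%E]lebesgue_measure_itv/= lte_fin.
have r0 : 0 < r by rewrite invr_gt0.
rewrite ifT; last by lra.
by rewrite lee_fin; rewrite -/r; lra.
Qed.

End TelescopingKernel.

(** * Mollification of weak gradients *)

Section IntegralBounds.
Context {R : realType} {n : nat}.
Notation lam := (@lebesgueRn R n).
Notation integ f := (lam.-integrable setT (EFin \o f)).
Implicit Types (f g : 'rV[R]_n -> R).

(** Integrability is bundled in because the real-valued integral is total: it takes a default value
    where the extended one is infinite, and a bound on that would say nothing. *)
Definition integral_le f (C : R) := integ f /\ \int[lam]_x f x <= C.

Lemma integral_leD f g a b : integral_le f a -> integral_le g b ->
  integral_le (fun x => f x + g x) (a + b).
Proof.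
move=> [fi fa] [gi gb]; split; first exact: (integrableD measurableT fi gi).
by rewrite RintegralD// lerD.
Qed.

Lemma integral_leZ c f a : 0 <= c -> integral_le f a -> integral_le (fun x => c * f x) (c * a).
Proof.
move=> c0 [fi fa]; split; first exact: (integrableZl measurableT c fi).
by rewrite RintegralZl// ler_wpM2l.
Qed.

Lemma Rintegral_sum (I : finType) (f : I -> 'rV[R]_n -> R) : (forall i, integ (f i)) ->
  integ (fun x => \sum_i f i x) /\ \int[lam]_x (\sum_i f i x) = \sum_i \int[lam]_x f i x.
Proof.
move=> fi; suff P (s : seq I) : integ (fun x => \sum_(i <- s) f i x) /\
    \int[lam]_x (\sum_(i <- s) f i x) = \sum_(i <- s) \int[lam]_x f i x by exact: P.
elim: s => [|i s [IHi IH]].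
  rewrite big_nil; under eq_fun do rewrite big_nil.
  split; first exact: integrable0.
  by rewrite Rintegral_cst// mul0r.
rewrite big_cons -IH -RintegralD//; split.
  by under [X in EFin \o X]eq_fun do rewrite big_cons; exact: (integrableD measurableT (fi i) IHi).
by apply: eq_Rintegral => x _; rewrite big_cons.
Qed.

Lemma integral_le_sum (I : finType) (f : I -> 'rV[R]_n -> R) a :
  (forall i, integral_le (f i) (a i)) ->
  integral_le (fun x => \sum_i f i x) (\sum_i a i).
Proof.
move=> H; have [fi fE] := Rintegral_sum (fun i => (H i).1).
by split => //; rewrite fE; apply: ler_sum => i _; exact: (H i).2.
Qed.

Lemma integral_le_dominated f g a : measurable_fun (setT : set (Rn R n)) g ->
  (forall x, `|g x| <= f x) -> integral_le f a -> integ g /\ `|\int[lam]_x g x| <= a.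
Proof.
move=> mg gf [fi fa]; have gi := integrable_le mg fi gf.
by split => //; apply: le_trans fa; apply: norm_Rintegral_le.
Qed.

End IntegralBounds.

Section BoundedLipschitzDeterminant.
Context {R : realType} {q n : nat}.
Notation V := 'rV[R]_q.

Lemma bounded_lipschitz_cst (c : R) : bounded_lipschitz (fun _ : V => c).
Proof.
by exists `|c| => //; split=> [x|x y]; rewrite ?subrr ?normr0 ?mulr_ge0.
Qed.

Lemma bounded_lipschitz_det (A : 'I_n -> 'I_n -> V -> R) :
  (forall i j, bounded_lipschitz (A i j)) ->
  bounded_lipschitz (fun x => \det (\matrix_(i, j) A i j x)).
Proof.
move=> HA.
suff P (t : 'S_n) (s : seq 'I_n) : bounded_lipschitz (fun x => \prod_(i <- s) A i (t i) x).
  suff S (s : seq 'S_n) : bounded_lipschitz (fun x => \sum_(t <- s) (-1) ^+ t * \prod_i A i (t i) x).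
    have := S (index_enum 'S_n); rewrite /determinant.
    by under eq_fun do under eq_bigr do under eq_bigr do rewrite -[A _ _ _](mxE matrix_key (fun i j => A i j _)).
  elim: s => [|t s IH]; first by under eq_fun do rewrite big_nil; exact: bounded_lipschitz_cst.
  under eq_fun do rewrite big_cons.
  by apply: bounded_lipschitzD => //; apply: bounded_lipschitzM => //; exact: bounded_lipschitz_cst.
elim: s => [|i s IH]; first by under eq_fun do rewrite big_nil; exact: bounded_lipschitz_cst.
by under eq_fun do rewrite big_cons; exact: bounded_lipschitzM.
Qed.

End BoundedLipschitzDeterminant.

Section Sobolev.
Context {R : realType} {n : nat}.
Notation lam := (@lebesgueRn R n).
Notation integ f := (lam.-integrable setT (EFin \o f)).
Implicit Types (m l : nat) (F : 'I_n -> R -> R) (Om : set 'rV[R]_n).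

(* [u] and its weak gradient [G] on [Om], both extended by zero. *)
Definition sobolev Om (u : 'I_n -> 'rV[R]_n -> R) (G : 'I_n -> 'I_n -> 'rV[R]_n -> R) :=
  [/\ forall i, integ (u i), forall i j, integ (G i j),
      forall i j, integ (fun x => `|G i j x| ^+ n) &
      forall i j phi, test_function Om phi ->
        \int[lam]_x (u i x * partial j phi x) = - \int[lam]_x (G i j x * phi x)].

(** The points x at which a kernel supported in the cube of half-side [r], reflected and moved to x,
    still has its support in [Om] and may be tested against a weak gradient. *)
Definition inner Om (r : R) : set 'rV[R]_n :=
  [set x : 'rV[R]_n | forall z : 'rV[R]_n, (forall i, `|x ord0 i - z ord0 i| <= r) -> Om z].

Lemma sub_inner Om r s : s <= r -> inner Om r `<=` inner Om s.
Proof. by move=> sr x xr z xz; apply: xr => i; exact: le_trans (xz i) sr. Qed.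

Definition reflected F (x : 'rV[R]_n) i (t : R) := F i (x ord0 i - t).

Lemma reflected_family r F x : bump_family r F -> bump_family (r + `|x|) (reflected F x).
Proof.
move=> bF i; split=> [k|t rt].
  have := @smooth_upto_affine R k (F i) (-1) (x ord0 i) ((bF i).1 k).
  by under eq_fun do rewrite mulN1r addrC.
apply: (bF i).2; have xi := ler_norm_rV x i.
have := ler_normD (x ord0 i - t) (- x ord0 i); rewrite normrN addrAC subrr sub0r normrN.
by move: rt xi; lra.
Qed.

Lemma dprod_reflected r F x j (z : 'rV[R]_n) : bump_family r F ->
  prodfun (dprod j (reflected F x)) z = - prodfun (dprod j F) (x - z).
Proof.
move=> bF; rewrite /prodfun (bigD1 j)//= [in RHS](bigD1 j)//= -mulNr; congr (_ * _).
  rewrite /dprod eqxx derive1E !mxE.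
  have := is_derive_affine (-1) (x ord0 j) (z ord0 j) (smooth_derivable (bF j).1).
  rewrite /reflected; under eq_fun do rewrite mulN1r addrC.
  by move=> /@derive_val ->; rewrite !mulN1r addrC.
by apply: eq_bigr => i ij; rewrite /dprod (negbTE ij) /reflected !mxE.
Qed.

Lemma test_reflected Om r F x : bump_family r F -> inner Om r x ->
  test_function Om (fun z => prodfun F (x - z)).
Proof.
move=> bF xr; have E : (fun z => prodfun F (x - z)) = prodfun (reflected F x).
  by apply/funext => z; apply: eq_bigr => i _; rewrite /reflected !mxE.
split; first by move=> k; rewrite E; apply: Ck_prodfun (reflected_family x bF).
exists [set z : 'rV[R]_n | forall i, `[x ord0 i - r, x ord0 i + r]%classic (z ord0 i)]; split.
- apply: (@rV_compact R n (fun i => `[x ord0 i - r, x ord0 i + r]%classic)) => i.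
  exact: segment_compact.
- move=> z /= Hz; apply: xr => i; have := Hz i.
  by rewrite in_itv/= ler_norml => /andP[? ?]; apply/andP; split; lra.
move=> z /existsNP[i zi]; apply: (@prodfun_support _ _ r _ _ i bF).
rewrite !mxE ltNge; apply/negP => H; apply: zi; move: H.
by rewrite /= in_itv/= ler_norml => /andP[? ?]; apply/andP; split; lra.
Qed.

(** The weak gradient is tested against z |-> F(x - z); the minus sign of the reflection cancels the
    one of integration by parts. *)
Lemma conv_partial Om u G r F x i j : sobolev Om u G -> bump_family r F -> inner Om r x ->
  conv (prodfun (dprod j F)) (u i) x = conv (prodfun F) (G i j) x.
Proof.
move=> [ui _ _ /(_ i j _ (test_reflected _ _)) H] bF xr; have {H} := H _ _ _ bF xr.
have -> : partial j (fun z => prodfun F (x - z)) = fun z => - prodfun (dprod j F) (x - z).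
  have -> : (fun z => prodfun F (x - z)) = prodfun (reflected F x).
    by apply/funext => z; apply: eq_bigr => k _; rewrite /reflected !mxE.
  rewrite (partial_prodfun j (reflected_family x bF)); apply/funext => z.
  exact: dprod_reflected bF.
under [X in Rintegral _ _ X]eq_fun do rewrite mulrN mulrC -mulN1r.
rewrite RintegralZl// ?mulN1r//; last first.
  apply: integrable_kernel => //; exact: prodfun_bounded_lipschitz (bump_family_dprod j bF).
move=> /oppr_inj; rewrite /conv => ->; apply: eq_Rintegral => z _; exact: mulrC.
Qed.

End Sobolev.

Lemma det_row_addZ (R : comPzRingType) n (i : 'I_n) (a b c : 'I_n -> R) (s : R) (Z : 'I_n -> 'I_n -> R) :
  (forall j, a j = b j + s * c j) ->
  \det (\matrix_(k, j) (if k == i then a j else Z k j)) =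
  \det (\matrix_(k, j) (if k == i then b j else Z k j)) +
  s * \det (\matrix_(k, j) (if k == i then c j else Z k j)).
Proof.
move=> abc; rewrite -[X in X + _]mul1r; apply: (@determinant_multilinear _ _ _ _ _ i).
- by apply/rowP => j; rewrite !mxE eqxx mul1r.
- by apply/matrixP => k j; rewrite !mxE eq_sym (negbTE (neq_lift _ _)).
- by apply/matrixP => k j; rewrite !mxE eq_sym (negbTE (neq_lift _ _)).
Qed.

Section SmoothConvolution.
Context {R : realType} {n : nat}.
Notation lam := (@lebesgueRn R n).
Notation integ f := (lam.-integrable setT (EFin \o f)).

Lemma C1b_conv (m : nat) (f : 'rV[R]_n -> R) : integ f ->
  C1b (conv (eta m) f) (fun j => conv (prodfun (dprod j (fun _ : 'I_n => @moll R m))) f).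
Proof.
move=> fi; split=> [|j|j x]; first exact: conv_lipschitz (eta_bounded_lipschitz m) fi.
  exact: conv_lipschitz (prodfun_bounded_lipschitz (bump_family_dprod j (moll_family m))) fi.
exact: (@is_derive_conv R n _ j (fun=> moll m) f x (moll_family m) fi).
Qed.

End SmoothConvolution.

Section MollifiedDeterminants.
Context {R : realType} {N : nat}.
Notation n := N.+1.
Notation lam := (@lebesgueRn R n).
Notation integ f := (lam.-integrable setT (EFin \o f)).
Implicit Types (m l : nat) (x : 'rV[R]_n).
Variables (Om : set 'rV[R]_n) (u : 'I_n -> 'rV[R]_n -> R) (G : 'I_n -> 'I_n -> 'rV[R]_n -> R).
Hypothesis SG : sobolev Om u G.

Let mollD m (j : 'I_n) := dprod j (fun _ : 'I_n => @moll R m).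
Let U m i := conv (eta m) (u i).
Let dU m i j := conv (prodfun (mollD m j)) (u i).
Let ddU m i j k := conv (prodfun (dprod k (mollD m j))) (u i).
Let CG m i j := conv (eta m) (G i j).

Let ui i : integ (u i). Proof. by case: SG. Qed.
Let Gi i j : integ (G i j). Proof. by case: SG. Qed.
Let GNi i j : integ (fun x => `|G i j x| ^+ n). Proof. by case: SG. Qed.

Let mollD_family m j : bump_family m.+1%:R^-1 (mollD m j).
Proof. exact/bump_family_dprod/moll_family. Qed.

Lemma bounded_lipschitzB f g : bounded_lipschitz f -> bounded_lipschitz g ->
  bounded_lipschitz (fun x : 'rV[R]_n => f x - g x).
Proof.
move=> bf bg; under eq_fun do rewrite -mulN1r.
by apply: bounded_lipschitzD => //; apply: bounded_lipschitzM => //; exact: bounded_lipschitz_cst.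
Qed.

Lemma C1bB f g (df dg : 'I_n -> 'rV[R]_n -> R) : C1b f df -> C1b g dg ->
  C1b (fun x => f x - g x) (fun j x => df j x - dg j x).
Proof.
move=> [bf bdf Df] [bg bdg Dg]; split=> [|j|j x]; try exact: bounded_lipschitzB.
exact: is_deriveB.
Qed.

Lemma C1b_U m i : C1b (U m i) (dU m i).
Proof. exact: (@C1b_conv R n m (u i) (ui i)). Qed.

Lemma C1b_dU m i j : C1b (dU m i j) (ddU m i j).
Proof.
split=> [|k|k x]; first exact: conv_lipschitz (prodfun_bounded_lipschitz (mollD_family m j)) (ui i).
  exact: conv_lipschitz (prodfun_bounded_lipschitz (bump_family_dprod k (mollD_family m j))) (ui i).
exact: (@is_derive_conv R n _ k (mollD m j) (u i) x (mollD_family m j) (ui i)).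
Qed.

(** [dU] is the classical gradient of the mollified function on the whole space, as the null
    Lagrangian identity requires, while the bounds concern [CG]. Near the boundary the two may
    differ, since extension by zero can create a jump. *)
Lemma dU_conv m i j x : inner Om m.+1%:R^-1 x -> dU m i j x = CG m i j x.
Proof. exact: (conv_partial i j SG (moll_family m)). Qed.

Lemma conv_sum (I : finType) (K : I -> 'rV[R]_n -> R) f x :
  (forall i, bounded_lipschitz (K i)) -> integ f ->
  conv (fun y => \sum_i K i y) f x = \sum_i conv (K i) f x.
Proof.
move=> bK fi; rewrite /conv.
have [_ <-] := Rintegral_sum (fun i => integrable_kernel x (bK i) fi).
by apply: eq_Rintegral => z _; rewrite mulr_suml.
Qed.

(** The quantitative substitute for compactness: the divergence in [eta_sub_eta] is moved onto the
    weak gradient, which leaves kernels of L^1 norm at most 2/(m+1). *)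
Lemma U_sub m l i x : (m <= l)%N -> inner Om m.+1%:R^-1 x ->
  U m i x - U l i x = \sum_j conv (prodfun (psi_family m l j)) (G i j) x.
Proof.
move=> ml xm; have bP (j : 'I_n) := psi_bump_family (R := R) j ml.
under eq_bigr do rewrite -(conv_partial _ _ SG (bP _) xm).
rewrite -conv_sum//; last first.
  by move=> j; exact: prodfun_bounded_lipschitz (bump_family_dprod j (bP j)).
rewrite /U /conv -RintegralB//; first last.
- exact: integrable_kernel (eta_bounded_lipschitz l) (ui i).
- exact: integrable_kernel (eta_bounded_lipschitz m) (ui i).
by apply: eq_Rintegral => z _; rewrite -mulrBl eta_sub_eta.
Qed.

Variables (M : R) (f : 'rV[R]_n -> R) (df : 'I_n -> 'rV[R]_n -> R) (B : R).
Hypotheses (GM : forall i j, \int[lam]_x `|G i j x| ^+ n <= M).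
Hypotheses (fC : C1b f df)
  (f0 : exists k, forall x, ~ cube k x -> f x = 0 /\ forall j, df j x = 0)
  (dfB : forall j x, `|df j x| <= B).

Lemma integral_psi_conv m l i j : (m <= l)%N ->
  integral_le (fun x => `|conv (prodfun (psi_family m l j)) (G i j) x| ^+ n)
    ((2 / m.+1%:R) ^+ n * M).
Proof.
move=> ml; have bP := prodfun_bounded_lipschitz (psi_bump_family (R := R) j ml).
have c0 : 0 < 2 / m.+1%:R :> R by rewrite divr_gt0.
have H := conv_Lp_le bP (integral_psi j ml) c0 (Gi i j) (GNi i j).
have mC : measurable_fun (setT : set (Rn R n)) (conv (prodfun (psi_family m l j)) (G i j)).
  exact: measurable_conv.
have mCN : measurable_fun (setT : set (Rn R n)) (fun x => `|conv (prodfun (psi_family m l j)) (G i j) x| ^+ n).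
  by apply: measurable_funX; apply: measurableT_comp => //; exact: normr_measurable.
have GE : (\int[lam]_x (`|G i j x| ^+ n)%:E)%E = (\int[lam]_x `|G i j x| ^+ n)%:E.
  by rewrite fineK//; exact: (integrable_fin_num measurableT (GNi i j)).
have H2 : (\int[lam]_x (`|conv (prodfun (psi_family m l j)) (G i j) x| ^+ n)%:E <=
    ((2 / m.+1%:R) ^+ n * M)%:E)%E.
  apply: (le_trans H); rewrite GE -EFinM lee_fin; apply: ler_wpM2l; last exact: GM.
  exact: exprn_ge0 (ltW c0).
have I : integ (fun x => `|conv (prodfun (psi_family m l j)) (G i j) x| ^+ n).
  apply/integrableP; split; first exact/measurable_EFinP.
  under eq_integral do rewrite /= ger0_norm ?exprn_ge0//.
  by apply: (le_lt_trans H2); rewrite ltry.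
by split => //; rewrite -lee_fin fineK//; exact: (integrable_fin_num measurableT I).
Qed.

Lemma integral_eta_conv m i j : integral_le (fun x => `|CG m i j x| ^+ n) M.
Proof.
by have [? H] := normN_conv m (Gi i j) (GNi i j); split => //; exact: le_trans H _.
Qed.

(** From the outside: n telescoped rows and n! Leibniz terms. For the small row, n entries with n
    kernels each, 2^n from [integral_psi], B^n from [df] and n^n from [power_sum_le]; for the other
    rows, n^2 entries at two scales. *)
Definition gradient_constant : R := n%:R * ((n`!)%:R * (n%:R * (n%:R * ((2 * B) ^+ n * n%:R ^+ n)) + n%:R * (n%:R * 2))).

Section Telescope.
Variables (m l : nat) (ml : (m <= l)%N).
Hypotheses (fm : forall x, ~ inner Om m.+1%:R^-1 x -> f x = 0 /\ forall j, df j x = 0).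

Let mixed i k j x := mix i (fun k => dU m k j x) (fun k => dU l k j x) k.
Let w i x := U m i x - U l i x.

Let E i x := \det (\matrix_(k, j) (if k == i then df j x * w i x else mixed i k j x)).

(** [det_row_bound] with t = 1/(m+1), the order of the row containing [w] according to [U_sub]. Away
    from the inner set that row vanishes together with [df]. *)
Let E_le i x : `|E i x| <= (n`!)%:R * (m.+1%:R^-1 * (\sum_(j < n) (B * m.+1%:R) ^+ n *
     (n%:R ^+ n * \sum_q `|conv (prodfun (psi_family m l q)) (G i q) x| ^+ n) +
   \sum_k \sum_j (`|CG m k j x| ^+ n + `|CG l k j x| ^+ n))).
Proof.
have t0 : 0 < m.+1%:R^-1 :> R by rewrite invr_gt0.
have [xm|xm] := pselect (inner Om m.+1%:R^-1 x); last first.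
  have -> : E i x = 0.
    rewrite /E (expand_det_row _ i) big1// => j _; rewrite mxE eqxx.
    by rewrite ((fm xm).2 j) !mul0r.
  rewrite normr0; apply: mulr_ge0 => //; apply: mulr_ge0; first exact: ltW.
  apply: addr_ge0.
    apply: sumr_ge0 => j _; rewrite mulr_ge0 ?exprn_ge0//.
      by rewrite mulr_ge0// (le_trans _ (dfB j x)).
    by rewrite mulr_ge0 ?exprn_ge0// sumr_ge0// => q _; rewrite exprn_ge0.
  by apply: sumr_ge0 => k _; apply: sumr_ge0 => j _; rewrite addr_ge0 ?exprn_ge0.
apply: (le_trans (det_row_bound _ i t0)); apply: ler_wpM2l => //.
apply: ler_wpM2l; first exact: ltW.
apply: lerD.
  apply: ler_sum => j _; rewrite mxE eqxx invrK normrM.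
  have P0 : 0 <= \sum_q `|conv (prodfun (psi_family m l q)) (G i q) x| by exact: sumr_ge0.
  apply: (@le_trans _ _ ((B * m.+1%:R * \sum_q `|conv (prodfun (psi_family m l q)) (G i q) x|) ^+ n)).
    rewrite lerXn2r ?nnegrE ?mulr_ge0//; first exact: le_trans (dfB j x).
    rewrite [leRHS]mulrAC; apply: ler_wpM2r => //; apply: ler_pM => //.
    by rewrite /w U_sub//; exact: ler_norm_sum.
  rewrite exprMn; apply: ler_wpM2l.
    by rewrite exprn_ge0 ?mulr_ge0//; exact: le_trans (dfB j x).
  exact: power_sum_le.
apply: ler_sum => k _; apply: ler_sum => j _; rewrite mxE.
have [->|ki] := eqVneq k i; first by rewrite mul0r addr_ge0 ?exprn_ge0.
have xl : inner Om l.+1%:R^-1 x.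
  by apply: sub_inner xm; rewrite lef_pV2 ?posrE// ler_nat.
rewrite mul1r /mixed /mix; case: (k < i)%N; rewrite dU_conv//.
  by rewrite lerDl exprn_ge0.
by rewrite lerDr exprn_ge0.
Qed.

Let bl_mixed i k j : bounded_lipschitz (mixed i k j).
Proof. by rewrite /mixed /mix; case: (k < i)%N; [have [] := C1b_dU m k j|have [] := C1b_dU l k j]. Qed.

Let wC i : C1b (w i) (fun j x => dU m i j x - dU l i j x).
Proof. exact: C1bB (C1b_U m i) (C1b_U l i). Qed.

Let E_integral i : integ (E i) /\ `|\int[lam]_x E i x| <= n%:R^-1 * (gradient_constant * M * m.+1%:R^-1).
Proof.
have bE : bounded_lipschitz (E i).
  apply: (@bounded_lipschitz_det R n n (fun k j x => if k == i then df j x * w i x else mixed i k j x)).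
  move=> k j; case: (k == i) => //; apply: bounded_lipschitzM; first by case: fC.
  by have [] := wC i.
have mE : measurable_fun (setT : set (Rn R n)) (E i).
  exact: continuous_Rn_measurable (bounded_lipschitz_continuous bE).
have B0 : 0 <= B by exact: le_trans (dfB i 0).
apply: (integral_le_dominated mE (E_le i)).
(* The factor 1/n disappears once the n rows are summed. The power (m+1)^n from dividing the small
   row by t cancels (1/(m+1))^n from the kernels, so a single 1/(m+1) survives. *)
have -> : n%:R^-1 * (gradient_constant * M * m.+1%:R^-1) =
  (n`!)%:R * (m.+1%:R^-1 * (\sum_(j < n) (B * m.+1%:R) ^+ n *
     (n%:R ^+ n * \sum_(q < n) ((2 / m.+1%:R) ^+ n * M)) +
   \sum_(k < n) \sum_(j < n) (M + M))).
  rewrite /gradient_constant !sumr_const !card_ord.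
  have n0 : n%:R^-1 * n%:R = 1 :> R by rewrite mulVf ?pnatr_eq0.
  have a0 : m.+1%:R ^+ n * m.+1%:R^-1 ^+ n = 1 :> R.
    by rewrite -exprMn divff ?expr1n ?pnatr_eq0.
  have mn (y : R) : y *+ n = n%:R * y by rewrite mulr_natl.
  move: n0 a0 mn; set d : R := n%:R; set t := m.+1%:R^-1; set a := m.+1%:R; set c : R := d^-1.
  move: (d) (c) (n`!%:R) => {}d {}c F n0 a0 mn.
  rewrite !mn !exprMn; move: a0; set an := a ^+ n; set tn := t ^+ n => a0.
  transitivity ((c * d) * (F * (d * (d * (2 ^+ n * B ^+ n * d ^+ n)) + d * (d * 2)) * M * t)); first by ring.
  transitivity (F * (t * (d * (B ^+ n * (an * tn) * (d ^+ n * (d * (2 ^+ n * M)))) + d * (d * (M + M))))).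
    by rewrite n0 a0; ring.
  by ring.
apply: integral_leZ => //; apply: integral_leZ => //.
apply: integral_leD.
  apply: integral_le_sum => j; apply: integral_leZ; first by rewrite exprn_ge0 ?mulr_ge0.
  by apply: integral_leZ; [rewrite exprn_ge0|apply: integral_le_sum => q; exact: integral_psi_conv].
by apply: integral_le_sum => k; apply: integral_le_sum => j; apply: integral_leD; exact: integral_eta_conv.
Qed.

(** Row i of [D i] is the gradient of [f * w i] and its other rows are gradients, so its integral
    vanishes. Subtracting [E i], the part where the derivative falls on [f], leaves the i-th
    telescoping term times [f]. *)
Lemma telescope_estimate :
  `|\int[lam]_x (f x * (\det (\matrix_(i, j) CG m i j x) - \det (\matrix_(i, j) CG l i j x)))| <=
  gradient_constant * M * m.+1%:R^-1.
Proof.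
pose D i x := \det (\matrix_(k, j)
  (if k == i then df j x * w i x + f x * (dU m i j x - dU l i j x) else mixed i k j x)).
have fwC i := C1bM fC (wC i).
have fw0 i : compact_cube (fun x => f x * w i x).
  by have [k fk] := f0; exists k => x /fk[-> _]; rewrite mul0r.
have D0 i : \int[lam]_x D i x = 0.
  apply: (@integral_det_gradient_eq0 R n i _ _ (fun k j x => mixed i k j x)
    (fun k j q x => mix i (fun k => ddU m k j q x) (fun k => ddU l k j q x) k) (fwC i) (fw0 i)).
    move=> k j; rewrite /mixed /mix; case: (k < i)%N; exact: C1b_dU.
  move=> k j q x; rewrite /mix; congr (if _ then _ else _); rewrite /ddU /mollD dprodC//.
have Di i : integ (D i).
  have bD : bounded_lipschitz (D i).
    apply: (@bounded_lipschitz_det R n n (fun k j x => if k == i then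
      df j x * w i x + f x * (dU m i j x - dU l i j x) else mixed i k j x)).
    by move=> k j; case: (k == i) => //; have [_] := fwC i.
  apply: integrable_compact; first exact: bounded_lipschitz_continuous bD.
    by case: bD => C _ [CD _]; exists C.
  have [q fq] := f0; exists q => x /fq[fx dfx].
  rewrite /D (expand_det_row _ i) big1// => j _; rewrite mxE eqxx fx dfx.
  by rewrite !mul0r addr0 mul0r.
have H x : f x * (\det (\matrix_(i, j) CG m i j x) - \det (\matrix_(i, j) CG l i j x)) =
    \sum_i (D i x - E i x).
  rewrite det_telescope mulr_sumr; apply: eq_bigr => i _.
  (* Off the inner set [dU] and [CG] may differ, but there [f] and [df] vanish: the left side is 0
     and the matrices of [D i] and [E i] coincide. *)
  have [xm|xm] := pselect (inner Om m.+1%:R^-1 x); last first.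
    have [fx dfx] := fm xm; rewrite fx mul0r -[LHS](subrr (D i x)); congr (_ - _).
    by congr determinant; apply/matrixP => k j; rewrite !mxE fx dfx !mul0r addr0.
  have xl : inner Om l.+1%:R^-1 x by apply: sub_inner xm; rewrite lef_pV2 ?posrE// ler_nat.
  have dUm k j : dU m k j x = CG m k j x := dU_conv k j xm.
  have dUl k j : dU l k j x = CG l k j x := dU_conv k j xl.
  rewrite {1}/D (@det_row_addZ _ _ i _ (fun j => df j x * w i x)
    (fun j => dU m i j x - dU l i j x) (f x) (fun k j => mixed i k j x) (fun=> erefl)).
  rewrite [RHS]addrAC subrr add0r.
  congr (_ * \det _); apply/matrixP => k j; rewrite [LHS]mxE [RHS]mxE dUm dUl.
  case: (k == i); first by apply: f_equal2; [|apply: f_equal]; exact: mxE.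
  by rewrite /mixed /mix dUm dUl; case: (k < i)%N; exact: mxE.
under eq_Rintegral do rewrite H.
have [_ ->] := Rintegral_sum (fun i => integrableB measurableT (Di i) (E_integral i).1).
apply: (le_trans (ler_norm_sum _ _ _)).
apply: (@le_trans _ _ (\sum_(i < n) n%:R^-1 * (gradient_constant * M * m.+1%:R^-1))).
  apply: ler_sum => i _; rewrite RintegralB//; last exact: (E_integral i).1.
  by rewrite D0 sub0r normrN; exact: (E_integral i).2.
by rewrite sumr_const card_ord -[(_ * _) *+ n]mulr_natl mulrA divff ?mul1r// pnatr_eq0.
Qed.

End Telescope.
End MollifiedDeterminants.

(** * Weak continuity of the determinant *)

Lemma dist3 (R : realDomainType) (a b c d e : R) :
  `|a - b| <= e -> `|c - d| <= e -> `|c - a| <= e -> `|d - b| <= e *+ 3.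
Proof.
by rewrite !ler_norml mulrSr mulr2n => /andP[? ?] /andP[? ?] /andP[? ?]; apply/andP; split; lra.
Qed.

Section DeterminantMaps.
Context {R : realType} {n : nat}.

Lemma cvg_det (T : Type) (F : set_system T) {FF : Filter F} (A_ : T -> 'I_n -> 'I_n -> R)
    (A : 'I_n -> 'I_n -> R) : (forall i j, A_ t i j @[t --> F] --> A i j) ->
  \det (\matrix_(i, j) A_ t i j) @[t --> F] --> \det (\matrix_(i, j) A i j).
Proof.
move=> AA; rewrite /determinant.
apply: cvg_big => [|s _]; first exact: add_continuous.
apply: cvgM; first exact: cvg_cst.
apply: cvg_big => [|i _]; first exact: mul_continuous.
under eq_cvg do rewrite mxE; rewrite mxE; exact: AA.
Qed.

Lemma measurable_det d (T : measurableType d) (D : set T) (A : 'I_n -> 'I_n -> T -> R) :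
  (forall i j, measurable_fun D (A i j)) ->
  measurable_fun D (fun t => \det (\matrix_(i, j) A i j t)).
Proof.
move=> mA; rewrite /determinant; apply: measurable_sum => s.
apply: measurable_funM; first exact: measurable_cst.
apply: measurable_prod => i _.
under eq_fun do rewrite mxE; exact: mA.
Qed.

End DeterminantMaps.

Section DeterminantL1.
Context {R : realType} {N : nat}.
Notation n := N.+1.
Notation lam := (@lebesgueRn R n).
Notation integ f := (lam.-integrable setT (EFin \o f)).
Implicit Types (m l : nat) (x : 'rV[R]_n) (G : 'I_n -> 'I_n -> 'rV[R]_n -> R).

Definition power_integrable G (M : R) := forall i j,
  integ (G i j) /\ integral_le (fun x => `|G i j x| ^+ n) M.

Lemma det_le (A : 'I_n -> 'I_n -> R) :
  `|\det (\matrix_(i, j) A i j)| <= (n`!)%:R * (\sum_i \sum_j `|A i j| ^+ n).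
Proof.
apply: (le_trans (det_row_bound _ ord0 ltr01)); apply: ler_wpM2l => //.
rewrite mul1r [leRHS](bigD1 ord0)//=; apply: lerD.
  by apply: ler_sum => j _; rewrite mxE divr1.
rewrite (bigD1 ord0)//= big1 ?add0r; last by move=> j _; rewrite mul0r.
by apply: ler_sum => i i0; apply: ler_sum => j _; rewrite i0 mul1r mxE.
Qed.

Lemma det_sub_le (A B : 'I_n -> 'I_n -> R) (t : R) : 0 < t ->
  `|\det (\matrix_(i, j) A i j) - \det (\matrix_(i, j) B i j)| <=
  \sum_i (n`!)%:R * (t * (\sum_j t^-1 ^+ n * `|A i j - B i j| ^+ n +
    \sum_k \sum_j (`|A k j| ^+ n + `|B k j| ^+ n))).
Proof.
move=> t0; rewrite det_telescope; apply: (le_trans (ler_norm_sum _ _ _)).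
apply: ler_sum => i _; apply: (le_trans (det_row_bound _ i t0)); apply: ler_wpM2l => //.
apply: ler_wpM2l; first exact: ltW.
apply: lerD; first by apply: ler_sum => j _; rewrite mxE eqxx !mxE exprMn mulrC.
apply: ler_sum => k _; apply: ler_sum => j _; rewrite mxE.
have [->|ki] := eqVneq k i; first by rewrite mul0r addr_ge0 ?exprn_ge0.
rewrite mul1r /mix; case: (k < i)%N; rewrite mxE; first by rewrite lerDl exprn_ge0.
by rewrite lerDr exprn_ge0.
Qed.

Lemma measurable_det_Rn G (M : R) : power_integrable G M ->
  measurable_fun (setT : set (Rn R n)) (fun x => \det (\matrix_(i, j) G i j x)).
Proof. by move=> GM; apply: measurable_det => i j; apply: measurable_of_integrable; exact: (GM i j).1. Qed.

Lemma integrable_det G (M : R) : power_integrable G M ->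
  integ (fun x => \det (\matrix_(i, j) G i j x)).
Proof.
move=> GM; have [I _] := integral_leZ (ler0n _ n`!) (integral_le_sum (fun i => integral_le_sum (fun j => (GM i j).2))).
apply: (integrable_le (measurable_det_Rn GM) I) => x; exact: det_le.
Qed.

Lemma power_integrable_conv m G M : power_integrable G M ->
  power_integrable (fun i j => conv (eta m) (G i j)) M.
Proof.
move=> GM i j; have [Gi [GNi GNM]] := GM i j.
split; first exact: integrable_conv.
by have [? H] := normN_conv m Gi GNi; split => //; exact: le_trans H _.
Qed.

(** Continuity of the determinant from L^n to L^1. The bound from [det_sub_le] has the form P(t)
    S(l) + Q t with S(l) tending to 0: t is chosen first, then l. The speed depends on [G]. *)
Lemma det_L1_approximation G (M : R) : power_integrable G M ->
  (fun l => \int[lam]_x `|\det (\matrix_(i, j) conv (eta l) (G i j) x) - \det (\matrix_(i, j) G i j x)|)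
    @ \oo --> (0 : R).
Proof.
move=> GM.
have M0 : 0 <= M.
  by apply: le_trans (GM ord0 ord0).2.2; apply: Rintegral_ge0 => x _; rewrite exprn_ge0.
pose a l i j := \int[lam]_x `|conv (eta l) (G i j) x - G i j x| ^+ n.
have aE l i j : integral_le (fun x => `|conv (eta l) (G i j) x - G i j x| ^+ n) (a l i j).
  split => //; have [Gi [GNi _]] := GM i j.
  have [Ci [CNi _]] := power_integrable_conv l GM i j.
  have mD : measurable_fun (setT : set (Rn R n)) (fun x => `|conv (eta l) (G i j) x - G i j x| ^+ n).
    apply: measurable_funX; apply: measurableT_comp; first exact: normr_measurable.
    by apply: measurable_funB; [exact: measurable_of_integrable Ci|exact: measurable_of_integrable Gi].
  have I : integ (fun x => 3%:R ^+ n * (`|conv (eta l) (G i j) x| ^+ n + `|G i j x| ^+ n)).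
    exact: (integrableZl measurableT _ (integrableD measurableT CNi GNi)).
  apply: (integrable_le mD I) => x; rewrite ger0_norm ?exprn_ge0//.
  have := @exprD3_le R n `|conv (eta l) (G i j) x| `|G i j x| 0 (normr_ge0 _) (normr_ge0 _) (lexx 0).
  rewrite !addr0 expr0n/= addr0; apply: le_trans.
  by apply: lerXn2r; rewrite ?nnegrE ?addr_ge0//; exact: ler_normB.
pose S l := \sum_(i < n) \sum_(j < n) a l i j.
have S0 : S @ \oo --> (0 : R).
  have -> : 0 = \sum_(i < n) \sum_(j < n) (0 : R) by rewrite big1// => i _; rewrite big1.
  apply: cvg_big => [|i _]; first exact: add_continuous.
  apply: cvg_big => [|j _]; first exact: add_continuous.
  exact: power_approximation (GM i j).1 (GM i j).2.1.
pose Q : R := n%:R * (n`!%:R * (n%:R * (n%:R * (2 * M)))).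
have H (t : R) l : 0 < t ->
  \int[lam]_x `|\det (\matrix_(i, j) conv (eta l) (G i j) x) - \det (\matrix_(i, j) G i j x)| <=
  (n`!)%:R * (t * t^-1 ^+ n) * S l + Q * t.
  move=> t0.
  have I : integral_le (fun x => \sum_i (n`!)%:R * (t * (\sum_j t^-1 ^+ n * `|conv (eta l) (G i j) x - G i j x| ^+ n +
    \sum_k \sum_j (`|conv (eta l) (G k j) x| ^+ n + `|G k j x| ^+ n))))
    (\sum_i (n`!)%:R * (t * (\sum_j t^-1 ^+ n * a l i j + \sum_(k < n) \sum_(j < n) (M + M)))).
    apply: integral_le_sum => i; apply: integral_leZ => //; apply: integral_leZ; first exact: ltW.
    apply: integral_leD.
      by apply: integral_le_sum => j; apply: integral_leZ; rewrite ?exprn_ge0 ?invr_ge0 ?ltW.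
    apply: integral_le_sum => k; apply: integral_le_sum => j; apply: integral_leD.
      exact: (power_integrable_conv l GM k j).2.
    exact: (GM k j).2.
  have D : integ (fun x => `|\det (\matrix_(i, j) conv (eta l) (G i j) x) - \det (\matrix_(i, j) G i j x)|).
    exact: (integrable_norm (integrableB measurableT (integrable_det (power_integrable_conv l GM))
      (integrable_det GM))).
  apply: (@le_trans _ _ (\sum_i (n`!)%:R * (t * (\sum_j t^-1 ^+ n * a l i j + \sum_(k < n) \sum_(j < n) (M + M))))).
    apply: le_trans I.2; apply: (le_Rintegral measurableT D I.1) => x _; exact: det_sub_le.
  rewrite -mulr_sumr -mulr_sumr big_split/= -mulrA -[X in _ <= _ + X]mulrC.
  under eq_bigr do rewrite -mulr_sumr.
  rewrite -mulr_sumr -/(S l) !sumr_const !card_ord /Q.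
  have mn (y : R) : y *+ n = n%:R * y by rewrite mulr_natl.
  move: mn; set d : R := n%:R; move: (d) => {}d mn; rewrite !mn.
  by rewrite le_eqVlt; apply/orP; left; apply/eqP; ring.
apply/cvgrPdist_le => e e0.
have Q0 : 0 <= Q by rewrite /Q; do 4! apply: mulr_ge0 => //; exact: mulr_ge0.
pose t := e / 2 / (Q + 1).
have t0 : 0 < t by rewrite /t !divr_gt0// ltr_wpDl.
pose P : R := (n`!)%:R * (t * t^-1 ^+ n).
have P0 : 0 <= P by rewrite /P mulr_ge0// mulr_ge0 ?exprn_ge0 ?invr_ge0// ltW.
have e1 : 0 < e / 2 / (P + 1) by rewrite !divr_gt0// ltr_wpDl.
have := S0; move=> /cvgrPdist_le/(_ _ e1); apply: filterS => l.
rewrite !sub0r !normrN => Sl.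
rewrite ger0_norm; last by apply: Rintegral_ge0.
apply: (le_trans (H t l t0)); rewrite -/P.
have E1 : P * S l <= e / 2.
  apply: (@le_trans _ _ ((P + 1) * (e / 2 / (P + 1)))).
    apply: (@le_trans _ _ (P * `|S l|)); first by rewrite ler_wpM2l// ler_norm.
    by apply: ler_pM => //; rewrite lerDl.
  by rewrite mulrC divfK// gt_eqF// ltr_wpDl.
have E2 : Q * t <= e / 2.
  apply: (@le_trans _ _ ((Q + 1) * t)); first by apply: ler_wpM2r; rewrite ?lerDl ?ltW.
  by rewrite /t mulrC divfK// gt_eqF// ltr_wpDl.
by lra.
Qed.

Section Mollification.
Variables (Om : set 'rV[R]_n) (f : 'rV[R]_n -> R) (df : 'I_n -> 'rV[R]_n -> R) (B : R) (m : nat).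
Hypotheses (fC : C1b f df)
  (f0 : exists k, forall x, ~ cube k x -> f x = 0 /\ forall j, df j x = 0)
  (dfB : forall j x, `|df j x| <= B)
  (fm : forall x, ~ inner Om m.+1%:R^-1 x -> f x = 0 /\ forall j, df j x = 0).

Lemma integrable_test_det G (M : R) : power_integrable G M ->
  integ (fun x => f x * \det (\matrix_(i, j) G i j x)).
Proof.
move=> GM; have [[C _ [CF _]] _ _] := fC; apply: (@integrableMl_bounded _ _ R lam f _ C _ CF (integrable_det GM)).
by apply: continuous_Rn_measurable; apply: bounded_lipschitz_continuous; case: fC.
Qed.

(** Limit l to infinity in [telescope_estimate]. The speed of that limit depends on [G], but the
    resulting bound sees [G] only through [M]. *)
Lemma mollified_det_estimate u G (M : R) : sobolev Om u G -> power_integrable G M ->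
  `|\int[lam]_x (f x * (\det (\matrix_(i, j) conv (eta m) (G i j) x) - \det (\matrix_(i, j) G i j x)))| <=
  @gradient_constant R N B * M * m.+1%:R^-1.
Proof.
move=> SG GM; have [[C C0 [CF _]] _ _] := fC.
apply/ler_addgt0Pr => e e0.
have e1 : 0 < e / (C + 1) by rewrite divr_gt0// ltr_wpDl.
have /cvgrPdist_le/(_ _ e1)[l0 _ H] := det_L1_approximation GM.
pose l := maxn m l0; have ml : (m <= l)%N := leq_maxl _ _.
have := H l (leq_maxr _ _); rewrite /= sub0r normrN => {}H.
pose D k x := \det (\matrix_(i, j) conv (eta k) (G i j) x).
have Di k : integ (D k) := integrable_det (power_integrable_conv k GM).
have Gi := integrable_det GM.
have fDi k : integ (fun x => f x * D k x) := integrable_test_det (power_integrable_conv k GM).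
have fGi := integrable_test_det GM.
have -> : \int[lam]_x (f x * (\det (\matrix_(i, j) conv (eta m) (G i j) x) - \det (\matrix_(i, j) G i j x))) =
    \int[lam]_x (f x * (D m x - D l x)) + \int[lam]_x (f x * (D l x - \det (\matrix_(i, j) G i j x))).
  rewrite -RintegralD//.
  - by apply: eq_Rintegral => x _; rewrite -mulrDr addrA subrK.
  - by under [X in EFin \o X]eq_fun do rewrite mulrBr; exact: (integrableB measurableT (fDi m) (fDi l)).
  - by under [X in EFin \o X]eq_fun do rewrite mulrBr; exact: (integrableB measurableT (fDi l) fGi).
apply: (le_trans (ler_normD _ _)); apply: lerD.
  exact: (telescope_estimate SG (fun i j => (GM i j).2.2) fC f0 dfB ml fm).
have DG : integ (fun x => `|D l x - \det (\matrix_(i, j) G i j x)|).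
  exact: (integrable_norm (integrableB measurableT (Di l) Gi)).
apply: (@le_trans _ _ (\int[lam]_x (C * `|D l x - \det (\matrix_(i, j) G i j x)|))).
  apply: norm_Rintegral_le.
  - by under [X in EFin \o X]eq_fun do rewrite mulrBr; exact: (integrableB measurableT (fDi l) fGi).
  - exact: (integrableZl measurableT C DG).
  by move=> x; rewrite normrM ler_wpM2r.
rewrite RintegralZl//; apply: (@le_trans _ _ ((C + 1) * (e / (C + 1)))).
  apply: ler_pM => //; first by apply: Rintegral_ge0.
    by rewrite lerDl.
  by apply: le_trans H; exact: ler_norm.
by rewrite mulrC divfK// gt_eqF// ltr_wpDl.
Qed.

(** At a fixed scale the mollified entries are bounded by sup [eta] times the L^1 bound, uniformly
    in k and x, so pointwise convergence passes to the integral by domination with a multiple of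
    |f|. *)
Lemma mollified_det_cvg (G_ : nat -> 'I_n -> 'I_n -> 'rV[R]_n -> R) G (M C : R) :
  (forall k, power_integrable (G_ k) M) -> power_integrable G M ->
  (forall k i j, \int[lam]_x `|G_ k i j x| <= C) ->
  (forall i j x, conv (eta m) (G_ k i j) x @[k --> \oo] --> conv (eta m) (G i j) x) ->
  \int[lam]_x (f x * \det (\matrix_(i, j) conv (eta m) (G_ k i j) x)) @[k --> \oo] -->
  \int[lam]_x (f x * \det (\matrix_(i, j) conv (eta m) (G i j) x)).
Proof.
move=> GkM GM GkC Gcvg.
have [K K0 [EK _]] := eta_bounded_lipschitz (R := R) (n := n) m.
have KC k i j x : `|conv (eta m) (G_ k i j) x| <= K * C.
  have [Gi _] := GkM k i j.
  apply: (@le_trans _ _ (\int[lam]_z (K * `|G_ k i j z|))).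
    apply: norm_Rintegral_le.
    - exact: integrable_kernel (eta_bounded_lipschitz m) Gi.
    - exact: (integrableZl measurableT K (integrable_norm Gi)).
    by move=> z; rewrite normrM ler_wpM2r.
  by rewrite RintegralZl// ?ler_wpM2l//; exact: (integrable_norm Gi).
pose Q : R := n`!%:R * (\sum_(i < n) \sum_(j < n) (K * C) ^+ n).
have DQ k x : `|\det (\matrix_(i, j) conv (eta m) (G_ k i j) x)| <= Q.
  apply: (le_trans (det_le _)); apply: ler_wpM2l => //.
  by apply: ler_sum => i _; apply: ler_sum => j _; apply: lerXn2r; rewrite ?nnegrE// (le_trans _ (KC k i j x)).
have bf : bounded_lipschitz f by case: fC.
have fi : integ f.
  apply: integrable_compact; first exact: bounded_lipschitz_continuous.
    by case: bf => c _ [cf _]; exists c.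
  by have [k fk] := f0; exists k => x /fk[].
have mf := measurable_of_integrable fi.
have Fi k := integrable_test_det (power_integrable_conv m (GkM k)).
have FG := integrable_test_det (power_integrable_conv m GM).
have [_ H] := @dominated_L1 _ _ R lam (fun k x => f x * \det (\matrix_(i, j) conv (eta m) (G_ k i j) x))
  (fun x => f x * \det (\matrix_(i, j) conv (eta m) (G i j) x)) (fun x => Q * `|f x|)
  (fun k => measurable_of_integrable (Fi k)) (integrableZl measurableT Q (integrable_norm fi))
  (fun k x => ltac:(rewrite normrM mulrC; apply: ler_wpM2r => //))
  (fun x => cvgM (cvg_cst _) (cvg_det (fun i j => Gcvg i j x))).
apply/cvgrPdist_le => e e0; move: H => /cvgrPdist_le/(_ _ e0); apply: filterS => k.
rewrite sub0r normrN => /(le_trans (ler_norm _)); apply: le_trans.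
rewrite distrC -RintegralB//; apply: (le_normr_Rintegral measurableT).
exact: (integrableB measurableT (Fi k) FG).
Qed.

End Mollification.

Theorem det_weak_continuity (Om : set 'rV[R]_n) (f : 'rV[R]_n -> R) df (r : R)
    (u_ : nat -> 'I_n -> 'rV[R]_n -> R) (G_ : nat -> 'I_n -> 'I_n -> 'rV[R]_n -> R) u G (M C : R) :
  C1b f df -> (exists k, forall x, ~ cube k x -> f x = 0 /\ forall j, df j x = 0) ->
  0 < r -> (forall x, ~ inner Om r x -> f x = 0 /\ forall j, df j x = 0) ->
  (forall k, sobolev Om (u_ k) (G_ k)) -> sobolev Om u G ->
  (forall k, power_integrable (G_ k) M) -> power_integrable G M ->
  (forall k i j, \int[lam]_x `|G_ k i j x| <= C) ->
  (forall m i j x, conv (eta m) (G_ k i j) x @[k --> \oo] --> conv (eta m) (G i j) x) ->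
  \int[lam]_x (f x * \det (\matrix_(i, j) G_ k i j x)) @[k --> \oo] -->
  \int[lam]_x (f x * \det (\matrix_(i, j) G i j x)).
Proof.
move=> fC f0 r0 fr SG_ SG GkM GM GkC Gcvg.
have [B dfB] : exists B, forall j x, `|df j x| <= B.
  have [_ bdf _] := fC.
  have /choice[b Hb] : forall j, exists c, forall x, `|df j x| <= c.
    by move=> j; have [c _ [cf _]] := bdf j; exists c.
  exists (\sum_j `|b j|) => j x; apply: (le_trans (Hb j x)); apply: (le_trans (ler_norm _)).
  by rewrite (bigD1 j)//= lerDl sumr_ge0.
apply/cvgrPdist_le => e e0.
set K := @gradient_constant R N B * M.
have [m mr mK] : exists2 m : nat, m.+1%:R^-1 <= r & K * m.+1%:R^-1 <= e / 3.
  have e3 : 0 < e / 3 by rewrite divr_gt0.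
  (* The two summands serve the two requirements: 1/(m+1) <= r keeps the support of [f] inside the
     inner set, and K/(m+1) <= e/3 makes the mollification error small for all k at once. *)
  pose z := `|K| / (e / 3) + r^-1; exists (Num.truncn z); have := truncnS_gt z.
    move=> zm; rewrite invf_ple ?posrE// (le_trans _ (ltW zm))// lerDr.
    by rewrite mulr_ge0// invr_ge0 ltW.
  move=> zm; apply: (@le_trans _ _ (`|K| / (Num.truncn z).+1%:R)).
    by rewrite ler_wpM2r// ler_norm.
  rewrite ler_pdivrMr// mulrC -ler_pdivrMr// (le_trans _ (ltW zm))// lerDl.
  by rewrite invr_ge0 ltW.
have fm x : ~ inner Om m.+1%:R^-1 x -> f x = 0 /\ forall j, df j x = 0.
  by move=> xm; apply: fr => xr; apply: xm; exact: sub_inner xr.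
have E1 k := mollified_det_estimate fC f0 dfB fm (SG_ k) (GkM k).
have E2 := mollified_det_estimate fC f0 dfB fm SG GM.
have e1 : 0 < e / 3 by rewrite divr_gt0.
have := mollified_det_cvg fC f0 GkM GM GkC (Gcvg m) => /cvgrPdist_le/(_ _ e1).
apply: filterS => k E3.
have I1 := integrable_test_det fC (GkM k).
have I2 := integrable_test_det fC GM.
have J1 := integrable_test_det fC (power_integrable_conv m (GkM k)).
have J2 := integrable_test_det fC (power_integrable_conv m GM).
move: E1 => /(_ k); under eq_Rintegral do rewrite mulrBr.
rewrite RintegralB// => /le_trans/(_ mK) E1.
move: E2; under eq_Rintegral do rewrite mulrBr.
rewrite RintegralB// => /le_trans/(_ mK) E2.
have -> : e = (e / 3) *+ 3 by rewrite -mulr_natr divfK.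
exact: dist3 E1 E2 E3.
Qed.

End DeterminantL1.

(** * Duality in L^p and uniform boundedness *)

Section LpDuality.
Context d (T : measurableType d) {R : realType} (mu : {measure set T -> \bar R}).
Variables (p q : R).
Hypotheses (p1 : 1 < p) (q0 : 0 < q) (pq : p^-1 + q^-1 = 1).
Implicit Types f g h : T -> R.
Notation nrm r f := ('N[mu]_(r%:E)[EFin \o f])%E.

Let p0 : 0 < p. Proof. exact: lt_trans p1. Qed.

Lemma measurable_norm_powR f (r : R) : measurable_fun setT f ->
  measurable_fun setT (fun x => `|f x| `^ r).
Proof.
move=> mf; apply: (@measurableT_comp _ _ _ _ _ _ (@powR R ^~ r)); first exact: measurable_powR.
by apply: measurableT_comp => //; exact: normr_measurable.
Qed.

Lemma Lnorm_powR_integrable f (r : R) : 0 < r -> measurable_fun setT f -> (nrm r f < +oo)%E ->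
  mu.-integrable setT (EFin \o (fun x => `|f x| `^ r)) /\
  \int[mu]_x (`|f x| `^ r) = fine (nrm r f) `^ r.
Proof.
move=> r0 mf fr; have := powR_Lnorm mu (EFin \o f) (lt0r_neq0 r0).
under eq_integral do rewrite /=.
move=> E; split; last by rewrite /Rintegral -E fine_poweR.
apply/integrableP; split; first by apply/measurable_EFinP; exact: measurable_norm_powR.
under eq_integral do rewrite /= ger0_norm ?powR_ge0//.
by rewrite -E; exact: poweR_lty.
Qed.

Lemma hoelder_pairing f g : measurable_fun setT f -> measurable_fun setT g ->
  (nrm p f < +oo)%E -> (nrm q g < +oo)%E ->
  mu.-integrable setT (EFin \o (fun x => g x * f x)) /\
  (`|\int[mu]_x (g x * f x)|%:E <= nrm q g * nrm p f)%E.
Proof.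
move=> mf mg fp gq; have H := hoelder mu mf mg p0 q0 pq.
have mgf : measurable_fun setT (fun x => g x * f x) by exact: measurable_funM.
have E : ('N[mu]_1[EFin \o (f \* g)%R] = \int[mu]_x `|(g x * f x)%:E|)%E.
  by rewrite Lnorm1; apply: eq_integral => x _ /=; rewrite mulrC.
have I : mu.-integrable setT (EFin \o (fun x => g x * f x)).
  apply/integrableP; split; first exact/measurable_EFinP.
  rewrite /= -E; apply: (le_lt_trans H).
  by rewrite lte_mul_pinfty// ?Lnorm_ge0// ge0_fin_numE// Lnorm_ge0.
split => //; rewrite muleC; apply: le_trans H; rewrite E.
apply: le_trans (le_abse_integral mu measurableT _); last exact/measurable_EFinP.
by rewrite -[in leRHS](fineK (integrable_fin_num measurableT I)).
Qed.

(** The equality case of Hoelder's inequality: the sign of h times (|h| / A)^(p-1), where A is the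
    L^p norm of h. *)
Lemma norming_function h : measurable_fun setT h -> (nrm p h < +oo)%E ->
  exists g, [/\ measurable_fun setT g, (nrm q g <= 1)%E &
    \int[mu]_x (g x * h x) = fine (nrm p h)].
Proof.
move=> mh hp; have [hi hE] := Lnorm_powR_integrable p0 mh hp.
set A := fine (nrm p h) in hE *.
have A0 : 0 <= A by rewrite fine_ge0 ?Lnorm_ge0.
have [->|An0] := eqVneq A 0.
  exists (fun=> 0); split; first exact: measurable_cst.
    by rewrite [X in (X <= _)%E](_ : _ = 0%E)// Lnorm0// eqe gt_eqF.
  by under eq_Rintegral do rewrite mul0r; rewrite Rintegral_cst// mul0r.
have {}A0 : 0 < A by rewrite lt_neqAle eq_sym An0.
pose t x := `|h x| / A; have t0 x : 0 <= t x by rewrite divr_ge0// ltW.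
(* Writing the power p - 1 as [h / A] times the power p - 2 of its modulus carries the sign along;
   where h vanishes the first factor makes [g] zero whatever the sign of p - 2. *)
pose g x := h x / A * t x `^ (p - 2).
have ti : mu.-integrable setT (EFin \o (fun x => t x `^ p)) /\ \int[mu]_x (t x `^ p) = 1.
  have tE x : t x `^ p = A^-1 `^ p * `|h x| `^ p by rewrite /t mulrC powRM// invr_ge0 ltW.
  split.
    by under [X in EFin \o X]eq_fun do rewrite tE; exact: (integrableZl measurableT _ hi).
  under eq_Rintegral do rewrite tE.
  by rewrite RintegralZl// hE -powRM ?invr_ge0 ?ltW// mulVf// powR1.
have mg : measurable_fun setT g.
  apply: measurable_funM; first by apply: measurable_funM => //; exact: measurable_cst.
  apply: (@measurableT_comp _ _ _ _ _ _ (@powR R ^~ (p - 2))); first exact: measurable_powR.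
  apply: measurable_funM; last exact: measurable_cst.
  by apply: measurableT_comp => //; exact: normr_measurable.
have gE x : `|g x| `^ q = t x `^ p.
  have -> : `|g x| = t x * t x `^ (p - 2).
    by rewrite /g normrM (ger0_norm (powR_ge0 _ _)) normrM normfV (gtr0_norm A0).
  have [->|tn0] := eqVneq (t x) 0; first by rewrite mul0r !powR0// gt_eqF.
  have tp : 0 < t x by rewrite lt_neqAle eq_sym tn0 t0.
  have -> : t x * t x `^ (p - 2) = t x `^ (p - 1).
    rewrite -{1}[t x]powRr1// -powRD; last by rewrite tn0 implybT.
    by congr (_ `^ _); ring.
  have pqE : p * q = q + p.
    by rewrite -[LHS]mul1r -pq; field; apply/andP; split; rewrite gt_eqF.
  by rewrite -powRrM mulrBl mul1r pqE addrAC subrr add0r.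
exists g; split => //.
  have := powR_Lnorm mu (EFin \o g) (lt0r_neq0 q0).
  under eq_integral do rewrite /= gE.
  have -> : (\int[mu]_x (t x `^ p)%:E = 1)%E.
    by rewrite -[RHS]/(1%:E) -ti.2 fineK//; exact: (integrable_fin_num measurableT ti.1).
  move=> /(congr1 (fun z => z `^ q^-1)%E); rewrite -poweRrM mulfV ?gt_eqF// poweR1r.
  by rewrite poweRe1 ?Lnorm_ge0// => ->.
have -> : A = \int[mu]_x (A * t x `^ p) by rewrite RintegralZl ?ti.2 ?mulr1//; exact: ti.1.
apply: eq_Rintegral => x _; rewrite /g.
have [h0|hn0] := eqVneq (h x) 0.
  by rewrite h0 /t h0 normr0 mul0r mulr0 powR0 ?mulr0// gt_eqF.
have tn0 : t x != 0 by rewrite /t mulf_neq0 ?invr_eq0 ?normr_eq0.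
have -> : t x `^ p = t x ^+ 2 * t x `^ (p - 2).
  by rewrite -powR_mulrn// -powRD ?tn0 ?implybT//; congr (_ `^ _); ring.
rewrite mulrAC [RHS]mulrA; congr (_ * _); rewrite /t exprMn real_normK ?num_real// exprVn.
by field.
Qed.

End LpDuality.

Lemma cvg_norm_le (R : realType) (u : nat -> R) (l c : R) : u @ \oo --> l ->
  (forall k, `|u k| <= c) -> `|l| <= c.
Proof.
move=> ul uc; rewrite -(cvg_lim _ (cvg_norm ul))//; apply: limr_le.
  by apply: cvgP; exact: cvg_norm ul.
exact: nearW.
Qed.

Section UniformBoundedness.
Context {R : realType} {V : lmodType R} (S : set V) (N : V -> \bar R).
Variables (ell : nat -> V -> R) (x : nat -> V).
Hypotheses (Sx : forall k, S (x k)) (Nfin : forall f, S f -> (N f < +oo)%E).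
Hypothesis ell_linear : forall j a f g, S f -> S g ->
  ell j (a *: f + g) = a * ell j f + ell j g.
Hypothesis ell_le : forall j f, S f -> ((`|ell j f|)%:E <= N f)%E.
Hypothesis ell_norming : forall j k, `|ell j (x k)| <= ell k (x k).
Hypothesis x_cvg : forall L, dual S N L -> cvgn (fun k => L (x k)).

(* A gliding hump: were the values unbounded, a sum of [+- 3^-m ell (kappa m)] over a fast
   subsequence [kappa], with signs preventing cancellation, would be unbounded on [x]. *)
Lemma weakly_convergent_bounded : exists C, forall k, ell k (x k) <= C.
Proof.
apply: contrapT => nC.
(* The factor 3^m compensates the weight 3^-m of the m-th functional, so that its value at [z m]
   still exceeds m. *)
have /choice[kappa Hk] : forall m : nat, exists k, m%:R * 3 ^+ m < ell k (x k).
  move=> m; apply: contrapT => H; apply: nC; exists (m%:R * 3 ^+ m) => k.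
  by rewrite leNgt; apply/negP => mk; apply: H; exists k.
pose z m := x (kappa m); pose l m := ell (kappa m).
(* Each new term takes the sign that the partial sum already has at [z m'], so at that point the two
   add up in absolute value. *)
pose Lam := fix Lam m : V -> R := if m is m'.+1 then fun f =>
  Lam m' f + (if 0 <= Lam m' (z m') then 1 else -1) * (3 ^- m' * l m' f) else fun=> 0.
pose s m : R := if 0 <= Lam m (z m) then 1 else -1.
have LamS m f : Lam m.+1 f = Lam m f + s m * (3 ^- m * l m f) by [].
have s1 m : `|s m| = 1 by rewrite /s; case: ifP => _; rewrite ?normrN normr1.
have Lamz m : 3 ^- m * l m (z m) <= `|Lam m.+1 (z m)|.
  rewrite LamS /s; have l0 : 0 <= 3 ^- m * l m (z m).
    by rewrite mulr_ge0 ?invr_ge0 ?exprn_ge0//; apply: le_trans (ell_norming (kappa m) (kappa m)).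
  move: l0; set a := 3 ^- m * _ => a0; case: ifPn => H; first by rewrite ger0_norm; lra.
  by rewrite ltr0_norm; move: H; rewrite -ltNge => H; lra.
(* The bracket is the exact geometric sum of 3^-i for i from m to m + k - 1, so the induction closes
   with equality. *)
have tail b f m k : (forall j, `|l j f| <= b) ->
    `|Lam (m + k)%N f - Lam m f| <= b * (3 / 2 * (3 ^- m - 3 ^- (m + k))).
  move=> lb; elim: k => [|k IH]; first by rewrite addn0 !subrr normr0 mulr0 mulr0.
  rewrite addnS LamS addrAC; apply: (le_trans (ler_normD _ _)).
  rewrite normrM s1 mul1r normrM (ger0_norm (_ : 0 <= 3 ^- (m + k))) ?invr_ge0 ?exprn_ge0//.
  apply: (@le_trans _ _ (b * (3 / 2 * (3 ^- m - 3 ^- (m + k))) + 3 ^- (m + k) * b)).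
    by apply: lerD => //; apply: ler_wpM2l => //; rewrite invr_ge0 exprn_ge0.
  rewrite exprS invfM; set u := 3 ^- (m + k); set v := 3 ^- m.
  by rewrite le_eqVlt; apply/orP; left; apply/eqP; field.
have e3 m : 0 < 3 ^- m :> R by rewrite invr_gt0 exprn_gt0.
have tail' b f m k : (forall j, `|l j f| <= b) ->
    `|Lam (m + k)%N f - Lam m f| <= b * (3 / 2 * 3 ^- m).
  move=> lb; apply: (le_trans (tail _ _ _ _ lb)); apply: ler_wpM2l; first exact: le_trans (lb 0%N).
  by apply: ler_wpM2l => //; rewrite gerBl ltW.
have lN f : S f -> forall j, `|l j f| <= fine (N f).
  move=> Sf j; have := ell_le (kappa j) Sf; rewrite -lee_fin fineK// ge0_fin_numE ?Nfin//.
  by apply: le_trans (ell_le 0 Sf).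
have Lam_cvg f : S f -> cvgn (Lam ^~ f).
  move=> Sf; apply: cauchy_cvg; apply/cauchy_exP => e e0.
  have b0 : 0 <= fine (N f) by exact: le_trans (lN f Sf 0%N).
  pose m := Num.truncn (fine (N f) * (3 / 2) / e); exists (Lam m f).
  exists m => // k /= mk; rewrite -(subnKC mk) -ball_normE /ball_/= distrC.
  apply: (le_lt_trans (tail' _ _ m (k - m)%N (lN f Sf))).
  have : fine (N f) * (3 / 2) / e < 3 ^+ m.
    by apply: (lt_le_trans (truncnS_gt _)); rewrite -natrX ler_nat; exact: ltn_expl.
  move: (fine (N f)) (3 ^+ m) (exprn_gt0 m (ltr0n R 3)) => b v v0.
  by rewrite ltr_pdivrMr// => bv; rewrite !mulrA ltr_pdivrMr// -mulrA [e * _]mulrC.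
pose L f := limn (Lam ^~ f).
have dL : dual S N L.
  split.
    move=> a f g Sf Sg; have E m : Lam m (a *: f + g) = a * Lam m f + Lam m g.
      elim: m => [|m IH]; first by rewrite /= mulr0 addr0.
      by rewrite !LamS IH /l ell_linear//; ring.
    apply: cvg_lim => //; under eq_cvg do rewrite E.
    by apply: cvgD; [apply: cvgMr|]; exact: Lam_cvg.
  (* 3/2 is the sum of all the weights 3^-m. *)
  exists (3 / 2) => f Sf; have lb := lN f Sf.
  have NE : N f = (fine (N f))%:E.
    by rewrite fineK// ge0_fin_numE ?Nfin//; apply: le_trans (ell_le 0 Sf).
  rewrite NE -EFinM lee_fin mulrC; apply: (cvg_norm_le (Lam_cvg f Sf)) => k.
  have := tail' _ f 0%N k lb.
  by rewrite add0n subr0 expr0 invr1 mulr1.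
(* The weights after the m-th add up to 3/2 * 3^-(m+1) = 3^-m / 2, and by the norming hypothesis no
   later functional is larger at [z m] than [l m]; half of the hump survives, so [L (z m)] exceeds
   m/2 in modulus. *)
have Ltail m : `|Lam m.+1 (z m)| - 2^-1 * (3 ^- m * l m (z m)) <= `|L (z m)|.
  have lb j : `|l j (z m)| <= l m (z m) by exact: ell_norming.
  have C : Lam (m.+1 + k)%N (z m) - Lam m.+1 (z m) @[k --> \oo] --> L (z m) - Lam m.+1 (z m).
    apply: cvgB; last exact: cvg_cst.
    have -> : (fun k => Lam (m.+1 + k)%N (z m)) = [sequence Lam (k + m.+1)%N (z m)]_k.
      by apply/funext => k; rewrite addnC.
    by have := Lam_cvg _ (Sx (kappa m)); rewrite -(cvg_shiftn m.+1).
  have := cvg_norm_le C (fun k => tail' _ _ m.+1 k lb).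
  have := ler_normD (L (z m)) (Lam m.+1 (z m) - L (z m)).
  rewrite addrC subrK [in X in _ <= X -> _]distrC exprS invfM.
  set u := 3 ^- m; set w := l m _; set v := `|_ - _|; move=> ? ?.
  by lra.
have [M HM] : exists M, forall k, `|L (x k)| <= M.
  have /cvg_seq_bounded[M [_ /(_ (M + 1))]] := x_cvg dL.
  by rewrite ltrDl ltr01 => /(_ isT) H; exists (M + 1) => k; exact: H.
have Hm m : m%:R / 2 <= M :> R.
  apply: le_trans (HM (kappa m)); apply: le_trans (Ltail m).
  have := Lamz m; have := Hk m; rewrite -ltr_pdivlMr ?exprn_gt0// mulrC.
  rewrite -/(l m) -/(z m); set a := (3 ^- m * _); set b := `|_|; move=> ? ?; lra.
have := truncnS_gt (2 * M); have := Hm (Num.truncn (2 * M)).+1; set u := _%:R; lra.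
Qed.

End UniformBoundedness.

(** * Reduction to functions on the whole space *)

Lemma norm_entry_le (R : realType) m n (A : 'M[R]_(m, n)) i j : `|A i j| <= `|A|.
Proof.
apply/ler_addgt0Pr => e e0; apply/ltW.
have : ball (0 : 'M[R]_(m, n)) (`|A| + e) A.
  by rewrite mx_norm_ball /ball_/= sub0r normrN ltrDl.
by move=> [_ /(_ i j)]; rewrite mxE /ball/= sub0r normrN.
Qed.

Lemma exprn_le_powR (R : realType) (a p : R) k : (0 < k)%N -> k%:R <= p -> 0 <= a ->
  a ^+ k <= 1 + a `^ p.
Proof.
move=> k0 kp a0; have [a1|a1] := leP a 1.
  by apply: (@le_trans _ _ 1); rewrite ?exprn_ile1// lerDl powR_ge0.
by rewrite -powR_mulrn// (le_trans (ler_powR (ltW a1) kp))// lerDr.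
Qed.

Lemma continuous_borel_measurable (R : realType) (W : ptopologicalType) (phi : W -> R) :
  continuous phi -> @measurable_fun _ _ (borel W) _ setT phi.
Proof.
move=> cphi; apply: (@measurability _ _ (borel W) _ setT phi _ (RGenOInfty.measurableE R)).
move=> _ [_ [a ->] <-]; rewrite setTI; apply: sub_sigma_algebra.
by apply: open_comp; [move=> x _; exact: cphi|exact: interval_open].
Qed.

Section LpOnBoundedOpenSet.
Context {R : realType} {n : nat}.
Notation lam := (@lebesgueRn R n).
Notation integ f := (lam.-integrable setT (EFin \o f)).
Notation nrm r f := ('N[lam]_(r%:E)[EFin \o f])%E.
Implicit Types f g h : 'rV[R]_n -> R.
Variables (Om : set 'rV[R]_n) (p : R).
Hypotheses (oOm : open Om) (bOm : bounded_set Om) (p0 : 0 < p).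

Let mOm : @measurable _ (Rn R n) Om. Proof. exact: open_Rn_measurable. Qed.

Let iOm : integ (\1_Om : 'rV[R]_n -> R).
Proof. by apply: integrable_indicT => //; exact: bounded_lebesgueRn_lty. Qed.

Lemma measurable_borel_comp (W : normedModType R) (phi : W -> R) (f : 'rV[R]_n -> W) :
  continuous phi -> @measurable_fun _ _ (Rn R n) (borel W) Om f ->
  measurable_fun (setT : set (Rn R n)) ((phi \o f) \_ Om).
Proof.
move=> cphi mf; apply/(measurable_restrictT _ mOm).1.
move=> _ B mB; rewrite comp_preimage; apply: mf => //.
by rewrite -[X in measurable X]setTI; exact: continuous_borel_measurable.
Qed.

Lemma Lnorm_comp_le (W : normedModType R) (phi : W -> R) (f : 'rV[R]_n -> W) :
  continuous phi -> (forall w, `|phi w| <= `|w|) ->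
  @measurable_fun _ _ (Rn R n) (borel W) Om f ->
  (nrm p ((phi \o f) \_ Om) <= Lp_norm Om p f)%E.
Proof.
move=> cphi phile mf; rewrite /Lp_norm unlock; apply: gt0_ler_poweR.
- by rewrite invr_ge0 ltW.
- by rewrite in_itv/= leey andbT integral_ge0// => x _; exact: poweR_ge0.
- by rewrite in_itv/= leey andbT integral_ge0// => x _; exact: poweR_ge0.
apply: ge0_le_integral => //.
- by move=> x _; exact: poweR_ge0.
- by apply/measurable_EFinP; apply: measurable_norm_powR; exact: measurable_borel_comp.
- apply/measurable_EFinP; apply: measurable_norm_powR.
  by apply: (@measurable_borel_comp _ (fun w : W => `|w|)) => //; exact: norm_continuous.
move=> x _; rewrite lee_fin; apply: ge0_ler_powR; rewrite ?nnegrE//; first exact: ltW.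
rewrite !patchE; case: ifP => _; last by rewrite !normr0.
by rewrite normr_id; exact: phile.
Qed.

Definition Lp_on f (C : R) := [/\ measurable_fun (setT : set (Rn R n)) f,
  (nrm p f <= C%:E)%E & forall x, ~ Om x -> f x = 0].

(** On a bounded set L^p embeds in L^k, through a^k <= 1 + a^p instead of Hoelder; only a uniform
    bound matters. *)
Lemma Lp_on_power f C k : Lp_on f C -> (0 < k)%N -> k%:R <= p ->
  integral_le (fun x => `|f x| ^+ k) (\int[lam]_x (\1_Om x : R) + C `^ p).
Proof.
move=> [mf fC f0] k0 kp.
have C0 : 0 <= C by rewrite -lee_fin; apply: le_trans fC; exact: Lnorm_ge0.
have [fi fE] := Lnorm_powR_integrable p0 mf (le_lt_trans fC (ltry C)).
have [I Ile] : integral_le (fun x => \1_Om x + `|f x| `^ p) (\int[lam]_x (\1_Om x : R) + C `^ p).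
  apply: integral_leD; split => //; rewrite fE; apply: ge0_ler_powR; rewrite ?nnegrE//; first exact: ltW.
    by apply: fine_ge0; exact: Lnorm_ge0.
  by rewrite -lee_fin fineK// ge0_fin_numE ?Lnorm_ge0// (le_lt_trans fC (ltry C)).
have B x : `|f x| ^+ k <= \1_Om x + `|f x| `^ p.
  rewrite indicE; have [xO|xO] := boolP (x \in Om); first exact: exprn_le_powR.
  rewrite f0 ?normr0 ?expr0n ?gtn_eqF// ?addr_ge0 ?powR_ge0//.
  by move=> /mem_set; rewrite (negbTE xO).
have J : integ (fun x => `|f x| ^+ k).
  apply: (integrable_le _ I).
    apply: measurable_funX; apply: measurableT_comp => //; exact: normr_measurable.
  by move=> x; rewrite ger0_norm ?exprn_ge0.
split => //; apply: le_trans Ile; apply: le_Rintegral => // x _; exact: B.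
Qed.

Lemma Lp_on_integrable f C : Lp_on f C -> 1 <= p -> integ f /\
  \int[lam]_x `|f x| <= \int[lam]_x (\1_Om x : R) + C `^ p.
Proof.
move=> fC p1; have [I H] := Lp_on_power fC (leqnn 1) p1.
have [mf _ _] := fC; split; last exact: H.
by apply: (integrable_le mf I) => x; rewrite expr1.
Qed.

Lemma bounded_Lp_on f (B : R) : measurable_fun (setT : set (Rn R n)) f ->
  (forall x, `|f x| <= B) -> (forall x, ~ Om x -> f x = 0) -> (nrm p f < +oo)%E.
Proof.
move=> mf fB f0; rewrite unlock; apply: poweR_lty.
have I : integ (fun x => (B `^ p) * \1_Om x) by exact: (integrableZl measurableT _ iOm).
have J : integ (fun x => `|f x| `^ p).
  apply: (integrable_le (measurable_norm_powR _ mf) I) => x.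
  rewrite ger0_norm ?powR_ge0// indicE; case: (boolP (x \in Om)) => xO.
    rewrite mulr1; apply: ge0_ler_powR; rewrite ?nnegrE//; first exact: ltW.
    exact: le_trans (fB x).
  rewrite f0 ?normr0 ?powR0 ?mulr0// ?gt_eqF//.
  by move=> /mem_set; rewrite (negbTE xO).
have /integrableP[_] := J; apply: le_lt_trans.
rewrite le_eqVlt; apply/orP; left; apply/eqP; apply: eq_integral => x _ /=.
by rewrite (ger0_norm (powR_ge0 _ _)).
Qed.

End LpOnBoundedOpenSet.

Section SobolevReduction.
Context {R : realType} {N : nat}.
Notation n := N.+1.
Notation lam := (@lebesgueRn R n).
Notation integ f := (lam.-integrable setT (EFin \o f)).
Notation nrm r f := ('N[lam]_(r%:E)[EFin \o f])%E.
Variables (Om : set 'rV[R]_n) (p : R).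
Hypotheses (oOm : open Om) (bOm : bounded_set Om) (np : n%:R <= p) (p1 : 1 < p).

Let p0 : 0 < p. Proof. exact: lt_trans p1. Qed.
Let mOm : @measurable _ (Rn R n) Om. Proof. exact: open_Rn_measurable. Qed.

Let q := p / (p - 1).
Let q0 : 0 < q. Proof. by rewrite divr_gt0// subr_gt0. Qed.
Let pq : p^-1 + q^-1 = 1.
Proof. by rewrite invf_div; field; rewrite gt_eqF. Qed.

Notation V := (('rV[R]_n -> 'rV[R]_n) * ('rV[R]_n -> 'M[R]_n))%type.
Implicit Types v : V.

Definition value v i : 'rV[R]_n -> R := (fun x => v.1 x ord0 i) \_ Om.
Definition entry v i j : 'rV[R]_n -> R := (fun x => v.2 x i j) \_ Om.

Lemma Lp_norm_fin (W : normedModType R) (f : 'rV[R]_n -> W) : Lp Om p f ->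
  Lp_norm Om p f = (fine (Lp_norm Om p f))%:E.
Proof. by move=> [_ fp]; rewrite fineK// ge0_fin_numE//; exact: Lnorm_ge0. Qed.

Lemma value_Lp_on v i : Lp Om p v.1 -> Lp_on Om p (value v i) (fine (Lp_norm Om p v.1)).
Proof.
move=> vp; have [mv _] := vp.
have cphi : continuous (fun w : 'rV[R]_n => w ord0 i) by exact: coord_continuous.
split; first exact: (measurable_borel_comp oOm cphi mv).
  rewrite -Lp_norm_fin//.
  have H := Lnorm_comp_le oOm p0 cphi (fun w => ler_norm_rV w i) mv.
  exact: H.
by move=> x xO; rewrite /value patchE memNset.
Qed.

Lemma entry_Lp_on v i j : Lp Om p v.2 -> Lp_on Om p (entry v i j) (fine (Lp_norm Om p v.2)).
Proof.
move=> vp; have [mv _] := vp.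
have cphi : continuous (fun w : 'M[R]_n => w i j) by exact: coord_continuous.
split; first exact: (measurable_borel_comp oOm cphi mv).
  rewrite -Lp_norm_fin//.
  have H := Lnorm_comp_le oOm p0 cphi (fun w => norm_entry_le w i j) mv.
  exact: H.
by move=> x xO; rewrite /entry patchE memNset.
Qed.

Lemma sobolev_W1p v : W1p Om p v -> sobolev Om (value v) (entry v).
Proof.
move=> [v1 v2 vw]; split.
- by move=> i; have [] := Lp_on_integrable oOm bOm p0 (value_Lp_on i v1) (ltW p1).
- by move=> i j; have [] := Lp_on_integrable oOm bOm p0 (entry_Lp_on i j v2) (ltW p1).
- by move=> i j; have [] := Lp_on_power oOm bOm p0 (entry_Lp_on i j v2) (ltn0Sn N) np.
move=> i j phi /(vw i j phi).
rewrite Rintegral_mkcond [X in _ = - X -> _]Rintegral_mkcond.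
have E (f g : 'rV[R]_n -> R) : ((fun x => f x * g x) \_ Om) = (fun x => (f \_ Om) x * g x).
  by apply/funext => x; rewrite !patchE; case: ifP => // _; rewrite mul0r.
by rewrite !E.
Qed.

Lemma entryD v w (a : R) i j x : entry (a *: v + w) i j x = a * entry v i j x + entry w i j x.
Proof. by rewrite /entry !patchE; case: ifP => _; rewrite ?mulr0 ?addr0//= !mxE. Qed.

Section Pairing.
Variables (g : 'rV[R]_n -> R) (i j : 'I_n).
Hypotheses (mg : measurable_fun (setT : set (Rn R n)) g) (gq : (nrm q g < +oo)%E).

(** Used with two kinds of [g]: norming functions, to bound the gradients in L^p, and translated
    mollifiers, to make the mollified gradients converge pointwise. *)
Definition pairing v := \int[lam]_x (g x * entry v i j x).

Lemma pairing_integrable v : W1p Om p v -> integ (fun x => g x * entry v i j x).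
Proof.
move=> [_ v2 _]; have [me ep _] := entry_Lp_on i j v2.
by have [] := hoelder_pairing p1 q0 pq me mg (le_lt_trans ep (ltry _)) gq.
Qed.

Lemma pairing_linear a v w : W1p Om p v -> W1p Om p w ->
  pairing (a *: v + w) = a * pairing v + pairing w.
Proof.
move=> Wv Ww; have Iv := pairing_integrable Wv; have Iw := pairing_integrable Ww.
rewrite /pairing -RintegralZl// -RintegralD//; last exact: (integrableZl measurableT a Iv).
by apply: eq_Rintegral => x _; rewrite entryD; ring.
Qed.

Lemma pairing_le v : W1p Om p v -> (`|pairing v|%:E <= nrm q g * nrm p (entry v i j))%E.
Proof.
move=> [_ v2 _]; have [me ep _] := entry_Lp_on i j v2.
by have [] := hoelder_pairing p1 q0 pq me mg (le_lt_trans ep (ltry _)) gq.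
Qed.

Lemma pairing_le_W1p v : W1p Om p v -> (`|pairing v|%:E <= nrm q g * W1p_norm Om p v)%E.
Proof.
move=> Wv; apply: (le_trans (pairing_le Wv)); have [_ v2 _] := Wv.
apply: lee_wpmul2l; first exact: Lnorm_ge0.
have [_ ep _] := entry_Lp_on i j v2; apply: (le_trans ep).
rewrite -Lp_norm_fin// /W1p_norm leeDr//; exact: Lnorm_ge0.
Qed.

Lemma pairing_dual : dual (W1p Om p) (W1p_norm Om p) pairing.
Proof.
split; first by move=> a v w; exact: pairing_linear.
exists (fine (nrm q g)) => v Wv; rewrite fineK; first exact: pairing_le_W1p.
by rewrite ge0_fin_numE// Lnorm_ge0.
Qed.

End Pairing.

Section WeaklyConvergentSequences.
Variables (v_ : nat -> V) (v : V).
Hypothesis vv : weak_cvg (W1p Om p) (W1p_norm Om p) v_ v.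

Lemma weak_cvg_W1p k : W1p Om p (v_ k). Proof. by case: vv. Qed.

(** Uniform boundedness for the pairings with norming functions: by Hoelder, the l-th one at [v_ k]
    is at most the L^p norm of the entry of [v_ k], which is the value of the k-th one there. *)
Lemma entry_norm_bounded i j : exists C, forall k, (nrm p (entry (v_ k) i j) <= C%:E)%E.
Proof.
have Wk := weak_cvg_W1p.
have fk k : (nrm p (entry (v_ k) i j) < +oo)%E.
  by have [_ v2 _] := Wk k; have [_ ep _] := entry_Lp_on i j v2; exact: le_lt_trans ep (ltry _).
have mk k : measurable_fun (setT : set (Rn R n)) (entry (v_ k) i j).
  by have [_ v2 _] := Wk k; have [me _ _] := entry_Lp_on i j v2.
have /choice[g Hg] := fun k => norming_function p1 q0 pq (mk k) (fk k).
have mg k : measurable_fun (setT : set (Rn R n)) (g k) by case: (Hg k).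
have g1 k : (nrm q (g k) <= 1)%E by case: (Hg k).
have gq k : (nrm q (g k) < +oo)%E by apply: le_lt_trans (g1 k) _; exact: ltry.
have fin k : (nrm p (entry (v_ k) i j) = (fine (nrm p (entry (v_ k) i j)))%:E)%E.
  by rewrite fineK// ge0_fin_numE ?Lnorm_ge0.
have [C HC] : exists C, forall k, pairing (g k) i j (v_ k) <= C.
  apply: (@weakly_convergent_bounded R V (W1p Om p) (W1p_norm Om p)
    (fun k => pairing (g k) i j) v_ Wk).
  - move=> f [f1 f2 _]; rewrite /W1p_norm lte_add_pinfty//; [by case: f1|by case: f2].
  - by move=> k a f h Wf Wh; exact: (@pairing_linear (g k) i j (mg k) (gq k)).
  - move=> k f Wf; apply: (le_trans (pairing_le_W1p i j (mg k) (gq k) Wf)).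
    by rewrite -[leRHS]mul1e lee_wpmul2r// adde_ge0//; exact: Lnorm_ge0.
  - move=> l k; have [_ _ E] := Hg k; rewrite [leRHS]E -lee_fin -fin.
    apply: (le_trans (pairing_le i j (mg l) (gq l) (Wk k))).
    by rewrite -[leRHS]mul1e lee_wpmul2r//; exact: Lnorm_ge0.
  - by move=> L dL; have [_ _ H] := vv; apply/cvg_ex; exists (L v); exact: H.
exists C => k; rewrite fin lee_fin; have [_ _ <-] := Hg k; exact: HC.
Qed.

Lemma entries_bounded : exists M, forall i j k,
  (nrm p (entry (v_ k) i j) <= M%:E)%E /\ (nrm p (entry v i j) <= M%:E)%E.
Proof.
have /choice[C HC] : forall ij : 'I_n * 'I_n, exists C, forall k, (nrm p (entry (v_ k) ij.1 ij.2) <= C%:E)%E.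
  by move=> ij; exact: entry_norm_bounded.
have [_ [_ v2 _] _] := vv.
exists (\sum_ij `|C ij| + `|fine (Lp_norm Om p v.2)|) => i j k; split.
  apply: (le_trans (HC (i, j) k)); rewrite lee_fin (bigD1 (i, j))//= -addrA.
  by apply: (le_trans (ler_norm _)); rewrite lerDl addr_ge0// sumr_ge0.
have [_ ep _] := entry_Lp_on i j v2; apply: (le_trans ep); rewrite lee_fin.
by apply: (le_trans (ler_norm _)); rewrite lerDr sumr_ge0.
Qed.

Lemma weak_cvg_power_integrable : exists M, [/\ forall k, power_integrable (entry (v_ k)) M,
  power_integrable (entry v) M & forall k i j, \int[lam]_x `|entry (v_ k) i j x| <= M].
Proof.
have [C HC] := entries_bounded; have [_ Wv _] := vv.
have A k i j : Lp_on Om p (entry (v_ k) i j) C.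
  have [_ v2 _] := weak_cvg_W1p k; have [me _ e0] := entry_Lp_on i j v2.
  by split => //; exact: (HC i j k).1.
have B i j : Lp_on Om p (entry v i j) C.
  have [_ v2 _] := Wv; have [me _ e0] := entry_Lp_on i j v2.
  by split => //; exact: (HC i j 0%N).2.
exists (\int[lam]_x (\1_Om x : R) + C `^ p); split.
- move=> k i j; split; first by have [] := Lp_on_integrable oOm bOm p0 (A k i j) (ltW p1).
  exact: (Lp_on_power oOm bOm p0 (A k i j) (ltn0Sn N) np).
- move=> i j; split; first by have [] := Lp_on_integrable oOm bOm p0 (B i j) (ltW p1).
  exact: (Lp_on_power oOm bOm p0 (B i j) (ltn0Sn N) np).
by move=> k i j; have [] := Lp_on_integrable oOm bOm p0 (A k i j) (ltW p1).
Qed.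

(** The mollified entry at [x] is its pairing with [eta m (x - z)] cut off to [Om], a bounded
    function on a bounded set and therefore in L^q. *)
Lemma weak_cvg_conv m i j x :
  conv (eta m) (entry (v_ k) i j) x @[k --> \oo] --> conv (eta m) (entry v i j) x.
Proof.
pose g z := eta m (x - z) * \1_Om z.
have mg : measurable_fun (setT : set (Rn R n)) g.
  apply: measurable_funM; first exact: (@measurable_kernel R n (eta m) x (@eta_continuous R n m)).
  exact: measurable_indic.
have [K K0 [EK _]] := eta_bounded_lipschitz (R := R) (n := n) m.
have gq : (nrm q g < +oo)%E.
  apply: (@bounded_Lp_on _ _ Om q oOm bOm q0 g K mg) => [z|z zO].
    rewrite /g normrM indicE; case: (z \in Om); last by rewrite normr0 mulr0.
    by rewrite normr1 mulr1.
  by rewrite /g indicE memNset// mulr0.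
have E w : conv (eta m) (entry w i j) x = pairing g i j w.
  apply: eq_Rintegral => z _; rewrite /g /entry patchE indicE.
  by case: ifP => zO; rewrite ?mulr1// !mulr0.
have [_ _ H] := vv; rewrite E; under eq_cvg do rewrite E.
by apply: H; exact: pairing_dual.
Qed.

End WeaklyConvergentSequences.
End SobolevReduction.

(** * Positivity of the limit determinant *)

Lemma subr_le_trans (R : realDomainType) (x y z w : R) : x - y - w <= 0 -> y <= z -> x - z <= w.
Proof. by move=> ? ?; lra. Qed.

Lemma ler_add_nonpos (R : realDomainType) (x y z e : R) : x - y <= z + e -> z <= 0 -> x <= y + e.
Proof. by move=> ? ?; lra. Qed.

Lemma norm_sub_le1 (R : realDomainType) (y z : R) : 0 <= y <= 1 -> 0 <= z <= 1 -> `|y - z| <= 1.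
Proof. by move=> /andP[? ?] /andP[? ?]; rewrite ler_norml; apply/andP; split; lra. Qed.

Section Preliminaries.
Context {R : realType} {n : nat}.
Notation lam := (@lebesgueRn R n).
Notation integ f := (lam.-integrable setT (EFin \o f)).
Implicit Types (f g : 'rV[R]_n -> R) (A Om : set 'rV[R]_n) (m : nat).

Lemma Rintegral_le0_ae f : integ f -> {ae lam, forall x, f x <= 0} -> \int[lam]_x f x <= 0.
Proof.
move=> fi f0; have mf := measurable_of_integrable fi.
have mg : measurable_fun (setT : set (Rn R n)) (fun x => Num.min (f x) 0).
  by apply: measurable_minr => //; exact: measurable_cst.
have gi : integ (fun x => Num.min (f x) 0).
  apply: (integrable_le mg (integrable_norm fi)) => x.
  by rewrite minEle /=; case: ifP => _; rewrite ?normr0.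
have -> : \int[lam]_x f x = \int[lam]_x Num.min (f x) 0.
  rewrite /Rintegral; congr fine; apply: ae_eq_integral => //; try exact/measurable_EFinP.
  move: f0 => [Z [mZ Z0 fZ]]; exists Z; split => // x xn; apply: fZ => fx; apply: xn => _.
  by rewrite /= (min_idPl fx).
have := @le_Rintegral _ (Rn R n) R lam setT _ (fun=> 0) measurableT gi (integrable0 lam setT).
rewrite Rintegral_cst// mul0r; apply=> x _; by rewrite ge_min lexx orbT.
Qed.

(** Mollified indicators converge in L^1 while [f] is only integrable, so [f] is cut at a level k:
    below k the error is at most k times the L^1 distance, above k it is at most |f|, whose integral
    there is small. *)
Lemma integral_mul_conv_indic A f e : @measurable _ (Rn R n) A -> (lam A < +oo)%E -> integ f -> 0 < e ->
  exists M : nat, forall m, (M <= m)%N ->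
    \int[lam]_x (conv (eta m) \1_A x * f x) <= \int[lam]_x (\1_A x * f x) + e.
Proof.
move=> mA Afin fi e0; have iA := integrable_indicT mA Afin.
have gi k : integ (cutoff f k) := integrable_cutoff fi k.
have [||_ D] := @dominated_L1 _ (Rn R n) R lam (cutoff f) f (fun x => `|f x|)
    (fun k => measurable_of_integrable (gi k)) (integrable_norm fi) _ _.
- by move=> k x; rewrite cutoffE; case: ifP => _; rewrite ?normr0.
- move=> x; apply: cvg_near_cst; exists (Num.truncn `|f x|).+1 => // k /= kk.
  by rewrite cutoffE ifT// ltW// (lt_le_trans (truncnS_gt _))// ler_nat.
have e1 : 0 < e / 2 by rewrite divr_gt0.
move: D => /cvgrPdist_le/(_ _ e1)[k _ /(_ k (leqnn k))/=].
rewrite sub0r normrN => /(le_trans (ler_norm _)) Dk.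
have e2 : 0 < e / 2 / (k%:R + 1) by rewrite divr_gt0// ltr_wpDl.
have /cvgrPdist_le/(_ _ e2)[M _ HM] := L1_approximation iA; exists M => m Mm.
have := HM m Mm; rewrite /= sub0r normrN => /(le_trans (ler_norm _)) {}HM.
have bc x := conv_indic_bounds m x mA iA.
have ci := integrable_conv m iA.
have cfi : integ (fun x => conv (eta m) \1_A x * f x).
  apply: (@integrableMl_bounded _ _ R lam _ f 1 (measurable_of_integrable ci) _ fi) => x.
  by have /andP[? ?] := bc x; rewrite ger0_norm.
have Afi : integ (fun x => \1_A x * f x).
  apply: (@integrableMl_bounded _ _ R lam _ f 1 (measurable_of_integrable iA) _ fi) => x.
  by rewrite indicE; case: (_ \in _); rewrite ?normr1 ?normr0.
have di : integ (fun x => `|conv (eta m) \1_A x - \1_A x|) := integrable_norm (integrableB measurableT ci iA).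
have hi : integ (fun x => `|cutoff f k x - f x|) := integrable_norm (integrableB measurableT (gi k) fi).
rewrite -lerBlDl -RintegralB//.
apply: (@le_trans _ _ (\int[lam]_x (k%:R * `|conv (eta m) \1_A x - \1_A x| + `|cutoff f k x - f x|))).
  apply: (le_Rintegral measurableT (integrableB measurableT cfi Afi)
    (integrableD measurableT (integrableZl measurableT k%:R di) hi)) => x _.
  rewrite -mulrBl; apply: (le_trans (ler_norm _)); rewrite normrM cutoffE.
  case: ifPn => fk; first by rewrite subrr normr0 addr0 mulrC ler_wpM2r.
  rewrite sub0r normrN -[leLHS]add0r lerD ?mulr_ge0//.
  rewrite -[leRHS]mul1r ler_wpM2r//; apply: norm_sub_le1 => //.
  by rewrite indicE; case: (_ \in _); rewrite /= ?lexx ler01.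
rewrite RintegralD//; last exact: (integrableZl measurableT k%:R di).
rewrite RintegralZl// [leRHS](splitr e); apply: lerD => //.
apply: (@le_trans _ _ ((k%:R + 1) * (e / 2 / (k%:R + 1)))).
  by apply: ler_pM => //; [apply: Rintegral_ge0|rewrite lerDl].
by rewrite mulrC divfK// gt_eqF// ltr_wpDl.
Qed.

Lemma conv_indic_support r (F : 'I_n -> R -> R) A (x : 'rV[R]_n) : bump_family r F ->
  (forall z : 'rV[R]_n, A z -> exists i, r < `|x ord0 i - z ord0 i|) -> conv (prodfun F) \1_A x = 0.
Proof.
move=> bF H; rewrite /conv.
rewrite [X in Rintegral _ _ X](_ : _ = fun=> 0); first by rewrite Rintegral_cst// mul0r.
apply/funext => z; rewrite indicE; have [zA|_] := boolP (z \in A); last by rewrite mulr0.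
have [i xi] := H z (set_mem zA).
by rewrite (prodfun_support (i := i) bF) ?mul0r// !mxE.
Qed.

(** An open, hence measurable, set between [inner Om (3 * r)] and [inner Om (2 * r)], which allows
    [Om] to be exhausted without discussing the measurability of [inner]. *)
Definition deep Om r : set 'rV[R]_n := \bigcup_(a in inner Om (3 * r)) ball a r.

Lemma open_deep Om r : open (deep Om r).
Proof. by apply: bigcup_open => a _; exact: ball_open. Qed.

Lemma deep_inner Om r : 0 < r -> deep Om r `<=` inner Om (2 * r).
Proof.
move=> r0 x [a aOm /(ball_rVP _ _ r0) ax] z xz; apply: aOm => i.
have := ax i; have := xz i; rewrite ltr_norml !ler_norml => /andP[? ?] /andP[? ?].
by apply/andP; split; lra.
Qed.

Lemma bigcup_deep Om : open Om -> Om `<=` \bigcup_k deep Om k.+1%:R^-1.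
Proof.
move=> oOm x Ox; have /nbhs_ballP[e /= e0 xeU] := open_nbhs_nbhs (conj oOm Ox).
have [k ke] : exists k : nat, k.+1%:R^-1 < e / 3.
  have [k _ /(_ k (leqnn _))/= ke] := near_infty_natSinv_lt (PosNum (divr_gt0 e0 (ltr0n R 3))).
  by exists k.
exists k => //; exists x; last exact: ballxx.
move=> z xz; apply: xeU; apply/ball_rVP => // i; apply: le_lt_trans (xz i) _.
by rewrite mulrC -ltr_pdivlMr.
Qed.

End Preliminaries.

(** The difference of d and 2 t - t^2 / d is (d - t)^2 / d. The weight [phi] is dropped from the
    term in [b] because it is at most 1. *)
Lemma tangent_inverse_le (R : realFieldType) (d t b phi : R) :
  0 < d -> d^-1 <= b -> 0 <= phi <= 1 -> phi * (2 * t) - t ^+ 2 * b <= phi * d.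
Proof.
move=> d0 db /andP[p0 p1].
have H : 2 * t - t ^+ 2 * d^-1 <= d.
  rewrite -subr_ge0 (_ : _ - _ = (d - t) ^+ 2 / d); last by field; rewrite gt_eqF.
  by rewrite divr_ge0 ?sqr_ge0// ltW.
have b0 : 0 <= d^-1 by rewrite invr_ge0 ltW.
have t0 : 0 <= t ^+ 2 by exact: sqr_ge0.
have H1 : phi * (2 * t - t ^+ 2 * d^-1) <= phi * d by exact: ler_wpM2l.
have H2 : phi * (t ^+ 2 * d^-1) <= t ^+ 2 * b.
  rewrite -[leRHS]mul1r; apply: ler_pM => //; first exact: mulr_ge0.
  exact: ler_wpM2l.
by move: H1; rewrite mulrBr; lra.
Qed.

Section LimitDeterminant.
Context {R : realType} {N : nat}.
Notation n := N.+1.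
Notation lam := (@lebesgueRn R n).
Notation integ f := (lam.-integrable setT (EFin \o f)).
Notation V := (('rV[R]_n -> 'rV[R]_n) * ('rV[R]_n -> 'M[R]_n))%type.
Variables (Om : set 'rV[R]_n) (p : R).
Hypotheses (oOm : open Om) (bOm : bounded_set Om) (np : n%:R <= p) (p1 : 1 < p).
Variables (v_ : nat -> V) (v : V) (b_ : nat -> 'rV[R]_n -> R) (c : R).
Hypothesis vv : weak_cvg (W1p Om p) (W1p_norm Om p) v_ v.
Hypotheses (b_c : forall k, integral_le (b_ k) c) (b_ge0 : forall k x, 0 <= b_ k x).
Hypothesis det_b : forall k, {ae lam, forall x, Om x ->
  0 < \det ((v_ k).2 x) /\ (\det ((v_ k).2 x))^-1 <= b_ k x}.

Let mOm : @measurable _ (Rn R n) Om. Proof. exact: open_Rn_measurable. Qed.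

Let detE w x : Om x -> \det (\matrix_(i, j) entry Om w i j x) = \det (w.2 x).
Proof.
by move=> Ox; congr determinant; apply/matrixP => i j; rewrite mxE /entry patchE mem_set.
Qed.

Let d x := \det (\matrix_(i, j) entry Om v i j x).

(** The depth 2 r is shared: one r for the spread of the mollified indicator of [A], the other for
    the distance that its support must keep from the complement of [Om]. *)
Lemma null_nonpositive_det A r : @measurable _ (Rn R n) A -> 0 < r ->
  A `<=` inner Om (2 * r) -> (forall x, A x -> d x <= 0) -> lam A = 0%E.
Proof.
move=> mA r0 Ar Ad.
have AO : A `<=` Om by move=> x /Ar; apply => i; rewrite subrr normr0 mulr_ge0// ltW.
have bA : bounded_set A.
  by have [B [Br HB]] := bOm; exists B; split => // C BC x Ax; exact: HB BC x (AO x Ax).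
have Afin : (lam A < +oo)%E by exact: bounded_lebesgueRn_lty.
have iA := integrable_indicT mA Afin.
have [M [GkM GM GkC]] := weak_cvg_power_integrable oOm bOm np p1 vv.
have SG k := sobolev_W1p oOm bOm np p1 (weak_cvg_W1p vv k).
have SG0 : sobolev Om (value Om v) (entry Om v) by have [_ Wv _] := vv; exact: (sobolev_W1p oOm bOm np p1 Wv).
have di : integ d := integrable_det GM.
have [q Aq] : exists q, A `<=` cube q.
  have [B [_ /(_ (B + 1))]] := bA; rewrite ltrDl ltr01 => /(_ isT) AB.
  exists (Num.truncn (B + 1)) => x /AB xB.
  rewrite /cube mx_norm_ball /ball_/= sub0r normrN; apply: le_lt_trans xB _; exact: truncnS_gt.
set a := \int[lam]_x (\1_A x : R).
have a0 : 0 <= a by apply: Rintegral_ge0 => x _; rewrite indicE.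
have main t m : 0 < t -> m.+1%:R^-1 <= r ->
    2 * t * a - t ^+ 2 * c <= \int[lam]_x (conv (eta m) \1_A x * d x).
  move=> t0 mr; set phi := conv (eta m) \1_A.
  have phiC := C1b_conv m iA.
  have bphi x : 0 <= phi x <= 1 := conv_indic_bounds m x mA iA.
  have supp (x : 'rV[R]_n) (P : (forall z : 'rV[R]_n, A z -> exists i, m.+1%:R^-1 < `|x ord0 i - z ord0 i|)) :
      phi x = 0 /\ forall j, conv (prodfun (dprod j (fun _ : 'I_n => @moll R m))) \1_A x = 0.
    split; first exact: conv_indic_support (moll_family m) P.
    by move=> j; exact: conv_indic_support (bump_family_dprod j (moll_family m)) P.
  (* If some z in [A] were within 1/(m+1) <= r of x, every y within r of x would be within 2 r of z,
     hence in [Om]. *)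
  have phi_inner x : ~ inner Om r x ->
      phi x = 0 /\ forall j, conv (prodfun (dprod j (fun _ : 'I_n => @moll R m))) \1_A x = 0.
    move=> xr; apply: supp => z Az; apply: contrapT => H; apply: xr => y xy.
    apply: (Ar z Az) => i; have := xy i; have {}H : `|x ord0 i - z ord0 i| <= m.+1%:R^-1.
      by rewrite leNgt; apply/negP => h; apply: H; exists i.
    have {}H := le_trans H mr => xyi.
    rewrite mulr_natl mulr2n -(subrKA (x ord0 i)); apply: (le_trans (ler_normD _ _)).
    by rewrite distrC lerD.
  have phi_cube : exists k, forall x, ~ cube k x ->
      phi x = 0 /\ forall j, conv (prodfun (dprod j (fun _ : 'I_n => @moll R m))) \1_A x = 0.
    exists q.+1 => x xq; apply: supp => z Az; apply: contrapT => H; apply: xq.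
    have xz : `|z - x| <= 1.
      rewrite leNgt; apply/negP => h; apply: H; apply: contrapT => H.
      suff : `|z - x| <= 1 by rewrite leNgt h.
      apply/ler_addgt0Pr => e e0; apply/ltW/norm_rVP; first by rewrite ltr_wpDl.
      move=> i; rewrite !mxE; apply: (@le_lt_trans _ _ m.+1%:R^-1).
        by rewrite leNgt distrC; apply/negP => h'; apply: H; exists i.
      by apply: (@le_lt_trans _ _ 1); rewrite ?invf_le1 ?ler1n// ltrDl.
    apply: contrapT => xq; have := cube_shift xz xq; rewrite addrC subrK; apply; exact: Aq.
  have Hk := det_weak_continuity phiC phi_cube r0 phi_inner SG SG0 GkM GM GkC
    (fun m i j x => @weak_cvg_conv R N Om p oOm bOm p1 v_ v vv m i j x).
  have phii : integ phi := integrable_conv m iA.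
  rewrite -(cvg_lim _ Hk)//; apply: limr_ge; first by apply/cvg_ex; eexists; exact: Hk.
  apply: nearW => k; have [bi bc] := b_c k.
  have dki := integrable_test_det phiC (GkM k).
  have pti : integ (fun x => phi x * (2 * t)).
    under [X in EFin \o X]eq_fun do rewrite mulrC.
    exact: (integrableZl measurableT (2 * t) phii).
  have tbi := integrableZl measurableT (t ^+ 2) bi.
  have hi : integ (fun x => phi x * (2 * t) - t ^+ 2 * b_ k x -
      phi x * \det (\matrix_(i, j) entry Om (v_ k) i j x)).
    exact: (integrableB measurableT (integrableB measurableT pti tbi) dki).
  have h0 : {ae lam, forall x, phi x * (2 * t) - t ^+ 2 * b_ k x -
      phi x * \det (\matrix_(i, j) entry Om (v_ k) i j x) <= 0}.
    have [Z [mZ Z0 dZ]] := det_b k; exists Z; split => // x xn; apply: dZ => dx; apply: xn.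
    have [Ox|nOx] := pselect (Om x).
      by have [d0 db] := dx Ox; rewrite /= subr_le0 detE//; exact: tangent_inverse_le.
    have [|phix _] := phi_inner x.
      by move=> xr; apply: nOx; apply: xr => i; rewrite subrr normr0 ltW.
    by rewrite /= phix !mul0r sub0r subr0 oppr_le0 mulr_ge0 ?sqr_ge0.
  have := Rintegral_le0_ae hi h0.
  rewrite RintegralB//; last exact: (integrableB measurableT pti tbi).
  rewrite RintegralB// RintegralZl// RintegralZr// (integral_conv m iA); last by move=> x; rewrite indicE.
  rewrite -/a [a * _]mulrC => H; apply: (subr_le_trans H).
  by apply: ler_wpM2l bc; exact: sqr_ge0.
have lim t : 0 < t -> 2 * t * a <= t ^+ 2 * c.
  move=> t0; apply/ler_addgt0Pr => e e0.
  have [m0 Hm] := integral_mul_conv_indic mA Afin di e0.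
  pose m := maxn m0 (Num.truncn r^-1).
  have mr : m.+1%:R^-1 <= r.
    rewrite invf_ple ?posrE// (le_trans (ltW (truncnS_gt _)))// ler_nat ltnS leq_maxr//.
  apply: (ler_add_nonpos (le_trans (main t m t0 mr) (Hm m (leq_maxl _ _)))).
  have Adi : integ (fun x => \1_A x * d x).
    apply: (@integrableMl_bounded _ _ R lam _ d 1 (measurable_of_integrable iA) _ di) => x.
    by rewrite indicE; case: (_ \in _); rewrite ?normr1 ?normr0.
  have := le_Rintegral measurableT Adi (integrable0 lam setT).
  rewrite Rintegral_cst// mul0r; apply=> x _; rewrite indicE.
  by have [xA|_] := boolP (x \in A); rewrite ?mul0r// mul1r; exact: Ad (set_mem xA).
have c0 : 0 <= c.
  by apply: le_trans (b_c 0%N).2; apply: Rintegral_ge0 => x _; exact: b_ge0.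
have : a <= 0.
  rewrite leNgt; apply/negP => a_gt0.
  (* With this t, 2 t a <= t^2 c reads 2 a <= a c / (c + 1), impossible for a > 0; the added 1
     covers c = 0. *)
  have t0 : 0 < a / (c + 1) by rewrite divr_gt0// ltr_wpDl.
  have := lim _ t0; rewrite expr2 -mulrA mulrCA -mulrA ler_pM2l// mulrAC ler_pdivlMr ?ltr_wpDl//.
  by rewrite -mulrA mulrCA ler_pM2l//; lra.
rewrite /a Rintegral_indic// => Aa; apply/eqP; rewrite -fine_eq0 ?ge0_fin_numE//.
by rewrite eq_le Aa fine_ge0.
Qed.

Theorem ae_det_gt0 : {ae lam, forall x, Om x -> 0 < \det (v.2 x)}.
Proof.
have [M [_ GM _]] := weak_cvg_power_integrable oOm bOm np p1 vv.
have md := measurable_det_Rn GM.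
(* Each piece stays away from the boundary, as [null_nonpositive_det] requires, and the pieces cover
   the exceptional set by [bigcup_deep]. *)
pose A k := [set x | d x <= 0] `&` deep Om k.+1%:R^-1.
have mA k : @measurable _ (Rn R n) (A k).
  apply: measurableI; last by apply: open_Rn_measurable; exact: open_deep.
  rewrite -[X in measurable X]setTI.
  by apply: (@measurable_fun_ler _ (Rn R n) R setT d (cst 0)) => //; exact: measurable_cst.
have A0 k : lam (A k) = 0%E.
  have k0 : 0 < k.+1%:R^-1 :> R by rewrite invr_gt0.
  by apply: (null_nonpositive_det (mA k) k0) => [x [_]|x []//]; exact: deep_inner.
have : lam.-negligible (\bigcup_k A k).
  by apply: negligible_bigcup => k; apply/negligibleP; [exact: mA|exact: A0].
apply: negligibleS => x /= /not_implyP[Ox /negP]; rewrite -leNgt => dx.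
have [k _ xk] := bigcup_deep oOm Ox; exists k => //; split => //=.
by rewrite /d detE.
Qed.

End LimitDeterminant.

(** * Support of the Young measure *)

Section InverseDeterminant.
Context {R : realType} {N : nat}.
Notation n := N.+1.
Notation lam := (@lebesgueRn R n).
Variables (Om : set 'rV[R]_n) (p : R).
Hypotheses (oOm : open Om) (bOm : bounded_set Om) (np : n%:R <= p) (p1 : 1 < p).

(** 1/det A is det A^-1, hence at most n! times the sum of the n-th powers of the entries of A^-1,
    and n <= p makes these uniformly integrable to the first power. The zero first component of [w]
    only serves to reuse [entry]. *)
Lemma inverse_det_bound (A_ : nat -> 'rV[R]_n -> 'M[R]_n) (C : R) :
  (forall k, Lp Om p (fun x => invmx (A_ k x))) ->
  (forall k, (Lp_norm Om p (fun x => invmx (A_ k x)) <= C%:E)%E) ->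
  exists (b_ : nat -> 'rV[R]_n -> R) (c : R), [/\ forall k, integral_le (b_ k) c,
    forall k x, 0 <= b_ k x &
    forall k x, Om x -> 0 < \det (A_ k x) -> (\det (A_ k x))^-1 <= b_ k x].
Proof.
move=> LA LC; pose w k : ('rV[R]_n -> 'rV[R]_n) * ('rV[R]_n -> 'M[R]_n) :=
  (fun=> 0, fun x => invmx (A_ k x)).
have p0 : 0 < p by exact: lt_trans p1.
have wC k i j : Lp_on Om p (entry Om (w k) i j) C.
  have [me ep e0] := entry_Lp_on oOm p1 (v := w k) i j (LA k).
  by split; [exact: me|apply: (le_trans ep); rewrite -Lp_norm_fin; [exact: LC|exact: LA]|exact: e0].
exists (fun k x => n`!%:R * \sum_i \sum_j `|entry Om (w k) i j x| ^+ n).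
exists (n`!%:R * \sum_(i < n) \sum_(j < n) (\int[lam]_x (\1_Om x : R) + C `^ p)); split.
- move=> k; apply: integral_leZ => //; apply: integral_le_sum => i; apply: integral_le_sum => j.
  exact: (Lp_on_power oOm bOm p0 (wC k i j) (ltn0Sn N) np).
- move=> k x; rewrite mulr_ge0//; apply: sumr_ge0 => i _; apply: sumr_ge0 => j _.
  exact: exprn_ge0.
move=> k x Ox dx; rewrite -det_inv.
apply: (le_trans (ler_norm _)); apply: le_trans (det_le _).
rewrite le_eqVlt; apply/orP; left; apply/eqP; congr (`| \det _ |).
by apply/matrixP => i j; rewrite mxE /entry patchE mem_set.
Qed.

End InverseDeterminant.

Section DeterminantTest.
Context {R : realType} {n : nat}.
Implicit Types (s : 'M[R]_n) (m : nat).

Definition det_test m s : R := Num.max 0 (1 - m.+1%:R * Num.max (\det s) 0).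

Lemma det_test_bounds m s : 0 <= det_test m s <= 1.
Proof.
rewrite /det_test le_max lexx/= ge_max ler01/= gerBl mulr_ge0//.
by rewrite le_max lexx orbT.
Qed.

Lemma det_test_nonpos m s : \det s <= 0 -> det_test m s = 1.
Proof. by move=> s0; rewrite /det_test (max_idPr s0) mulr0 subr0; apply/max_idPr. Qed.

Lemma det_test_le m s : 0 < \det s -> det_test m s <= m.+1%:R^-1 * (\det s)^-1.
Proof.
move=> s0; rewrite /det_test (max_idPl (ltW s0)) -invfM.
have y0 : 0 < m.+1%:R * \det s by rewrite mulr_gt0.
move: y0; set y := _ * _ => y0; rewrite ge_max invr_ge0 ltW//=.
(* This is 1 - y <= 1/y for y > 0. *)
rewrite -subr_ge0 (_ : _ - _ = ((y - 1) ^+ 2 + y) / y); last by field; rewrite gt_eqF.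
by rewrite divr_ge0 ?addr_ge0 ?sqr_ge0// ltW.
Qed.

Lemma continuous_det : continuous (fun s : 'M[R]_n => \det s).
Proof.
move=> s; have := @cvg_det R n _ (nbhs s) _ (fun t i j => t i j) (s : 'I_n -> 'I_n -> R).
have mE (t : 'M[R]_n) : \matrix_(i, j) t i j = t by apply/matrixP => i j; rewrite mxE.
rewrite mE; under eq_cvg do rewrite mE.
by apply => i j; exact: coord_continuous.
Qed.

Lemma continuous_det_test m : continuous (det_test m).
Proof.
move=> s.
apply: (@continuous_max R _ (fun=> 0) (fun s => 1 - m.+1%:R * Num.max (\det s) 0) s).
  exact: cst_continuous.
apply: continuousB; first exact: cst_continuous.
apply: continuousM; first exact: cst_continuous.
apply: (@continuous_max R _ (fun s : 'M[R]_n => \det s) (fun=> 0) s); first exact: continuous_det.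
exact: cst_continuous.
Qed.

Lemma det_test_vanishes (p : R) m : 1 <= p ->
  vanishes_at_infinity (fun s : 'M[R]_n => det_test m s / `|s| `^ p).
Proof.
move=> p1 e e0; exists (Num.max 1 e^-1) => s; rewrite gt_max => /andP[s1 se].
have s0 : 0 < `|s| by exact: lt_trans s1.
have sp : `|s| <= `|s| `^ p by rewrite -{1}(powRr1 (ltW s0)) ler_powR// ltW.
have q0 : 0 < `|s| `^ p by exact: lt_le_trans sp.
have /andP[v0 v1] := det_test_bounds m s.
rewrite normrM normfV (ger0_norm v0) (gtr0_norm q0) ltr_pdivrMr//.
apply: (le_lt_trans v1); rewrite mulrC -ltr_pdivrMr// div1r.
exact: lt_le_trans se sp.
Qed.

End DeterminantTest.

Lemma le_inv_nat_le0 (R : realType) (x c : R) : (forall m : nat, x <= m.+1%:R^-1 * c) -> x <= 0.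
Proof.
move=> H; rewrite leNgt; apply/negP => x0; have := H (Num.truncn (`|c| / x)).
have := truncnS_gt (`|c| / x); rewrite ltr_pdivrMr// => cx.
rewrite mulrC ler_pdivlMr// mulrC => /(lt_le_trans cx).
by rewrite ltNge ler_norm.
Qed.

Section YoungMeasureSupport.
Context {R : realType} {N : nat}.
Notation n := N.+1.
Notation lam := (@lebesgueRn R n).
Notation integ f := (lam.-integrable setT (EFin \o f)).
Variables (Om : set 'rV[R]_n) (p : R).
Hypotheses (oOm : open Om) (bOm : bounded_set Om) (p1 : 1 < p).
Variables (Y : nat -> 'rV[R]_n -> 'M[R]_n) (nu : 'rV[R]_n -> probability (borel 'M[R]_n) R).
Hypothesis Ynu : generates Om p Y nu.
Variables (b_ : nat -> 'rV[R]_n -> R) (c : R).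
Hypotheses (b_c : forall k, integral_le (b_ k) c) (b_ge0 : forall k x, 0 <= b_ k x).
Hypothesis det_b : forall k, {ae lam, forall x, Om x ->
  0 < \det (Y k x) /\ (\det (Y k x))^-1 <= b_ k x}.

Let mOm : @measurable _ (Rn R n) Om. Proof. exact: open_Rn_measurable. Qed.

Lemma Lp1_integrable (f : 'rV[R]_n -> R^o) : @Lp R n Om 1 R^o f ->
  integ (f \_ Om) /\ @Lp_norm R n Om 1 R^o f = (\int[lam]_x `|(f \_ Om) x|)%:E.
Proof.
move=> [mf f1].
have mf' : measurable_fun (setT : set (Rn R n)) (f \_ Om).
  have H := @measurable_borel_comp R n Om oOm R^o (fun w => w) f (fun w => cvg_id) mf.
  exact: H.
have E : @Lp_norm R n Om 1 R^o f = (\int[lam]_x `|((f \_ Om) x)%:E|)%E.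
  rewrite /Lp_norm Lnorm1; apply: eq_integral => x _ /=.
  by rewrite !patchE; case: ifP => _; rewrite ?normr_id ?normr0.
have I : integ (f \_ Om).
  by apply/integrableP; split; [exact/measurable_EFinP|rewrite /= -E].
split => //; rewrite E -[LHS]fineK//.
exact: (integrable_fin_num measurableT (integrable_norm I)).
Qed.

(** Weak convergence in L^1 is tested only against the constant 1 on [Om], which is enough to pass
    the bound on the integrals to the limit. *)
Lemma dual_integral : dual (@Lp R n Om 1 R^o) (@Lp_norm R n Om 1 R^o)
  (fun f => \int[lam]_x (f \_ Om) x).
Proof.
split=> [a f g Lf Lg|].
  have [If _] := Lp1_integrable Lf; have [Ig _] := Lp1_integrable Lg.
  rewrite -RintegralZl// -RintegralD//; last exact: (integrableZl measurableT a If).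
  apply: eq_Rintegral => x _; rewrite !patchE; case: ifP => // _.
  by rewrite mulr0 addr0.
exists 1 => f Lf; have [If ->] := Lp1_integrable Lf.
by rewrite mul1e lee_fin; exact: (le_normr_Rintegral measurableT If).
Qed.

Let g m : 'rV[R]_n -> R := (fun x => \int[nu x]_s det_test m s) \_ Om.

Lemma Rintegral_det_test m : integ (g m) /\ \int[lam]_x g m x <= m.+1%:R^-1 * c.
Proof.
have [_ _ _ H] := Ynu.
have [_ [LY Lg Hw]] := H _ (@continuous_det_test R n m) (@det_test_vanishes R n p m (ltW p1)).
have [gi _] := Lp1_integrable Lg; split => //.
have {}Hw := Hw _ dual_integral; rewrite -(cvg_lim _ Hw)//.
apply: limr_le; first by apply/cvg_ex; eexists; exact: Hw.
apply: nearW => k; have [Yi _] := Lp1_integrable (LY k).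
have m0 : 0 <= m.+1%:R^-1 :> R by rewrite invr_ge0.
have [bi bc] := integral_leZ m0 (b_c k).
apply: le_trans bc; rewrite -subr_le0 -RintegralB//.
apply: Rintegral_le0_ae; first exact: (integrableB measurableT Yi bi).
have [Z [mZ Z0 dZ]] := det_b k; exists Z; split => // x xn; apply: dZ => dx; apply: xn => /=.
rewrite patchE; case: ifPn => xO; last by rewrite sub0r oppr_le0 mulr_ge0.
have [d0 db] := dx (set_mem xO).
rewrite subr_le0; apply: (le_trans (det_test_le m d0)).
exact: ler_wpM2l.
Qed.

Lemma borel_det_nonpos : @measurable _ (borel 'M[R]_n) [set s : 'M[R]_n | \det s <= 0].
Proof.
have := continuous_borel_measurable (@continuous_det R n) measurableT (measurable_itv `]-oo, 0%R]).
by rewrite setTI.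
Qed.

Lemma nonpos_le_det_test m x :
  (nu x [set s : 'M[R]_n | (\det s <= 0)%R] <= (\int[nu x]_s det_test m s)%:E)%E.
Proof.
have mt : @measurable_fun _ _ (borel 'M[R]_n) _ setT (@det_test R n m).
  exact: continuous_borel_measurable (@continuous_det_test R n m).
have ti : (nu x).-integrable setT (EFin \o @det_test R n m).
  apply/integrableP; split; first exact/measurable_EFinP.
  apply: (@le_lt_trans _ _ (\int[nu x]_s 1)%E); last first.
    rewrite integral_cst// mul1e; apply: (le_lt_trans (probability_le1 (nu x) measurableT)).
    exact: ltry.
  apply: ge0_le_integral => //.
  - by apply/measurable_EFinP; apply: measurableT_comp => //; exact: normr_measurable.
  - exact: measurable_cst.
  move=> s _; have /andP[v0 v1] := det_test_bounds m s.
  by rewrite lee_fin ger0_norm.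
rewrite /Rintegral fineK; last exact: (integrable_fin_num measurableT ti).
rewrite -[X in nu x X]setIT -integral_indic//; last exact: borel_det_nonpos.
apply: ge0_le_integral => //.
- apply/measurable_EFinP; apply: measurable_indic; exact: borel_det_nonpos.
- exact/measurable_EFinP.
move=> s _; rewrite lee_fin indicE; have [sD|_] := boolP (s \in _).
  by rewrite (det_test_nonpos m (set_mem sD)).
by have /andP[] := det_test_bounds m s.
Qed.

(** Measurability of x |-> [nu x] of a set is never established, so the argument runs through the
    functions [g m]: on [Z j] all of them are at least 1/(j+1) while their integrals are O(1/m),
    hence [Z j] is null; a point where the nonpositive determinants carry positive mass lies in some
    [Z j]. *)
Theorem young_support : {ae lam, forall x, Om x -> nu x [set A : 'M[R]_n | 0 < \det A] = 1%E}.
Proof.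
pose Z j := \bigcap_m [set x | j.+1%:R^-1 <= g m x].
have mg m : measurable_fun (setT : set (Rn R n)) (g m).
  exact: measurable_of_integrable (Rintegral_det_test m).1.
have mZ j : @measurable _ (Rn R n) (Z j).
  apply: bigcapT_measurable => m.
  have := mg m measurableT _ (measurable_itv `[j.+1%:R^-1, +oo[); rewrite setTI; congr (measurable _).
  by apply/seteqP; split => x /=; rewrite in_itv/= andbT.
have ZO j : Z j `<=` Om.
  move=> x /(_ 0%N I) /=; rewrite /g patchE; case: ifPn => [/set_mem//|_].
  by rewrite leNgt invr_gt0 ltr0n.
have Z0 j : lam (Z j) = 0%E.
  have Zfin : (lam (Z j) < +oo)%E.
    apply: bounded_lebesgueRn_lty => //; have [B [Br HB]] := bOm.
    by exists B; split => // C BC x Zx; exact: HB BC x (ZO j x Zx).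
  have iZ := integrable_indicT (mZ j) Zfin.
  have r0 : 0 < j.+1%:R^-1 :> R by rewrite invr_gt0.
  have H m : j.+1%:R^-1 * fine (lam (Z j)) <= m.+1%:R^-1 * c.
    have [gi gc] := Rintegral_det_test m; apply: le_trans gc.
    rewrite -Rintegral_indic// -RintegralZl//.
    apply: (le_Rintegral measurableT (integrableZl measurableT _ iZ) gi) => x _.
    rewrite indicE; have [xZ|_] := boolP (x \in Z j).
      by rewrite mulr1; exact: (set_mem xZ) m I.
    rewrite mulr0 /g patchE; case: ifP => // _.
    by apply: Rintegral_ge0 => s _; have /andP[] := det_test_bounds m s.
  have F0 : fine (lam (Z j)) <= 0.
    by rewrite -(pmulr_rle0 _ r0); exact: (le_inv_nat_le0 H).
  apply/eqP; rewrite -fine_eq0 ?ge0_fin_numE//; rewrite eq_le F0 fine_ge0//.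
have : lam.-negligible (\bigcup_j Z j).
  by apply: negligible_bigcup => j; apply/negligibleP; [exact: mZ|exact: Z0].
apply: negligibleS => x /= /not_implyP[Ox nx].
have nuE : nu x [set s : 'M[R]_n | (\det s <= 0)%R] =
    (fine (nu x [set s : 'M[R]_n | (\det s <= 0)%R]))%:E.
  by rewrite fineK// fin_num_measure//; exact: borel_det_nonpos.
have [h0|h0] := leP (fine (nu x [set s : 'M[R]_n | (\det s <= 0)%R])) 0.
  exfalso; apply: nx.
  rewrite (_ : [set A | _] = ~` [set s : 'M[R]_n | \det s <= 0]); last first.
    by apply/seteqP; split => s /=; rewrite leNgt; [move=> ->|move/negP; rewrite negbK].
  rewrite (probability_setC _ borel_det_nonpos) nuE.
  by rewrite (_ : fine _ = 0) ?sube0//; apply/eqP; rewrite eq_le h0 fine_ge0.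
have [j _ /(_ j (leqnn _))/= hj] := near_infty_natSinv_lt (PosNum h0).
exists j => // m _ /=; rewrite /g patchE mem_set//; apply: (le_trans (ltW hj)).
by rewrite -lee_fin -nuE; exact: nonpos_le_det_test.
Qed.

End YoungMeasureSupport.

Theorem proposition2p5 (R : realType) (n : nat) (n_gt0 : (0 < n)%N)
  (Omega : set 'rV[R]_n) (Omega_lip : lipschitz_domain Omega)
  (p : R) (n_lt_p : n%:R < p)
  (y_ : nat -> 'rV[R]_n -> 'rV[R]_n) (Dy_ : nat -> 'rV[R]_n -> 'M[R]_n)
  (y : 'rV[R]_n -> 'rV[R]_n) (Dy : 'rV[R]_n -> 'M[R]_n)
  (y_cvg : weak_cvg (W1p Omega p) (W1p_norm Omega p)
             (fun k => (y_ k, Dy_ k)) (y, Dy))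
  (det_gt0 : forall k,
     {ae @lebesgueRn R n, forall x, Omega x -> 0 < \det (Dy_ k x)})
  (inv_Lp : forall k, Lp Omega p (fun x => invmx (Dy_ k x)))
  (inv_bounded : exists C : R, forall k,
     (Lp_norm Omega p (fun x => invmx (Dy_ k x)) <= C%:E)%E) :
  {ae @lebesgueRn R n, forall x, Omega x -> 0 < \det (Dy x)} /\
  (forall (sigma : nat -> nat) (nu : 'rV[R]_n -> probability (borel 'M[R]_n) R),
     {homo sigma : i j / (i < j)%N} ->
     generates Omega p (fun k => Dy_ (sigma k)) nu ->
     {ae @lebesgueRn R n, forall x, Omega x ->
        nu x [set A : 'M[R]_n | 0 < \det A] = 1%E}).
Proof.
have [oOm _ _ bOm _] := Omega_lip; have [C inv_C] := inv_bounded.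
case: n n_gt0 Omega Omega_lip n_lt_p y_ Dy_ y Dy y_cvg det_gt0 inv_Lp {inv_bounded} oOm bOm inv_C
  => // N _ Om _ np y_ Dy_ y Dy y_cvg det_gt0 inv_Lp oOm bOm inv_C.
(* From 1 <= n < p; this makes the conjugate exponent p / (p - 1) finite, on which the duality
   argument rests. *)
have p1 : 1 < p by apply: le_lt_trans np; rewrite ler1n.
have [b_ [c [b_c b_ge0 bP]]] := inverse_det_bound oOm bOm (ltW np) p1 inv_Lp inv_C.
have det_b k : {ae @lebesgueRn R N.+1, forall x, Om x ->
    0 < \det (Dy_ k x) /\ (\det (Dy_ k x))^-1 <= b_ k x}.
  have [Z [mZ Z0 dZ]] := det_gt0 k; exists Z; split => // x xn; apply: dZ => dx; apply: xn => Ox.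
  by have d0 := dx Ox; split; [|exact: bP].
split=> [|sigma nu _ Ynu].
  exact: (ae_det_gt0 oOm bOm (ltW np) p1 y_cvg b_c b_ge0 det_b).
exact: (young_support oOm bOm p1 Ynu (fun k => b_c (sigma k)) (fun k => b_ge0 (sigma k))
  (fun k => det_b (sigma k))).
Qed.
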